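(* Let $n\ge 1$ be an integer and let $\mathfrak{g}=\mathfrak{sl}_2(\mathbb{C})\ltimes V_{2n-1}$. Then the adjoint cohomology of $\mathfrak{g}$ satisfies $$H^0(\mathfrak{g},\mathfrak{g})=0,\quad H^1(\mathfrak{g},\mathfrak{g})\cong\mathbb{C},\quad H^2(\mathfrak{g},\mathfrak{g})=0,\quad H^3(\mathfrak{g},\mathfrak{g})\cong\mathbb{C}^{\lfloor\frac{n+1}{3}\rfloor},\quad H^4(\mathfrak{g},\mathfrak{g})\cong\mathbb{C}.$$
   Context: For $m\ge 1$, $V_m$ denotes the irreducible $\mathfrak{sl}_2(\mathbb{C})$-module of dimension $m+1$. The semidirect product $\mathfrak{sl}_2(\mathbb{C})\ltimes V_m$ is the vector space $\mathfrak{sl}_2(\mathbb{C})\oplus V_m$ with Lie bracket $[(X,v),(Y,u)]=([X,Y],Xu-Yv)$, so that $V_m$ is an abelian ideal. $H^k(\mathfrak{g},\mathfrak{g})$ denotes the $k$-th Lie algebra (Chevalley–Eilenberg) cohomology of $\mathfrak{g}$ with coefficients in the adjoint module. *)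

(* Defs.v *)
From HB Require Import structures.
From mathcomp Require Import all_boot all_order all_algebra.
From mathcomp Require Import generic_quotient ring_quotient.
From mathcomp Require Import boolp functions reals complex.
From mathcomp Require Import ring.

Set Implicit Arguments.
Unset Strict Implicit.
Unset Printing Implicit Defensive.

Import Order.TTheory GRing.Theory Num.Theory.
Local Open Scope ring_scope.
Local Open Scope quotient_scope.

Section LmodQuotient.
Variables (F : nzRingType) (V : lmodType F) (S : submodClosed V).

(* Quotient.quot expects a zmodClosed predicate, which submodClosed does not
   inherit from, hence this copy of S. *)
Definition submod_pred : {pred V} := S.

Fact submod_pred_zmod : zmod_closed submod_pred.
Proof.
by split=> [|u v Su Sv]; rewrite ?rpred0 // -scaleN1r rpredD ?rpredZ.
Qed.
HB.instance Definition _ :=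
  GRing.isZmodClosed.Build V submod_pred submod_pred_zmod.

Definition lmod_quot : Type := Quotient.quot submod_pred.
HB.instance Definition _ := GRing.Zmodule.on lmod_quot.
HB.instance Definition _ := ZmodQuotient.on lmod_quot.

Definition lmod_quot_scale (a : F) (q : lmod_quot) : lmod_quot :=
  \pi_lmod_quot (a *: repr q).

Lemma lmod_quot_piE (u v : V) :
  (\pi_lmod_quot u = \pi_lmod_quot v) <-> (u - v \in S).
Proof.
by split=> [/eqP|Suv]; [|apply/eqP]; rewrite -(Quotient.idealrBE submod_pred).
Qed.

Lemma lmod_quot_piZ (a : F) (v : V) :
  lmod_quot_scale a (\pi_lmod_quot v) = \pi_lmod_quot (a *: v).
Proof.
apply/lmod_quot_piE; rewrite -scalerBr; apply: rpredZ.
by apply/lmod_quot_piE; rewrite reprK.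
Qed.

Lemma lmod_quot_piD (u v : V) :
  \pi_lmod_quot (u + v) = \pi_lmod_quot u + \pi_lmod_quot v.
Proof. exact: (raddfD (\pi_(Quotient.quot submod_pred))). Qed.

Lemma lmod_quot_ind (P : lmod_quot -> Prop) :
  (forall v : V, P (\pi_lmod_quot v)) -> forall q, P q.
Proof. by move=> Ppi q; rewrite -[q]reprK; apply: Ppi. Qed.

Fact lmod_quot_scaleA (a b : F) (q : lmod_quot) :
  lmod_quot_scale a (lmod_quot_scale b q) = lmod_quot_scale (a * b) q.
Proof. by elim/lmod_quot_ind: q => v; rewrite !lmod_quot_piZ scalerA. Qed.

Fact lmod_quot_scale1 : left_id 1 lmod_quot_scale.
Proof. by elim/lmod_quot_ind=> v; rewrite lmod_quot_piZ scale1r. Qed.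

Fact lmod_quot_scaleDr : right_distributive lmod_quot_scale +%R.
Proof.
move=> a; elim/lmod_quot_ind=> u; elim/lmod_quot_ind=> v.
by rewrite -lmod_quot_piD !lmod_quot_piZ -lmod_quot_piD scalerDr.
Qed.

Fact lmod_quot_scaleDl (q : lmod_quot) :
  {morph lmod_quot_scale^~ q : a b / a + b}.
Proof.
elim/lmod_quot_ind: q => v a b.
by rewrite !lmod_quot_piZ -lmod_quot_piD scalerDl.
Qed.

HB.instance Definition _ := GRing.Zmodule_isLmodule.Build F lmod_quot
  lmod_quot_scaleA lmod_quot_scale1 lmod_quot_scaleDr lmod_quot_scaleDl.

End LmodQuotient.

Definition lmod_iso (F : nzRingType) (U W : lmodType F) : Prop :=
  exists f : {linear U -> W}, bijective f.

HB.mixin Record isLieAlgebra (F : fieldType) L of GRing.Lmodule F L := {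
  lie : L -> L -> L;
  lie_linearl : forall y, linear (lie^~ y);
  lie_linearr : forall x, linear (lie x);
  liexx : forall x, lie x x = 0;
  lie_jacobi : forall x y z,
    lie x (lie y z) + lie y (lie z x) + lie z (lie x y) = 0
}.

#[short(type="lieAlgType")]
HB.structure Definition LieAlgebra (F : fieldType) :=
  { L of isLieAlgebra F L & GRing.Lmodule F L }.

Record lieModule (F : fieldType) (L : lieAlgType F) (V : lmodType F) :=
  LieModule {
    lie_act :> L -> V -> V;
    lie_act_linearl : forall v, linear (lie_act^~ v);
    lie_act_linearr : forall x, linear (lie_act x);
    lie_act_bracket : forall x y v,
      lie_act (lie x y) v = lie_act x (lie_act y v) - lie_act y (lie_act x v)
  }.

Definition lie_irreducible (F : fieldType) (L : lieAlgType F)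
    (V : vectType F) (rho : lieModule L V) : Prop :=
  (fullv != 0 :> {vspace V})%VS /\
  forall U : {vspace V},
    (forall x v, v \in U -> rho x v \in U) -> U = 0%VS \/ U = fullv.

Section LieTheory.
Variables (F : fieldType) (L : lieAlgType F).
Implicit Types x y z : L.

Lemma lieDl x y z : lie (x + y) z = lie x z + lie y z.
Proof. by have := lie_linearl z 1 x y; rewrite !scale1r. Qed.

Lemma lieDr x y z : lie x (y + z) = lie x y + lie x z.
Proof. by have := lie_linearr x 1 y z; rewrite !scale1r. Qed.

Lemma lieC x y : lie x y = - lie y x.
Proof.
apply/eqP; rewrite -addr_eq0; apply/eqP.
by have := liexx (x + y); rewrite lieDl !lieDr !liexx add0r addr0.
Qed.

Lemma lieNr x y : lie x (- y) = - lie x y.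
Proof.
have lie0r : lie x 0 = 0 by apply: (addrI (lie x 0)); rewrite -lieDr !addr0.
by apply/eqP; rewrite -addr_eq0 -lieDr addNr lie0r.
Qed.

Fact adjoint_bracket x y z :
  lie (lie x y) z = lie x (lie y z) - lie y (lie x z).
Proof.
have := lie_jacobi x y z.
rewrite (lieC z (lie x y)) (lieC z x) lieNr.
by move/eqP; rewrite subr_eq0 => /eqP <-.
Qed.

Definition adjoint : lieModule L L :=
  LieModule (@lie_linearl F L) (@lie_linearr F L) adjoint_bracket.

End LieTheory.

Section SpecialLinear.
Variables (F : fieldType) (n : nat).

Definition trace0 : {pred 'M[F]_n} := fun A => \tr A == 0.

Fact trace0_submod : submod_closed trace0.
Proof.
split=> [|a A B]; rewrite !unfold_in ?mxtrace0 // => /eqP trA /eqP trB.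
by rewrite mxtraceD mxtraceZ trA trB mulr0 addr0.
Qed.
HB.instance Definition _ :=
  GRing.isSubmodClosed.Build F 'M[F]_n trace0 trace0_submod.

Record sl := Sl { sl_val :> 'M[F]_n; sl_valP : sl_val \in trace0 }.

HB.instance Definition _ := [isSub for sl_val].
HB.instance Definition _ := [Choice of sl by <:].
HB.instance Definition _ := [SubChoice_isSubLmodule of sl by <:].

Fact sl_lie_subproof (A B : sl) : A *m B - B *m A \in trace0.
Proof. by rewrite unfold_in raddfB /= mxtrace_mulC subrr. Qed.

Definition sl_lie (A B : sl) : sl := Sl (sl_lie_subproof A B).

Fact sl_lie_linearl B : linear (sl_lie^~ B).
Proof.
move=> a A A'; apply: val_inj => /=.
rewrite mulmxDl mulmxDr -scalemxAl -scalemxAr scalerBr opprD.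
by rewrite -!addrA; congr (_ + _); rewrite addrCA.
Qed.

Fact sl_lie_linearr A : linear (sl_lie A).
Proof.
move=> a B B'; apply: val_inj => /=.
rewrite mulmxDl mulmxDr -scalemxAl -scalemxAr scalerBr opprD.
by rewrite -!addrA; congr (_ + _); rewrite addrCA.
Qed.

Fact sl_liexx A : sl_lie A A = 0.
Proof. by apply: val_inj; rewrite /= subrr. Qed.

Fact sl_jacobi A B C :
  sl_lie A (sl_lie B C) + sl_lie B (sl_lie C A) + sl_lie C (sl_lie A B) = 0.
Proof.
apply: val_inj => /=; rewrite !mulmxBl !mulmxBr !mulmxA !opprB.
apply/matrixP => i j; rewrite !mxE; ring.
Qed.

HB.instance Definition _ := isLieAlgebra.Build F sl
  sl_lie_linearl sl_lie_linearr sl_liexx sl_jacobi.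

End SpecialLinear.

Section SemiDirect.
Variables (F : fieldType) (L : lieAlgType F) (V : lmodType F).
Variable rho : lieModule L V.

(* The argument only selects the bracket. *)
Definition semidirect (_ : lieModule L V) : Type := (L * V)%type.
Local Notation LV := (semidirect rho).
HB.instance Definition _ := GRing.Lmodule.on LV.

Definition semidirect_lie (p q : LV) : LV :=
  (lie p.1 q.1, rho p.1 q.2 - rho q.1 p.2).

Fact semidirect_lie_linearl q : linear (semidirect_lie^~ q).
Proof.
move=> a p p'; congr pair; first exact: lie_linearl.
rewrite /= lie_act_linearl lie_act_linearr scalerBr opprD.
by rewrite addrACA.
Qed.

Fact semidirect_lie_linearr p : linear (semidirect_lie p).
Proof.
move=> a q q'; congr pair; first exact: lie_linearr.
rewrite /= lie_act_linearl lie_act_linearr scalerBr opprD.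
by rewrite addrACA.
Qed.

Fact semidirect_liexx p : semidirect_lie p p = 0.
Proof. by rewrite /semidirect_lie liexx subrr. Qed.

Fact semidirect_jacobi p q r :
  semidirect_lie p (semidirect_lie q r) + semidirect_lie q (semidirect_lie r p)
  + semidirect_lie r (semidirect_lie p q) = 0.
Proof.
case: p q r => [x u] [y v] [z w]; congr pair; first exact: lie_jacobi.
have actB t (a b : V) : rho t (a - b) = rho t a - rho t b.
  by rewrite addrC -scaleN1r lie_act_linearr scaleN1r addrC.
rewrite /= !actB !lie_act_bracket.
have tele (a b c : V) : a - b + (b - c) = a - c by rewrite addrA subrK.
rewrite !opprB [X in _ + X + _]addrC [X in X + _]addrACA !tele.
by rewrite addrACA !tele subrr.
Qed.

HB.instance Definition _ := isLieAlgebra.Build F LV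
  semidirect_lie_linearl semidirect_lie_linearr semidirect_liexx
  semidirect_jacobi.

End SemiDirect.

Section Cohomology.
Variables (F : fieldType) (L : lieAlgType F) (M : lmodType F).
Variable rho : lieModule L M.

Definition set_arg k (x : {ffun 'I_k -> L}) (i : 'I_k) (u : L) :
  {ffun 'I_k -> L} := [ffun j => if j == i then u else x j].

Definition multilinear k (f : {ffun 'I_k -> L} -> M) : Prop :=
  forall (x : {ffun 'I_k -> L}) i, linear (fun u => f (set_arg x i u)).

Definition alternating k (f : {ffun 'I_k -> L} -> M) : Prop :=
  forall (x : {ffun 'I_k -> L}) i j, i != j -> x i = x j -> f x = 0.

Definition is_cochain k (f : {ffun 'I_k -> L} -> M) : Prop :=
  multilinear f /\ alternating f.

(* (x_0, ..., x_k) with x_i omitted *)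
Definition omit k (x : {ffun 'I_k.+1 -> L}) (i : 'I_k.+1) :
  {ffun 'I_k -> L} := [ffun p => x (lift i p)].

(* ([x_i, x_j], x_0, ..., x_k) with x_i and x_j omitted, for i < j: the entry
   number p >= 1 of this family is x_q with q = bump j (bump i p.-1). *)
Definition omit2 k (x : {ffun 'I_k.+1 -> L}) (i j : 'I_k.+1) :
  {ffun 'I_k -> L} :=
  [ffun p : 'I_k => if p == 0 :> nat then lie (x i) (x j)
                    else x (inord (bump j (bump i p.-1)))].

(* The formula makes sense for every function f; it is only used on cochains. *)
Definition ce_diff k (f : {ffun 'I_k -> L} -> M) : {ffun 'I_k.+1 -> L} -> M :=
  fun x =>
    \sum_(i < k.+1) (-1) ^+ i *: rho (x i) (f (omit x i))
    + \sum_(i < k.+1) \sum_(j < k.+1 | (i < j)%N)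
        (-1) ^+ (i + j) *: f (omit2 x i j).

Definition is_coboundary k : ({ffun 'I_k -> L} -> M) -> Prop :=
  match k with
  | 0 => fun f => f = 0
  | k'.+1 => fun f => exists2 h, is_cochain h & f = @ce_diff k' h
  end.

Lemma ce_diff_linear k : linear (@ce_diff k).
Proof.
move=> a f g; apply/funext => x.
change (ce_diff (a *: f + g) x = a *: ce_diff f x + ce_diff g x).
rewrite /ce_diff scalerDr addrACA; congr (_ + _).
  rewrite scaler_sumr -big_split; apply: eq_bigr => i _ /=.
  by rewrite lie_act_linearr scalerDr !scalerA mulrC.
rewrite scaler_sumr -big_split; apply: eq_bigr => i _ /=.
rewrite scaler_sumr -big_split; apply: eq_bigr => j _ /=.
by rewrite scalerDr !scalerA mulrC.
Qed.

Definition cocycle_pred k : {pred {ffun 'I_k -> L} -> M} :=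
  fun f => `[< is_cochain f /\ ce_diff f = 0 >].

Fact is_cochain0 k : is_cochain (0 : {ffun 'I_k -> L} -> M).
Proof. by split=> // x i a u v; rewrite /= scaler0 addr0. Qed.

Fact is_cochainD k (a : F) (f g : {ffun 'I_k -> L} -> M) :
  is_cochain f -> is_cochain g -> is_cochain (a *: f + g).
Proof.
move=> [mf af] [mg ag]; split=> [x i b u v|x i j ij xij]; rewrite !fctE.
  rewrite mf mg !scalerDr !scalerA mulrC !addrA; congr (_ + _).
  by rewrite -!addrA; congr (_ + _); rewrite addrC.
by rewrite (af _ _ _ ij xij) (ag _ _ _ ij xij) scaler0 addr0.
Qed.

Fact cocycle_submod k : submod_closed (@cocycle_pred k).
Proof.
split=> [|a f g /asboolP[cf df] /asboolP[cg dg]]; apply/asboolP; split.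
- exact: is_cochain0.
- by have := ce_diff_linear (-1) (0 : {ffun 'I_k -> L} -> M) 0;
     rewrite scaler0 addr0 scaleN1r addNr.
- exact: is_cochainD.
- by rewrite ce_diff_linear df dg scaler0 addr0.
Qed.
HB.instance Definition _ k := GRing.isSubmodClosed.Build F
  ({ffun 'I_k -> L} -> M) (@cocycle_pred k) (@cocycle_submod k).

Record cocycle k := Cocycle {
  cocycle_val :> {ffun 'I_k -> L} -> M;
  cocycle_valP : cocycle_val \in @cocycle_pred k
}.
HB.instance Definition _ k := [isSub for @cocycle_val k].
HB.instance Definition _ k := [Choice of cocycle k by <:].
HB.instance Definition _ k := [SubChoice_isSubLmodule of cocycle k by <:].

Definition coboundary_pred k : {pred cocycle k} :=
  fun z => `[< is_coboundary (cocycle_val z) >].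

Fact coboundary_submod k : submod_closed (@coboundary_pred k).
Proof.
case: k => [|k]; split=> [|a f g /asboolP cf /asboolP cg]; apply/asboolP => //=.
- by rewrite cf cg scaler0 addr0.
- exists 0; first exact: is_cochain0.
  by have := ce_diff_linear (-1) (0 : {ffun 'I_k -> L} -> M) 0;
     rewrite scaler0 addr0 scaleN1r addNr => ->.
- case: cf cg => [h ch ->] [h' ch' ->]; exists (a *: h + h').
    exact: is_cochainD.
  by rewrite ce_diff_linear.
Qed.
HB.instance Definition _ k := GRing.isSubmodClosed.Build F
  (cocycle k) (@coboundary_pred k) (@coboundary_submod k).

(* Z^k / B^k. The submodule quotiented out is, by construction, the set of the
   cocycles that are coboundaries; that every coboundary is a cocycle (d d = 0)
   is not needed for the definition. *)
Definition cohomology k : lmodType F := lmod_quot (@coboundary_pred k).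

End Cohomology.

(* Main.v *)
Require Import Defs.
From mathcomp Require Import all_boot all_algebra.
From mathcomp Require Import reals complex.
From HB Require Import structures.
From mathcomp Require Import all_order boolp functions.
From mathcomp Require Import zify ring.

Set Implicit Arguments.
Unset Strict Implicit.
Unset Printing Implicit Defensive.

Import Order.TTheory GRing.Theory Num.Theory.
Local Open Scope ring_scope.

(** Write g for the semidirect product, s for sl2 and m = 2n - 1. A cochain on g is
split according to how many of its arguments lie in s. The part with i arguments
in s is an exterior i-form on s with values in the alternating maps from V to g,
and the differential of g is the sum of two pieces: the differential d_s of s with
these maps as coefficients, and the operator d_V obtained by letting the abelian
ideal V act on g. The coefficient modules are finite dimensional, so the Casimir
element of s splits each of them into its invariants and a complement on which it
is invertible ([casimir_split]). The dual-basis contraction is a homotopy between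
the Casimir element and zero; this gives the two Whitehead lemmas [whitehead1] and
[whitehead2], the vanishing of H^1 and H^2 of s. A cocycle of g can therefore be
corrected by coboundaries so that its parts with three, two and one arguments in s
disappear one after the other ([level3], [level2], [level1]), provided that the
invariant part of the component with three arguments in s vanishes. What remains is
an alternating map from V to g that is invariant and killed by d_V; since d_V vanishes
on the invariants in at most three arguments, no such map is lost to a coboundary. So
H^k(g, g) is made, for k <= 4, of such maps in k arguments and, through the volume form
of s, of such maps in k - 3 arguments ([exact3], [ext_cocycle], [vol_cocycle], [component_iso]).

The invariants remain to be found. Weights of V are odd, those of s are even; hence
an invariant map in k arguments has values in V if k is odd and in s if k is even
([parity_zero]), and d_V vanishes on the maps with values in V since V is abelian
([dV_fst0]). An equivariant map is determined by its highest weight component, an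
alternating form psi which, in the basis b_0, ..., b_m of V with F b_i = b_(i+1), is
supported on index tuples of one fixed sum and satisfies the lowering relation: the
sum of the values of psi obtained by raising one index is zero ([hwform_sl0],
[hwform_V0], and conversely [hwform_lift]). In degree 0 there are no invariants. In
degree 1, Schur's lemma leaves the multiples of the identity of V: this is H^1, and
through the volume form it is H^4. In degree 2 the relation gives
psi(i, j) = (-1)^i psi(0, i + j) with i + j = m - 1 even, against antisymmetry, so
psi = 0. In degree 3 the sum of the indices is m, and solving the relation for the
triple with the largest entry leaves as free parameters exactly the triples
(2t, n-1-t, n-t) with 3t + 2 <= n; there are (n + 1) %/ 3 of them ([tight_eq0],
[altsol_tight]): this is H^3. In degree 4 the condition d_V = 0 evaluated on
b_p, b_i, b_j, b_k, b_l with 1 <= p <= m reduces to psi(i, j, k, l) E b_p = 0 as soon as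
p exceeds none of the four indices by 0, 1 or 2. This settles all but finitely many quadruples,
which occur for m <= 11 only, and the lowering relation settles those ([gap_eq0]). *)

(** * Linear identities in modules *)

Section LinearExpressions.
Variable F : fieldType.

Inductive lexp :=
  LVar of nat | LZero | LAdd of lexp & lexp | LOpp of lexp | LScale of F & lexp.

Fixpoint lcoef (e : lexp) (i : nat) : F :=
  match e with
  | LVar n => if eqn n i then 1 else 0
  | LZero => 0
  | LAdd a b => lcoef a i + lcoef b i
  | LOpp a => - lcoef a i
  | LScale c a => c * lcoef a i
  end.

Fixpoint leval (X : lmodType F) (env : seq X) (e : lexp) : X :=
  match e with
  | LVar n => nth 0 env n
  | LZero => 0
  | LAdd a b => leval env a + leval env b
  | LOpp a => - leval env a
  | LScale c a => c *: leval env a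
  end.

Lemma leval_coef (X : lmodType F) (env : seq X) e :
  leval env e = \sum_(i < size env) lcoef e i *: nth 0 env i.
Proof.
elim: e => [n||a IHa b IHb|a IHa|c a IHa] /=.
- have [lt_n|ge_n] := ltnP n (size env); last first.
    rewrite nth_default // big1 // => i _; case: eqnP => [ni|]; last by rewrite scale0r.
    by move: (ltn_ord i); rewrite -ni ltnNge ge_n.
  rewrite (bigD1 (Ordinal lt_n)) //=; case: eqnP => // _; rewrite scale1r.
  rewrite big1 ?addr0 // => i ni; case: eqnP => [nE|]; last by rewrite scale0r.
  by case/eqP: ni; apply: val_inj.
- by rewrite big1 // => i _; rewrite scale0r.
- by rewrite IHa IHb -big_split; apply: eq_bigr => i _; rewrite scalerDl.
- by rewrite IHa -sumrN; apply: eq_bigr => i _; rewrite scaleNr.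
- by rewrite IHa scaler_sumr; apply: eq_bigr => i _; rewrite scalerA.
Qed.

Fixpoint lequal (n : nat) (e1 e2 : lexp) : Prop :=
  if n is n'.+1 then lcoef e1 n' = lcoef e2 n' /\ lequal n' e1 e2 else True.

Lemma leval_eq (X : lmodType F) (env : seq X) e1 e2 :
  lequal (size env) e1 e2 -> leval env e1 = leval env e2.
Proof.
move=> e12; rewrite !leval_coef; apply: eq_bigr => i _; congr (_ *: _).
elim: (size env) (i : nat) (ltn_ord i) e12 => // n IHn j; rewrite ltnS leq_eqVlt.
by case/predU1P => [-> [] //|lt_jn [_ /IHn]]; apply.
Qed.

End LinearExpressions.

(** A linear identity between vectors follows from the equality of the
coefficients of each vector occurring in it; [lmod] reduces a goal to these
equations. *)
Ltac lmod_in x l :=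
  lazymatch l with
  | nil => constr:(false)
  | cons x _ => constr:(true)
  | cons _ ?l' => lmod_in x l'
  end.
Ltac lmod_atoms acc t :=
  lazymatch t with
  | (?a + ?b)%R => let acc' := lmod_atoms acc a in lmod_atoms acc' b
  | (- ?a)%R => lmod_atoms acc a
  | (_ *: ?a)%R => lmod_atoms acc a
  | 0%R => acc
  | _ => let b := lmod_in t acc in
         lazymatch b with true => acc | false => constr:(cons t acc) end
  end.
Ltac lmod_index x l :=
  lazymatch l with
  | cons x _ => constr:(0%N)
  | cons _ ?l' => let n := lmod_index x l' in constr:(S n)
  end.
Ltac lmod_reify F env t :=
  lazymatch t with
  | (?a + ?b)%R => let a' := lmod_reify F env a in
      let b' := lmod_reify F env b in constr:(@LAdd F a' b')
  | (- ?a)%R => let a' := lmod_reify F env a in constr:(@LOpp F a')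
  | (?c *: ?a)%R => let a' := lmod_reify F env a in constr:(@LScale F c a')
  | 0%R => constr:(@LZero F)
  | _ => let n := lmod_index t env in constr:(@LVar F n)
  end.
Ltac lmod_prepare X :=
  lazymatch goal with
  | |- @eq ?T ?a ?b =>
    let acc := lmod_atoms constr:(@nil T) a in
    let env := lmod_atoms acc b in
    lazymatch type of X with
    | GRing.Lmodule.type ?F =>
      let a' := lmod_reify F env a in
      let b' := lmod_reify F env b in
      change (@leval F X env a' = @leval F X env b');
      apply: leval_eq; cbn [lequal lcoef size eqn]; do ?split => //
    end
  end.
Tactic Notation "lmod" constr(X) := lmod_prepare X; ring.

Section UnbundledLinear.
Variables (F : fieldType) (T W : lmodType F) (f : T -> W).
Hypothesis lin_f : linear f.

Lemma linD u v : f (u + v) = f u + f v.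
Proof. by have := lin_f 1 u v; rewrite !scale1r. Qed.

Lemma lin0 : f 0 = 0.
Proof. by apply: (addrI (f 0)); rewrite -linD !addr0. Qed.

Lemma linZ c u : f (c *: u) = c *: f u.
Proof. by have := lin_f c u 0; rewrite !addr0 lin0 addr0. Qed.

Lemma linN u : f (- u) = - f u.
Proof. by rewrite -scaleN1r linZ scaleN1r. Qed.

Lemma linB u v : f (u - v) = f u - f v.
Proof. by rewrite linD linN. Qed.

Lemma lin_sum I (r : seq I) (P : pred I) (u : I -> T) :
  f (\sum_(i <- r | P i) u i) = \sum_(i <- r | P i) f (u i).
Proof. exact: (big_morph f linD lin0). Qed.

End UnbundledLinear.

Lemma linear_zero (F : fieldType) (T W : lmodType F) :
  linear (fun _ : T => 0 : W).
Proof. by move=> c u v; rewrite scaler0 addr0. Qed.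

(** * Curried alternating cochains *)

Section Curried.
Variables (F : fieldType) (T W : lmodType F).

Fixpoint cur (k : nat) : lmodType F :=
  if k is k'.+1 then ((T -> cur k') : lmodType F) else W.

Lemma curD k (f g : cur k.+1) x : (f + g) x = f x + g x. Proof. by []. Qed.
Lemma curN k (f : cur k.+1) x : (- f) x = - f x. Proof. by []. Qed.
Lemma curZ k c (f : cur k.+1) x : (c *: f) x = c *: f x. Proof. by []. Qed.
Lemma cur0 k x : (0 : cur k.+1) x = 0. Proof. by []. Qed.
Definition curE := (curD, curN, curZ, cur0).

Definition diag_zero (k : nat) : cur k.+1 -> Prop :=
  match k with
  | 0 => fun _ => True
  | k'.+1 => fun f => forall x, f x x = 0
  end.

(** Vanishing on adjacent equal arguments, at every depth, is enough for a
multilinear map to be alternating, and it is stable under partial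
application: hence the proofs by induction on the number of arguments. *)
Fixpoint altm (k : nat) : cur k -> Prop :=
  match k with
  | 0 => fun _ => True
  | k'.+1 => fun f =>
      [/\ linear (f : T -> cur k'), forall x, altm (f x) & diag_zero f]
  end.

Lemma altm_lin k (f : cur k.+1) : altm f -> linear (f : T -> cur k).
Proof. by case. Qed.

Lemma altm_app k (f : cur k.+1) x : altm f -> altm (f x).
Proof. by case=> _ cf _; apply: cf. Qed.

Lemma altm_diag k (f : cur k.+2) x : altm f -> f x x = 0.
Proof. by case=> _ _; apply. Qed.

Lemma altm_anti k (f : cur k.+2) x y : altm f -> f x y = - f y x.
Proof.
move=> cf; apply/eqP; rewrite -addr_eq0; apply/eqP.
have := altm_diag (x + y) cf; rewrite (linD (altm_lin cf)) curD.
rewrite !(linD (altm_lin (altm_app _ cf))) !(altm_diag _ cf) add0r addr0.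
by [].
Qed.

Lemma altm0 k : altm (0 : cur k).
Proof.
elim: k => //= k IHk; split=> //; first exact: linear_zero.
by case: k IHk.
Qed.

Lemma altm_comb k c (f g : cur k) : altm f -> altm g -> altm (c *: f + g).
Proof.
elim: k f g => //= k IHk f g [lf cf df] [lg cg dg]; split.
- by move=> d u v; rewrite !curE lf lg; lmod (cur k).
- by move=> x; apply: IHk.
- case: k {IHk} f g {lf cf lg cg} df dg => // k f g df dg x.
  by rewrite [LHS](_ : _ = c *: f x x + g x x) // (df x) (dg x) scaler0 addr0.
Qed.

Lemma altmZ k c (f : cur k) : altm f -> altm (c *: f).
Proof. by move=> cf; rewrite -[_ *: _]addr0; apply: altm_comb (altm0 _). Qed.

Lemma altmD k (f g : cur k) : altm f -> altm g -> altm (f + g).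
Proof. by move=> cf cg; rewrite -[f]scale1r; apply: altm_comb. Qed.

Lemma altmN k (f : cur k) : altm f -> altm (- f).
Proof. by rewrite -scaleN1r; apply: altmZ. Qed.

Lemma altmB k (f g : cur k) : altm f -> altm g -> altm (f - g).
Proof. by move=> cf /altmN; apply: altmD. Qed.

Lemma altm_sum k I (r : seq I) (P : pred I) (u : I -> cur k) :
  (forall i, altm (u i)) -> altm (\sum_(i <- r | P i) u i).
Proof. by move=> cu; apply: big_ind => //; [exact: altm0 | exact: altmD]. Qed.

(** With a and b the actions of a Lie algebra element on the arguments and on the
values, this is the Lie derivative. *)
Fixpoint der (a : T -> T) (b : W -> W) (k : nat) : cur k -> cur k :=
  match k with
  | 0 => b
  | k'.+1 => fun f y => der a b (f y) - f (a y)
  end.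

Lemma derS a b k (f : cur k.+1) y : der a b f y = der a b (f y) - f (a y).
Proof. by []. Qed.

Lemma der_lin a b k : linear b -> linear (@der a b k).
Proof.
move=> lb; elim: k => // k IHk c f g; apply/funext => y.
by rewrite !(derS, curE) IHk; lmod (cur k).
Qed.

Lemma der_altm a b k (f : cur k) : linear a -> linear b -> altm f -> altm (der a b f).
Proof.
move=> la lb; elim: k f => // k IHk f cf; split.
- move=> c u v; rewrite !derS la !(altm_lin cf) (der_lin _ lb).
  by lmod (cur k).
- by move=> y; rewrite derS; apply: altmB (altm_app _ cf); apply/IHk/altm_app.
- case: k IHk f cf => // k IHk f cf x.
  rewrite derS !curE derS (altm_diag _ cf) (lin0 (der_lin _ lb)).
  by rewrite (altm_anti (a x) x cf); lmod (cur k).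
Qed.

Lemma der_comm a b a' b' k (f : cur k) :
  linear a -> linear a' -> linear b -> linear b' -> altm f ->
  der a b (der a' b' f) - der a' b' (der a b f) =
  der (fun x => a (a' x) - a' (a x)) (fun w => b (b' w) - b' (b w)) f.
Proof.
move=> la la' lb lb'; elim: k f => // k IHk f cf; apply/funext => y.
rewrite !(derS, curE) !(linB (der_lin _ _)) // -IHk; last exact: altm_app.
by rewrite (linB (altm_lin cf)); lmod (cur k).
Qed.

Lemma der_comb c a b a' b' k (f : cur k) : altm f ->
  der (fun x => c *: a x + a' x) (fun w => c *: b w + b' w) f =
  c *: der a b f + der a' b' f.
Proof.
elim: k f => // k IHk f cf; apply/funext => y.
rewrite !(derS, curE) IHk; last exact: altm_app.
by rewrite (altm_lin cf); lmod (cur k).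
Qed.

Lemma eq_der a a' b b' k (f : cur k) : a =1 a' -> b =1 b' -> der a b f = der a' b' f.
Proof. by move=> /funext -> /funext ->. Qed.

(** The differential is determined by Cartan's formula: contracting d f with x
gives the Lie derivative of f along x minus d of the contraction of f. *)
Fixpoint dif (br : T -> T -> T) (ac : T -> W -> W) (k : nat) :
    cur k -> cur k.+1 :=
  match k with
  | 0 => fun m x => ac x m
  | k'.+1 => fun f x => (der (br x) (ac x) f : cur k'.+1) - dif br ac (f x)
  end.

Section Differential.
Variables (br : T -> T -> T) (ac : T -> W -> W).
Local Notation d := (dif br ac).
Local Notation th x := (der (br x) (ac x)).

Lemma dif0 (m : cur 0) x : d m x = ac x m. Proof. by []. Qed.
Lemma difS k (f : cur k.+1) x : d f x = th x f - d (f x). Proof. by []. Qed.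

Hypothesis br_linl : forall y, linear (br^~ y).
Hypothesis br_linr : forall x, linear (br x).
Hypothesis br_xx : forall x, br x x = 0.
Hypothesis ac_linl : forall w, linear (ac^~ w).
Hypothesis ac_linr : forall x, linear (ac x).

Lemma dif_lin k : linear (@dif br ac k).
Proof.
elim: k => [|k IHk] c f g; apply/funext => x; first by rewrite !(dif0, curE) ac_linr.
by rewrite !(difS, curE) (der_lin _ (ac_linr x)) IHk; lmod (cur k.+1).
Qed.

Lemma th_comb c x x' k (f : cur k) : altm f ->
  th (c *: x + x') f = c *: th x f + th x' f.
Proof.
move=> cf; rewrite -der_comb //; apply: eq_der => z; [exact: br_linl|exact: ac_linl].
Qed.

Lemma dif_altm k (f : cur k) : altm f -> altm (d f).
Proof.
elim: k f => [|k IHk] f cf; split => //.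
- by move=> c u v; rewrite !dif0 ac_linl.
- move=> c u v; rewrite !difS th_comb // (altm_lin cf) dif_lin.
  by lmod (cur k.+1).
- move=> x; rewrite difS; apply: altmB; first exact: der_altm.
  exact/IHk/altm_app.
- move=> x; rewrite difS curE curN derS br_xx (lin0 (altm_lin cf)) subr0.
  case: k IHk f cf => [|k] IHk f cf; first by rewrite dif0 subrr.
  by rewrite difS (altm_diag _ cf) (lin0 (@dif_lin k)) subr0 subrr.
Qed.

(** Derivations of the bracket that are compatible with the coefficient action
commute with the differential; both the invariance of the differential and d d = 0
are instances. *)
Lemma der_dif a b k (f : cur k) : linear a -> linear b ->
  (forall x y, a (br x y) = br (a x) y + br x (a y)) ->
  (forall x w, b (ac x w) = ac (a x) w + ac x (b w)) ->
  altm f -> der a b (d f) = d (der a b f).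
Proof.
move=> la lb a_br b_ac; elim: k f => [|k IHk] f cf; apply/funext => y.
  by rewrite derS !dif0 /= b_ac; lmod W.
have comm : der a b (th y f) - th y (der a b f) = th (a y) f.
  rewrite der_comm //; apply: eq_der => z; last by rewrite b_ac; lmod W.
  by rewrite a_br; lmod T.
rewrite !(derS, difS, curE) (linB (der_lin _ lb)) -comm.
rewrite IHk; last exact: altm_app.
by rewrite (linB (@dif_lin k)); lmod (cur k.+1).
Qed.

Hypothesis br_jacobi : forall x y z, br x (br y z) = br (br x y) z + br y (br x z).
Hypothesis ac_br : forall x y w, ac x (ac y w) = ac (br x y) w + ac y (ac x w).

Lemma dif_dif k (f : cur k) : altm f -> d (d f) = 0.
Proof.
elim: k f => [|k IHk] f cf; apply/funext => x.
  by rewrite [LHS]difS cur0 (@der_dif (br x) (ac x)) //; apply: subrr.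
rewrite [LHS]difS cur0 (@der_dif (br x) (ac x)) //.
rewrite [d f x]difS [X in _ - X](linB (@dif_lin _)) IHk; last exact: altm_app.
by rewrite subr0 subrr.
Qed.

End Differential.
End Curried.

Arguments dif {F T W} br ac {k} f.
Arguments der {F T W} a b {k} f.

(** * Polynomials in an endomorphism *)

Section PolynomialAction.
Variables (F : fieldType) (X : lmodType F) (T : X -> X).
Hypothesis lT : linear T.
Implicit Types (p q : {poly F}) (x : X).

Definition pact (p : {poly F}) (x : X) : X :=
  \sum_(i < size p) p`_i *: iter i T x.

Lemma pactE n p x : (size p <= n)%N -> pact p x = \sum_(i < n) p`_i *: iter i T x.
Proof.
move=> le_pn; rewrite /pact (big_ord_widen n (fun i => p`_i *: iter i T x) le_pn).
rewrite big_mkcond; apply: eq_bigr => i _; case: ltnP => // le_pi.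
by rewrite nth_default ?scale0r.
Qed.

Lemma linear_iter n : linear (iter n T).
Proof. by elim: n => // n IHn c u v; rewrite !iterS IHn lT. Qed.

Lemma pact_lin p : linear (pact p).
Proof.
move=> c u v; rewrite /pact scaler_sumr -big_split; apply: eq_bigr => i _ /=.
by rewrite linear_iter; lmod X.
Qed.

Lemma pact_comb c p q x : pact (c *: p + q) x = c *: pact p x + pact q x.
Proof.
set n := maxn (size p) (size q).
have le_n : (size (c *: p + q)%R <= n)%N.
  rewrite (leq_trans (size_polyD _ _)) // geq_max leq_maxr andbT.
  exact: leq_trans (size_scale_leq _ _) (leq_maxl _ _).
rewrite (pactE _ le_n) (@pactE n p) ?leq_maxl // (@pactE n q) ?leq_maxr //.
rewrite scaler_sumr -big_split; apply: eq_bigr => i _ /=.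
by rewrite coefD coefZ; lmod X.
Qed.

Lemma pact0 x : pact 0 x = 0.
Proof. by rewrite /pact size_poly0 big_ord0. Qed.

Lemma pactD p q x : pact (p + q) x = pact p x + pact q x.
Proof. by rewrite -[p]scale1r pact_comb !scale1r. Qed.

Lemma pactC c x : pact c%:P x = c *: x.
Proof. by rewrite (@pactE 1) ?size_polyC_leq1 // big_ord1 coefC. Qed.

Lemma pact1 x : pact 1 x = x.
Proof. by rewrite -[1]/(1%:P) pactC scale1r. Qed.

Lemma pactMX p x : pact (p * 'X) x = T (pact p x).
Proof.
rewrite (@pactE (size p).+1); last by rewrite (leq_trans (size_polyMleq _ _)) // size_polyX addn2.
rewrite big_ord_recl coefMX eqxx scale0r add0r /pact (lin_sum lT).
by apply: eq_bigr => i _; rewrite coefMX /= (linZ lT).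
Qed.

Lemma pactX x : pact 'X x = T x.
Proof. by rewrite -['X]mul1r pactMX pact1. Qed.

Lemma pactM p q x : pact (p * q) x = pact p (pact q x).
Proof.
rewrite mulrC; elim/poly_ind: p => [|p c IHp]; first by rewrite mulr0 !pact0.
rewrite mulrDr mulrA !pactD !pactMX IHp mulrC mul_polyC -[_ *: q]addr0.
by rewrite pact_comb pact0 addr0 pactC.
Qed.

(** Only stability of U is required of T and Y, since the operators of interest
satisfy their relations on alternating maps and not on all functions. *)
Lemma pact_comm (U : X -> Prop) (Y : X -> X) p x : linear Y ->
  (forall u, U u -> U (T u)) -> (forall u, U u -> Y (T u) = T (Y u)) ->
  U x -> Y (pact p x) = pact p (Y x).
Proof.
move=> lY UT YT Ux; rewrite /pact (lin_sum lY); apply: eq_bigr => i _.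
rewrite (linZ lY); congr (_ *: _).
suff [-> _] : Y (iter i T x) = iter i T (Y x) /\ U (iter i T x) by [].
by elim: (i : nat) => //= n [<- Un]; split; [exact: YT | exact: UT].
Qed.

Lemma pact_eigen p x c : T x = c *: x -> pact p x = p.[c] *: x.
Proof.
move=> Tx; rewrite /pact horner_coef scaler_suml; apply: eq_bigr => i _.
rewrite -scalerA; congr (_ *: _).
elim: (i : nat) => [|n IHn]; first by rewrite scale1r.
by rewrite iterS IHn (linZ lT) Tx scalerA exprSr.
Qed.

End PolynomialAction.

Section SubmodulePredicate.
Variables (F : fieldType) (X : lmodType F).

Definition submodule (U : X -> Prop) :=
  U 0 /\ forall c u v, U u -> U v -> U (c *: u + v).

Variable U : X -> Prop.
Hypothesis subU : submodule U.

Lemma submod0 : U 0. Proof. by case: subU. Qed.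
Lemma submodZ c u : U u -> U (c *: u).
Proof. by move=> Uu; rewrite -[_ *: _]addr0; apply: subU.2 => //; apply: submod0. Qed.
Lemma submodD u v : U u -> U v -> U (u + v).
Proof. by move=> Uu Uv; rewrite -[u]scale1r; apply: subU.2. Qed.
Lemma submodN u : U u -> U (- u).
Proof. by rewrite -scaleN1r; apply: submodZ. Qed.
Lemma submodB u v : U u -> U v -> U (u - v).
Proof. by move=> Uu /submodN; apply: submodD. Qed.
Lemma submod_sum I (r : seq I) (P : pred I) (u : I -> X) :
  (forall i, U (u i)) -> U (\sum_(i <- r | P i) u i).
Proof. by move=> Uu; apply: big_ind => //; [exact: submod0 | exact: submodD]. Qed.

Lemma submod_pact T p u : (forall u, U u -> U (T u)) -> U u -> U (pact T p u).
Proof.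
move=> UT Uu; apply: submod_sum => i; apply: submodZ.
by elim: (i : nat) => //= n; apply: UT.
Qed.

(** Finite dimension is expressed by coordinates because the submodules in question
live in function spaces of infinite dimension. *)
Definition findim := exists N (j : X -> 'rV[F]_N),
  linear j /\ forall u, U u -> j u = 0 -> u = 0.

(** The vectors u, T u, ..., T^N u have linearly dependent coordinates. *)
Lemma annih_local N (j : X -> 'rV[F]_N) T u : linear T ->
  (forall u, U u -> U (T u)) -> linear j -> (forall u, U u -> j u = 0 -> u = 0) ->
  U u -> exists2 p, p != 0 & pact T p u = 0.
Proof.
move=> lT UT lj inj_j Uu.
pose A : 'M[F]_(N.+1, N) := \matrix_i j (iter i T u).
have : kermx A != 0.
  by rewrite -mxrank_eq0 mxrank_ker subn_eq0 -ltnNge ltnS rank_leq_col.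
case/rowV0Pn => c /sub_kermxP cA c0.
exists (rVpoly c); first by rewrite -(inj_eq (can_inj rVpolyK)) linear0 in c0 *.
apply: inj_j; first exact: submod_pact.
rewrite (@pactE _ _ _ N.+1) ?size_poly // (lin_sum lj) -[RHS]cA mulmx_sum_row.
by apply: eq_bigr => i _; rewrite (linZ lj) rowK coef_rVpoly_ord.
Qed.

(** A family whose coordinate matrix has maximal rank is spanning. *)
Lemma findim_span : findim -> exists r (b : 'I_r -> X),
  (forall i, U (b i)) /\ forall u, U u -> exists c : 'I_r -> F, u = \sum_i c i *: b i.
Proof.
case=> N [j [lj inj_j]].
pose P r := `[< exists b : 'I_r -> X, (forall i, U (b i)) /\
   \rank (\matrix_i j (b i)) = r >].
have P0 : exists r, P r.
  exists 0%N; apply/asboolP; exists (fun=> 0); split=> [_|]; first exact: submod0.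
  by apply/eqP; rewrite -leqn0 rank_leq_row.
have Pmax r : P r -> (r <= N)%N by case/asboolP => b [_ {1}<-]; apply: rank_leq_col.
case: (ex_maxnP P0 Pmax) => r /asboolP[b [Ub rkb]] maxr.
exists r, b; split=> // u Uu.
pose A : 'M[F]_(r, N) := \matrix_i j (b i).
case: (boolP (j u <= A)%MS) => [/submxP[c jc]|nsub].
  exists (c 0); apply/eqP; rewrite -subr_eq0; apply/eqP/inj_j.
    by apply: submodB => //; apply: submod_sum => i; apply: submodZ.
  rewrite (linB lj) jc mulmx_sum_row (lin_sum lj); apply/eqP; rewrite subr_eq0; apply/eqP.
  by apply: eq_bigr => i _; rewrite (linZ lj) rowK.
suff /maxr : P r.+1 by rewrite ltnn.
apply/asboolP; exists (fun i => if unlift ord0 i is Some i' then b i' else u).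
split=> [i|]; first by case: unlift.
set B := \matrix_i _.
have sAB : (A <= B)%MS.
  apply/row_subP => i; rewrite rowK (_ : j (b i) = row (lift ord0 i) B) ?row_sub //.
  by rewrite rowK liftK.
have suB : (j u <= B)%MS.
  by rewrite (_ : j u = row ord0 B) ?row_sub // rowK unlift_none.
apply/eqP; rewrite eqn_leq rank_leq_row -{1}rkb ltn_neqAle mxrankS // andbT.
rewrite (contraNN _ nsub) // => /eqP rkAB; apply: submx_trans suB _.
by rewrite -(geq_leqif (mxrank_leqif_sup sAB)) rkAB.
Qed.

(** The product of annihilating polynomials for the vectors of a finite spanning
family. *)
Lemma annih_global T : findim -> linear T -> (forall u, U u -> U (T u)) ->
  exists2 p, p != 0 & forall u, U u -> pact T p u = 0.
Proof.
move=> fU lT UT; have [r [b [Ub spb]]] := findim_span fU.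
have [N [j [lj inj_j]]] := fU.
have /choice[q qP] i : exists q, q != 0 /\ pact T q (b i) = 0.
  by have [q q0 qb] := annih_local lT UT lj inj_j (Ub i); exists q.
exists (\prod_i q i); first by apply/prodf_neq0 => i _; case: (qP i).
move=> u /spb[c ->]; rewrite (lin_sum (pact_lin lT _)) big1 // => i _.
rewrite (linZ (pact_lin lT _)) (bigD1 i) //= mulrC pactM // (qP i).2.
by rewrite (lin0 (pact_lin lT _)) scaler0.
Qed.

End SubmodulePredicate.

(** Split off linear factors of p until the product of the others does not kill v. *)
Lemma eigvec (C : closedFieldType) (X : lmodType C) (T : X -> X) p v :
  linear T -> p != 0 -> v != 0 -> pact T p v = 0 ->
  exists2 mu, root p mu & exists r, pact T r v != 0 /\ T (pact T r v) = mu *: pact T r v.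
Proof.
move=> lT p0 v0; have [n] := ubnP (size p); elim: n p p0 => // n IHn p p0 sz_p pv.
have [c0|] := boolP (size p == 1)%N.
  move/size_poly1P: c0 pv => [c c0 ->]; rewrite pactC => /eqP.
  by rewrite scaler_eq0 (negbTE c0) (negbTE v0).
case/closed_rootP => mu mup; have /factor_theorem[q pE] := mup.
have q0 : q != 0 by apply: contraNneq p0 => q0; rewrite pE q0 mul0r.
have [qv|qv] := eqVneq (pact T q v) 0.
  have [||mu' qmu' Tr] := IHn q q0; rewrite ?qv //; last first.
    by exists mu' => //; rewrite pE rootM qmu'.
  by move: sz_p; rewrite pE size_Mmonic ?monicXsubC // size_XsubC addn2.
exists mu => //; exists q; split=> //; apply/eqP; rewrite -subr_eq0 -scaleNr.
move: pv; rewrite pE mulrC pactM // pactD // pactX // -[- mu%:P]polyCN pactC => ->.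
by rewrite eqxx.
Qed.

(** * Finite-dimensional sl2-modules *)

(** The relations are imposed on the submodule U only: on functions that are not
multilinear the Lie derivatives satisfy no commutation relations. *)
Record sl2mod (C : fieldType) (X : lmodType C) (U : X -> Prop) (e h f : X -> X) :
    Prop := Sl2mod {
  sl2_sub : submodule U;
  sl2_line : linear e; sl2_linh : linear h; sl2_linf : linear f;
  sl2_Ue : forall u, U u -> U (e u);
  sl2_Uh : forall u, U u -> U (h u);
  sl2_Uf : forall u, U u -> U (f u);
  sl2_ef : forall u, U u -> e (f u) - f (e u) = h u;
  sl2_he : forall u, U u -> h (e u) - e (h u) = 2 *: e u;
  sl2_hf : forall u, U u -> h (f u) - f (h u) = - (2 *: f u)
}.

(** The Weyl group element, exchanging highest and lowest weight vectors. *)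
Lemma sl2mod_swap (C : fieldType) (X : lmodType C) (U : X -> Prop) (e h f : X -> X) :
  sl2mod U e h f -> sl2mod U f (fun u => - h u) e.
Proof.
case=> sU le lh lf Ue Uh Uf ef he hf; split=> //.
- by move=> c u v; rewrite lh; lmod X.
- by move=> u Uu; apply: submodN => //; apply: Uh.
- by move=> u Uu; rewrite -ef //; lmod X.
- by move=> u Uu; rewrite (linN lf) -[RHS]opprK -hf //; lmod X.
- by move=> u Uu; rewrite (linN le) -he //; lmod X.
Qed.

Section HighestWeight.
Variables (C : numFieldType) (X : lmodType C) (U : X -> Prop) (e h f : X -> X).
Hypothesis mU : sl2mod U e h f.
Hypothesis fU : findim U.

Let sU := sl2_sub mU.
Let le := sl2_line mU.
Let lh := sl2_linh mU.
Let lf := sl2_linf mU.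

Lemma sl2_Uit g n w : (forall u, U u -> U (g u)) -> U w -> U (iter n g w).
Proof. by move=> Ug Uw; elim: n => //= n /Ug. Qed.

Lemma sl2_Uen n w : U w -> U (iter n e w).
Proof. exact/sl2_Uit/(sl2_Ue mU). Qed.

Lemma sl2_Ufn n w : U w -> U (iter n f w).
Proof. exact/sl2_Uit/(sl2_Uf mU). Qed.

Lemma weight_e w c : U w -> h w = c *: w -> h (e w) = (c + 2) *: e w.
Proof.
move=> Uw hw; have := sl2_he mU Uw; rewrite hw (linZ le) => /eqP.
by rewrite subr_eq => /eqP ->; lmod X.
Qed.

Lemma weight_en w c n : U w -> h w = c *: w ->
  h (iter n e w) = (c + (2 * n)%:R) *: iter n e w.
Proof.
move=> Uw hw; elim: n => [|n IHn]; first by rewrite muln0 addr0.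
by rewrite iterS (weight_e (sl2_Uen n Uw) IHn) mulnS natrD; congr (_ *: _); ring.
Qed.

Lemma weight_f w c : U w -> h w = c *: w -> h (f w) = (c - 2) *: f w.
Proof.
move=> Uw hw; have := sl2_hf mU Uw; rewrite hw (linZ lf) => /eqP.
by rewrite subr_eq => /eqP ->; lmod X.
Qed.

Lemma weight_fn w c n : U w -> h w = c *: w ->
  h (iter n f w) = (c - (2 * n)%:R) *: iter n f w.
Proof.
move=> Uw hw; elim: n => [|n IHn]; first by rewrite muln0 subr0.
by rewrite iterS (weight_f (sl2_Ufn n Uw) IHn) mulnS natrD; congr (_ *: _); ring.
Qed.

(** A weight vector has only finitely many nonzero images under the raising
operator, since these belong to distinct eigenvalues of [h], all of which are
roots of an annihilating polynomial. *)
Lemma raise_to_top w c : U w -> w != 0 -> h w = c *: w ->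
  exists n, iter n e w != 0 /\ e (iter n e w) = 0.
Proof.
move=> Uw w0 hw.
have [p p0 ph] := annih_global sU fU lh (sl2_Uh mU).
have [n en0] : exists n, iter n e w == 0.
  apply: contrapT => /forallNP en0.
  pose s := [seq c + (2 * i)%:R | i <- iota 0 (size p)].
  have : (size s < size p)%N.
    apply: max_poly_roots p0 _ _.
      apply/allP => x /mapP[i _ ->]; have /negP ei0 := en0 i.
      apply: contraNT ei0 => px; have := ph _ (sl2_Uen i Uw).
      rewrite (pact_eigen lh _ (weight_en i Uw hw)) => /eqP.
      by rewrite scaler_eq0 (rootPf px) ?orbF // => /orP[] // /eqP; move/eqP: px.
    rewrite map_inj_uniq ?iota_uniq // => i j /addrI/eqP.
    by rewrite eqr_nat => /eqP ij; lia.
  by rewrite size_map size_iota ltnn.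
have ex0 : exists n, iter n e w == 0 by exists n.
case: (ex_minnP ex0) => -[|k] ek0 mink; first by rewrite ek0 in w0.
exists k; split; last exact/eqP.
by apply/negP => /mink; rewrite ltnn.
Qed.

Lemma e_fn w c n : U w -> e w = 0 -> h w = c *: w ->
  e (iter n.+1 f w) = (n.+1%:R * (c - n%:R)) *: iter n f w.
Proof.
move=> Uw ew hw; elim: n => [|n IHn].
  have := sl2_ef mU Uw; rewrite ew (lin0 lf) subr0 hw => ->.
  by rewrite mul1r subr0.
have /eqP := sl2_ef mU (sl2_Ufn n.+1 Uw); rewrite -iterS subr_eq => /eqP ->.
rewrite IHn (weight_fn _ Uw hw) (linZ lf) -iterS -scalerDl; congr (_ *: _).
by rewrite natrM -!natr1; ring.
Qed.

End HighestWeight.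

(** Since e f^(n+1) w is (n+1) (c - n) times f^n w, the string generated by w can only
stop at n = c. *)
Lemma highest_weight_nat (C : numFieldType) (X : lmodType C) (U : X -> Prop)
    (e h f : X -> X) (w : X) (c : C) :
  sl2mod U e h f -> findim U -> U w -> w != 0 -> e w = 0 -> h w = c *: w ->
  exists n : nat, [/\ c = n%:R, iter n f w != 0 & iter n.+1 f w = 0].
Proof.
move=> mU fU Uw w0 ew hw.
have hw' : - h w = (- c) *: w by rewrite hw scaleNr.
have [n [fn0 fn1]] := raise_to_top (sl2mod_swap mU) fU Uw w0 hw'.
exists n; split=> //.
have := e_fn mU n Uw ew hw; rewrite /= fn1 (lin0 (sl2_line mU)).
move/esym/eqP; rewrite scaler_eq0 (negbTE fn0) orbF mulf_eq0 pnatr_eq0 /=.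
by rewrite subr_eq0 => /eqP.
Qed.

Section Casimir.
Variables (C : numClosedFieldType) (X : lmodType C).

Definition casimir (e h f : X -> X) (u : X) : X :=
  2 *: e (f u) + 2 *: f (e u) + h (h u).

Lemma casimir_swap (U : X -> Prop) (e h f : X -> X) : sl2mod U e h f ->
  casimir f (fun u => - h u) e = casimir e h f.
Proof.
move=> mU; apply/funext => u; rewrite /casimir (linN (sl2_linh mU)).
by rewrite opprK [X in X + _]addrC.
Qed.

Section Basics.
Variables (U : X -> Prop) (e h f : X -> X).
Hypothesis mU : sl2mod U e h f.
Let sU := sl2_sub mU.
Let le := sl2_line mU.
Let lh := sl2_linh mU.
Let lf := sl2_linf mU.
Let Ue := sl2_Ue mU.
Let Uh := sl2_Uh mU.
Let Uf := sl2_Uf mU.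

Lemma sl2_efE u : U u -> e (f u) = f (e u) + h u.
Proof. by move=> Uu; rewrite -(sl2_ef mU Uu); lmod X. Qed.
Lemma sl2_heE u : U u -> h (e u) = e (h u) + 2 *: e u.
Proof. by move=> Uu; rewrite -(sl2_he mU Uu); lmod X. Qed.
Lemma sl2_hfE u : U u -> h (f u) = f (h u) - 2 *: f u.
Proof. by move=> Uu; rewrite -(sl2_hf mU Uu); lmod X. Qed.

Definition sl2_lin := (linD le, linD lh, linD lf, linZ le, linZ lh, linZ lf,
  linN le, linN lh, linN lf).

Lemma casimir_lin : linear (casimir e h f).
Proof. by move=> c u v; rewrite /casimir le lh lf le lh lf; lmod X. Qed.

Lemma casimir_U u : U u -> U (casimir e h f u).
Proof.
move=> Uu; apply: submodD => //; first apply: submodD => //; last exact/Uh/Uh.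
  by apply: submodZ => //; apply/Ue/Uf.
by apply: submodZ => //; apply/Uf/Ue.
Qed.

Ltac pbw := repeat first
  [ rewrite !sl2_lin | rewrite sl2_efE; [|by auto 8] | rewrite sl2_heE; [|by auto 8]
  | rewrite sl2_hfE; [|by auto 8] ].

Lemma casimir_e u : U u -> e (casimir e h f u) = casimir e h f (e u).
Proof. by move=> Uu; rewrite /casimir; pbw; lmod X. Qed.
Lemma casimir_h u : U u -> h (casimir e h f u) = casimir e h f (h u).
Proof. by move=> Uu; rewrite /casimir; pbw; lmod X. Qed.
Lemma casimir_f u : U u -> f (casimir e h f u) = casimir e h f (f u).
Proof. by move=> Uu; rewrite /casimir; pbw; lmod X. Qed.

End Basics.

Section Nilpotent.
Variables (U : X -> Prop) (e h f : X -> X) (a : nat).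
Hypothesis mU : sl2mod U e h f.
Hypothesis fU : findim U.
Local Notation Om := (casimir e h f).

Let nilp u := U u /\ pact Om 'X^a u = 0.

Lemma casimir_nil_e u : nilp u -> nilp (e u).
Proof.
case=> Uu nu; split; first exact: (sl2_Ue mU).
rewrite -(pact_comm _ (sl2_line mU) (casimir_U mU) _ Uu) ?nu ?(lin0 (sl2_line mU)) //.
by move=> v Uv; rewrite (casimir_e mU).
Qed.

(** On a highest weight vector of weight c the Casimir element acts by
c (c + 2), which vanishes for no positive integer c. *)
Lemma casimir_nil_weight w c : nilp w -> w != 0 -> h w = c *: w ->
  exists n : nat, c = - (2 * n)%:R.
Proof.
move=> nw w0 hw; have [Uw _] := nw.
have [n [en0 een]] := raise_to_top mU fU Uw w0 hw.
exists n; set v := iter n e w in en0 een.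
have [Uv nv] : nilp v by rewrite /v; elim: (n) => //= i /casimir_nil_e.
have hv := weight_en mU n Uw hw; rewrite -/v in hv.
have [k [ck _ _]] := highest_weight_nat mU fU Uv en0 een hv.
have Ov : Om v = (k * (k + 2))%:R *: v.
  rewrite /casimir een (lin0 (sl2_linf mU)) (sl2_efE mU) // een (lin0 (sl2_linf mU)).
  rewrite hv ck (linZ (sl2_linh mU)) hv ck natrM natrD; lmod X.
move: nv; rewrite (pact_eigen (casimir_lin mU) _ Ov) => /eqP.
rewrite scaler_eq0 (negbTE en0) orbF hornerXn expf_eq0 pnatr_eq0 => /andP[_].
rewrite muln_eq0 addn2 orbF => /eqP k0; move/eqP: ck.
by rewrite k0 addr_eq0 => /eqP.
Qed.

End Nilpotent.

(** Raising an eigenvector of h to the top shows that its weight c is nonpositive,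
and lowering it to the bottom that it is nonnegative. *)
Lemma casimir_nil_weight0 (U : X -> Prop) (e h f : X -> X) a w c :
  sl2mod U e h f -> findim U -> U w -> pact (casimir e h f) 'X^a w = 0 ->
  w != 0 -> h w = c *: w -> c = 0.
Proof.
move=> mU fU Uw nw w0 hw.
have [n cn] := casimir_nil_weight mU fU (conj Uw nw) w0 hw.
have mU' := sl2mod_swap mU.
have hw' : - h w = (- c) *: w by rewrite hw scaleNr.
rewrite -(casimir_swap mU) in nw.
have [k ck] := casimir_nil_weight mU' fU (conj Uw nw) w0 hw'.
move: ck; rewrite cn opprK => /eqP; rewrite -addr_eq0 -natrD pnatr_eq0 => nk0.
have -> : (2 * n = 0)%N by lia.
by rewrite mulr0n oppr0.
Qed.

(** Here 0 is the only eigenvalue of h, so h is nilpotent; since e shifts weights by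
2, a nonzero e u would produce the eigenvalue 2. *)
Lemma casimir_nil_e0 (U : X -> Prop) (e h f : X -> X) a u :
  sl2mod U e h f -> findim U -> U u -> pact (casimir e h f) 'X^a u = 0 -> e u = 0.
Proof.
move=> mU fU Uu nu; have lh := sl2_linh mU; have Uh := sl2_Uh mU.
have lO := casimir_lin mU; have UO := casimir_U mU.
have hvec v p mu : U v -> pact (casimir e h f) 'X^a v = 0 -> pact h p v != 0 ->
    h (pact h p v) = mu *: pact h p v -> mu = 0.
  move=> Uv nv p0; apply: (casimir_nil_weight0 mU fU (a := a)) => //.
    exact: (submod_pact (sl2_sub mU) _ Uh Uv).
  rewrite (pact_comm _ (pact_lin lO _) Uh _ Uv) ?nv ?(lin0 (pact_lin lh _)) // => x Ux.
  by rewrite (pact_comm _ lh UO _ Ux) // => y Uy; rewrite (casimir_h mU).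
have [q q0 qh] := annih_global (sl2_sub mU) fU lh Uh.
have [b [p p_root qE]] := multiplicity_XsubC q 0.
rewrite q0 /= in p_root.
(* p collects the nonzero roots of the annihilating polynomial of h. *)
have hb0 : pact h 'X^b u = 0.
  apply/eqP/negPn/negP => v0.
  have p0 : p != 0 by apply: contraNneq q0 => p0; rewrite qE p0 mul0r.
  have [|mu mu_root [r [r0 hr]]] := eigvec (p := p) lh p0 v0.
    by rewrite -pactM // -['X]subr0 -qE qh.
  rewrite -pactM // in r0 hr.
  by move: p_root; rewrite -(hvec _ _ _ Uu nu r0 hr) mu_root.
apply/eqP/negPn/negP => eu0.
have eub : pact h (('X - 2%:P) ^+ b) (e u) = 0.
  suff -> : pact h (('X - 2%:P) ^+ b) (e u) = e (pact h 'X^b u).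
    by rewrite hb0 (lin0 (sl2_line mU)).
  elim: b {hb0 qE} => [|b IHb]; first by rewrite !pact1.
  rewrite !exprS !pactM // IHb pactX // pactD // pactX // -polyCN pactC.
  rewrite (sl2_heE mU) ?scaleNr ?addrK //.
  exact: (submod_pact (sl2_sub mU) _ Uh Uu).
have X20 : ('X - 2%:P) ^+ b != 0 :> {poly C} by rewrite expf_neq0 ?polyXsubC_eq0.
have [mu mu_root [r [r0 hr]]] := eigvec lh X20 eu0 eub.
have [Ueu neu] := casimir_nil_e mU (conj Uu nu).
have mu0 := hvec _ _ _ Ueu neu r0 hr.
move: mu_root; rewrite mu0 rootE horner_exp hornerXsubC expf_eq0 sub0r oppr_eq0.
by rewrite pnatr_eq0 andbF.
Qed.

(** The Casimir element is invertible on a stable complement of the invariants,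
and the projector onto the invariants is a polynomial in it: being annihilated
by a power of the Casimir element already means being invariant. *)
Lemma casimir_split (U : X -> Prop) (e h f : X -> X) :
  sl2mod U e h f -> findim U ->
  exists p r, forall u, U u ->
    [/\ u = pact (casimir e h f) p u + casimir e h f (pact (casimir e h f) r u),
        e (pact (casimir e h f) p u) = 0, h (pact (casimir e h f) p u) = 0
      & f (pact (casimir e h f) p u) = 0].
Proof.
move=> mU fU; have lO := casimir_lin mU; have UO := casimir_U mU.
have [q q0 qO] := annih_global (sl2_sub mU) fU lO UO.
have [a [p p_root qE]] := multiplicity_XsubC q 0.
rewrite q0 subr0 /= in p_root qE.
have : coprimep ('X^(a.+1)) p.
  by rewrite coprimep_expl // coprimep_sym -['X]subr0 coprimep_XsubC.
case/Bezout_eq1_coprimepP => -[r1 r2] /= Bez.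
exists (r2 * p), (r1 * 'X^a) => u Uu; set P := pact _ (r2 * p).
have UP : U (P u) by exact: (submod_pact (sl2_sub mU) _ UO Uu).
have nP : pact (casimir e h f) 'X^a (P u) = 0.
  by rewrite -pactM // mulrC -mulrA -qE pactM // qO // (lin0 (pact_lin lO _)).
have e0 := casimir_nil_e0 mU fU UP nP.
have f0 : f (P u) = 0.
  rewrite -(casimir_swap mU) in nP.
  exact: casimir_nil_e0 (sl2mod_swap mU) fU UP nP.
split=> //; last by rewrite -(sl2_ef mU) // e0 f0 (lin0 (sl2_line mU)) (lin0 (sl2_linf mU)) subr0.
rewrite -pactMX // -mulrA -exprSr -pactD // -[LHS](pact1 (casimir e h f)).
by congr (pact _ _ u); rewrite -Bez addrC.
Qed.

End Casimir.

Section Whitehead.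
Variables (C : numClosedFieldType) (X : lmodType C) (U : X -> Prop) (e h f : X -> X).
Hypothesis mU : sl2mod U e h f.
Hypothesis fU : findim U.
Let sU := sl2_sub mU.
Let le := sl2_line mU.
Let lh := sl2_linh mU.
Let lf := sl2_linf mU.
Let Ue := sl2_Ue mU.
Let Uh := sl2_Uh mU.
Let Uf := sl2_Uf mU.

Ltac pbw tac := repeat first
  [ rewrite !(sl2_lin mU) | progress tac | rewrite (sl2_efE mU); [|by auto 8]
  | rewrite (sl2_heE mU); [|by auto 8] | rewrite (sl2_hfE mU); [|by auto 8] ].

Variables p r : {poly C}.
Local Notation Om := (casimir e h f).
Local Notation P := (pact Om p).
Local Notation R := (pact Om r).
Hypothesis splitU : forall u, U u ->
  [/\ u = P u + Om (R u), e (P u) = 0, h (P u) = 0 & f (P u) = 0].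

Let lO := casimir_lin mU.
Let UO := casimir_U mU.

Lemma invproj_U u : U u -> U (P u).
Proof. exact: (submod_pact sU _ UO). Qed.

Lemma casinv_U u : U u -> U (R u).
Proof. exact: (submod_pact sU _ UO). Qed.

Lemma casimir_poly_comm (Y : X -> X) q u : linear Y ->
  (forall u, U u -> Y (Om u) = Om (Y u)) -> U u -> Y (pact Om q u) = pact Om q (Y u).
Proof. by move=> lY YO; apply: (pact_comm (U := U)). Qed.

Lemma poly_e q u : U u -> e (pact Om q u) = pact Om q (e u).
Proof. by apply: casimir_poly_comm => //; apply: casimir_e. Qed.
Lemma poly_h q u : U u -> h (pact Om q u) = pact Om q (h u).
Proof. by apply: casimir_poly_comm => //; apply: casimir_h. Qed.
Lemma poly_f q u : U u -> f (pact Om q u) = pact Om q (f u).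
Proof. by apply: casimir_poly_comm => //; apply: casimir_f. Qed.

Lemma invproj_e u : U u -> P (e u) = 0.
Proof. by move=> Uu; rewrite -poly_e //; case: (splitU Uu). Qed.
Lemma invproj_h u : U u -> P (h u) = 0.
Proof. by move=> Uu; rewrite -poly_h //; case: (splitU Uu). Qed.
Lemma invproj_f u : U u -> P (f u) = 0.
Proof. by move=> Uu; rewrite -poly_f //; case: (splitU Uu). Qed.

Lemma invproj_id u : U u -> e u = 0 -> h u = 0 -> f u = 0 -> P u = u.
Proof.
move=> Uu eu hu fu; case: (splitU Uu) => uE _ _ _.
have Ou : Om u = 0 by rewrite /casimir eu hu fu !(lin0 le, lin0 lh, lin0 lf, scaler0, addr0).
by rewrite [RHS]uE (casimir_poly_comm r lO) // Ou (lin0 (pact_lin lO r)) addr0.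
Qed.

(** Up to the invertible Casimir element, a vector without invariant part is a
combination of images of e, h and f by the very definition of that element. *)
Lemma noninv_sum u : U u -> P u = 0 ->
  exists a b c, [/\ U a, U b, U c & u = e a + h b + f c].
Proof.
move=> Uu Pu; case: (splitU Uu) => uE _ _ _; have URu := casinv_U Uu.
exists (2 *: f (R u)), (h (R u)), (2 *: e (R u)); split; [|by auto| |].
- by apply: (submodZ sU); auto.
- by apply: (submodZ sU); auto.
by rewrite [LHS]uE Pu add0r /casimir (linZ le) (linZ lf); lmod X.
Qed.

(** First Whitehead lemma: contracting with the dual basis for the Killing form
is a homotopy between the Casimir element and zero. *)
Lemma whitehead1 ue uh uf : U ue -> U uh -> U uf ->
  h ue - e uh = 2 *: ue -> h uf - f uh = - (2 *: uf) -> e uf - f ue = uh ->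
  exists g, [/\ U g, ue = e g, uh = h g & uf = f g].
Proof.
move=> Uue Uuh Uuf Ee Ef Eh.
have lP := pact_lin lO p; have lR := pact_lin lO r.
have nz2 : (2 : C) != 0 by rewrite pnatr_eq0.
have Pe : P ue = 0.
  apply: (scalerI nz2).
  by rewrite scaler0 -(linZ lP) -Ee (linB lP) invproj_h // invproj_e // subr0.
have Pf : P uf = 0.
  apply: (scalerI nz2); rewrite scaler0 -(linZ lP); apply/eqP.
  by rewrite -oppr_eq0 -(linN lP) -Ef (linB lP) invproj_h // invproj_f // subr0.
have Ph : P uh = 0 by rewrite -Eh (linB lP) invproj_e // invproj_f // subr0.
set ve := R ue; set vh := R uh; set vf := R uf.
have Uve : U ve by exact: casinv_U.
have Uvh : U vh by exact: casinv_U.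
have Uvf : U vf by exact: casinv_U.
have E1 : h ve = e vh + 2 *: ve.
  by rewrite poly_h // poly_e // -(linZ lR) -(linD lR) -Ee; congr (R _); lmod X.
have E2 : h vf = f vh - 2 *: vf.
  by rewrite poly_h // poly_f // -(linZ lR) -(linN lR) -(linD lR) -Ef; congr (R _); lmod X.
have E3 : e vf = f ve + vh.
  by rewrite poly_e // poly_f // -(linD lR) -Eh; congr (R _); lmod X.
(* The contraction with the dual basis, applied to the cocycle divided by the
   Casimir element. *)
exists (2 *: e vf + 2 *: f ve + h vh); split.
- by apply: (submodD sU); auto; apply: (submodD sU); apply: (submodZ sU); auto.
- have [-> _ _ _] := splitU Uue; rewrite Pe add0r -/ve /casimir.
  by pbw ltac:(rewrite ?E1 ?E2 ?E3); lmod X.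
- have [-> _ _ _] := splitU Uuh; rewrite Ph add0r -/vh /casimir.
  by pbw ltac:(rewrite ?E1 ?E2 ?E3); lmod X.
- have [-> _ _ _] := splitU Uuf; rewrite Pf add0r -/vf /casimir.
  by pbw ltac:(rewrite ?E1 ?E2 ?E3); lmod X.
Qed.

(** Second Whitehead lemma. On the invariant part the cocycle has trivial
coefficients, and is a coboundary because the bracket is onto. *)
Lemma whitehead2 uef ueh uhf : U uef -> U ueh -> U uhf ->
  e uhf - h uef + f ueh = 0 ->
  exists ge gh gf, [/\ U ge, U gh & U gf] /\
    [/\ uef = e gf - f ge - gh, ueh = e gh - h ge + 2 *: ge
      & uhf = h gf - f gh + 2 *: gf].
Proof.
move=> Uuef Uueh Uuhf E0.
have lR := pact_lin lO r.
set vef := R uef; set veh := R ueh; set vhf := R uhf.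
have Uvef : U vef by exact: casinv_U.
have Uveh : U veh by exact: casinv_U.
have Uvhf : U vhf by exact: casinv_U.
have E1 : h vef = e vhf + f veh.
  rewrite poly_h // poly_e // poly_f // -(linD lR); congr (R _).
  by rewrite -[h uef]add0r -E0; lmod X.
have [Eef ef0 hf0 ff0] := splitU Uuef.
have [Eeh eh0 hh0 fh0] := splitU Uueh.
have [Ehf e0 h0 f0] := splitU Uuhf.
(* The contraction with the dual basis, plus a primitive of the invariant part. *)
exists (- (2 *: e vef) - h veh + 2^-1 *: P ueh),
  (- (2 *: e vhf) + 2 *: f veh - P uef),
  (2 *: f vef + h vhf + 2^-1 *: P uhf).
have UPef := invproj_U Uuef; have UPeh := invproj_U Uueh; have UPhf := invproj_U Uuhf.
split; first by split; repeat first [apply: (submodB sU) | apply: (submodN sU)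
  | apply: (submodD sU) | apply: (submodZ sU)]; auto.
split.
- rewrite [LHS]Eef -/vef /casimir.
  pbw ltac:(rewrite ?E1 ?eh0 ?fh0 ?hh0 ?ef0 ?hf0 ?ff0 ?e0 ?f0 ?h0).
  by lmod X.
- rewrite [LHS]Eeh -/veh /casimir.
  pbw ltac:(rewrite ?E1 ?eh0 ?fh0 ?hh0 ?ef0 ?hf0 ?ff0 ?e0 ?f0 ?h0).
  by lmod_prepare X; field.
- rewrite [LHS]Ehf -/vhf /casimir.
  pbw ltac:(rewrite ?E1 ?eh0 ?fh0 ?hh0 ?ef0 ?hf0 ?ff0 ?e0 ?f0 ?h0).
  by lmod_prepare X; field.
Qed.

End Whitehead.

(** * Currying the Chevalley-Eilenberg complex *)

Section ConsTuples.
Variable L : Type.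

Definition fcons k (x : L) (y : {ffun 'I_k -> L}) : {ffun 'I_k.+1 -> L} :=
  [ffun i => if unlift ord0 i is Some j then y j else x].

Definition ftail k (x : {ffun 'I_k.+1 -> L}) : {ffun 'I_k -> L} :=
  [ffun i => x (lift ord0 i)].

Lemma fcons0 k x (y : {ffun 'I_k -> L}) : fcons x y ord0 = x.
Proof. by rewrite ffunE unlift_none. Qed.

Lemma fconsS k x (y : {ffun 'I_k -> L}) i : fcons x y (lift ord0 i) = y i.
Proof. by rewrite ffunE liftK. Qed.

Lemma ftailK k (x : {ffun 'I_k.+1 -> L}) : fcons (x ord0) (ftail x) = x.
Proof.
by apply/ffunP => i; rewrite !ffunE; case: unliftP => [j ->|->]; rewrite ?ffunE.
Qed.

Lemma fconsK k x (y : {ffun 'I_k -> L}) : ftail (fcons x y) = y.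
Proof. by apply/ffunP => i; rewrite ffunE fconsS. Qed.

Lemma ffun_ord0 (x y : {ffun 'I_0 -> L}) : x = y.
Proof. by apply/ffunP => -[]. Qed.

End ConsTuples.

Section Currying.
Variables (F : fieldType) (L : lieAlgType F) (M : lmodType F) (rho : lieModule L M).
Local Notation Fn k := ({ffun 'I_k -> L} -> M).
Local Notation C k := (cur L M k).

(** The dummy argument in degree 0 is the unique map from an empty index type. *)
Fixpoint ffcurry (k : nat) : Fn k -> C k :=
  match k with
  | 0 => fun f => f [ffun=> 0]
  | k'.+1 => fun f x => @ffcurry k' (fun y => f (fcons x y))
  end.

Fixpoint ffuncurry (k : nat) : C k -> Fn k :=
  match k with
  | 0 => fun m _ => m
  | k'.+1 => fun f y => ffuncurry (f (y ord0)) (ftail y)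
  end.

Lemma ffcurryK k : cancel (@ffcurry k) (@ffuncurry k).
Proof.
elim: k => [|k IHk] f; apply/funext => y /=; first by congr f; apply: ffun_ord0.
by rewrite IHk ftailK.
Qed.

Lemma ffuncurryK k : cancel (@ffuncurry k) (@ffcurry k).
Proof.
elim: k => [|k IHk] f //=; apply/funext => x; rewrite -[RHS]IHk; congr ffcurry.
by apply/funext => y; rewrite /= fcons0 fconsK.
Qed.

Lemma ffcurry_app k (f : Fn k.+1) x y : f (fcons x y) = ffuncurry (ffcurry f x) y.
Proof. by rewrite -[LHS]/((fun z => f (fcons x z)) y) -[fun z => _]ffcurryK. Qed.

Lemma ffcurry_lin k : linear (@ffcurry k).
Proof.
by elim: k => [|k IHk] c f g //=; apply/funext => x; rewrite curE curZ -IHk.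
Qed.

Lemma set_arg0 k x (y : {ffun 'I_k -> L}) u : set_arg (fcons x y) ord0 u = fcons u y.
Proof.
apply/ffunP => i; rewrite !ffunE; case: unliftP => [j ->|->]; last by rewrite eqxx.
by rewrite eq_sym (negbTE (neq_lift _ _)).
Qed.

Lemma set_argS k x (y : {ffun 'I_k -> L}) i u :
  set_arg (fcons x y) (lift ord0 i) u = fcons x (set_arg y i u).
Proof.
apply/ffunP => j; rewrite !ffunE; case: unliftP => [l ->|->].
  by rewrite (inj_eq (@lift_inj _ ord0)) ffunE.
by rewrite (negbTE (neq_lift _ _)).
Qed.

Lemma omit0 k x (y : {ffun 'I_k -> L}) : omit (fcons x y) ord0 = y.
Proof. by apply/ffunP => i; rewrite ffunE fconsS. Qed.

Lemma lift_lift0 k (i : 'I_k.+1) (j : 'I_k) :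
  lift (lift ord0 i) (lift ord0 j) = lift ord0 (lift i j).
Proof. by apply: val_inj; rewrite /= /bump /= !add1n !ltnS addnS. Qed.

Lemma omitS k x (y : {ffun 'I_k.+1 -> L}) i :
  omit (fcons x y) (lift ord0 i) = fcons x (omit y i).
Proof.
apply/ffunP => j; rewrite [LHS]ffunE; case: (unliftP ord0 j) => [l ->|->].
  by rewrite lift_lift0 !fconsS ffunE.
rewrite fcons0 (_ : lift _ _ = ord0) ?fcons0 //.
by apply: val_inj.
Qed.

Definition omit2_tail k (x : {ffun 'I_k.+2 -> L}) (i j : 'I_k.+2) :
  {ffun 'I_k -> L} := [ffun p : 'I_k => x (inord (bump j (bump i p)))].

Lemma omit2E k (x : {ffun 'I_k.+2 -> L}) i j :
  omit2 x i j = fcons (lie (x i) (x j)) (omit2_tail x i j).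
Proof.
apply/ffunP => p; rewrite ffunE; case: (unliftP ord0 p) => [l ->|->].
  by rewrite fconsS ffunE.
by rewrite fcons0.
Qed.

Lemma omit2_0 k x (y : {ffun 'I_k.+1 -> L}) (j : 'I_k.+1) :
  omit2_tail (fcons x y) ord0 (lift ord0 j) = omit y j.
Proof.
apply/ffunP => p; rewrite !ffunE.
rewrite (_ : inord _ = lift ord0 (lift j p)) ?liftK //.
apply: val_inj => /=; have lt_p := ltn_ord p.
by rewrite inordK /bump /=; lia.
Qed.

Lemma omit2_S k x (y : {ffun 'I_k.+2 -> L}) (i j : 'I_k.+2) : (i < j)%N ->
  omit2_tail (fcons x y) (lift ord0 i) (lift ord0 j) = fcons x (omit2_tail y i j).
Proof.
move=> ij; apply/ffunP => p; rewrite [LHS]ffunE; case: (unliftP ord0 p) => [l ->|->].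
  rewrite fconsS [RHS]ffunE -(fconsS x y); congr (fcons x y _); apply: val_inj.
  have lt1 : (@nat_of_ord k l < k)%N by case: (l).
  have lt2 := ltn_ord j.
  by rewrite /= !inordK /bump /=; lia.
rewrite fcons0 (_ : inord _ = ord0) ?fcons0 //.
by apply: val_inj; rewrite /= inordK /bump /=; lia.
Qed.

Lemma cochain_app k (f : Fn k.+1) x : is_cochain f -> is_cochain (fun y => f (fcons x y)).
Proof.
case=> mf af; split=> [y i c u v|y i j ij yij].
  by rewrite -!set_argS mf.
by apply: (af _ (lift ord0 i) (lift ord0 j)); rewrite ?fconsS ?(inj_eq (@lift_inj _ ord0)).
Qed.

Lemma ffcurry_altm k (f : Fn k) : is_cochain f -> altm (ffcurry f).
Proof.
elim: k f => // k IHk f cf; have [mf af] := cf; split.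
- move=> c u v; rewrite /= -ffcurry_lin; congr ffcurry; apply/funext => y.
  by have := mf (fcons 0 y) ord0 c u v; rewrite !set_arg0.
- by move=> x; apply/IHk/cochain_app.
- case: k f {IHk cf} mf af => // k f mf af x /=.
  rewrite (_ : (fun y => _) = 0) ?(lin0 (@ffcurry_lin _)) //; apply/funext => y.
  apply: (af _ ord0 (lift ord0 ord0)); first exact: neq_lift.
  by rewrite fconsS !fcons0.
Qed.

Lemma ffuncurry_lin k : linear (@ffuncurry k).
Proof.
by elim: k => [|k IHk] c f g; apply/funext => y //; rewrite /= IHk.
Qed.

(** An argument equal to the first one is brought next to it by an exchange of the first
two arguments and the induction hypothesis. *)
Lemma ffuncurry_cochain k (f : C k) : altm f -> is_cochain (ffuncurry f).
Proof.
elim: k f => [|k IHk] f cf; first by split=> [y []|y []].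
have ucons x y : ffuncurry f (fcons x y) = ffuncurry (f x) y by rewrite /= fcons0 fconsK.
split=> [x i c u v|x].
  rewrite -(ftailK x); case: (unliftP ord0 i) => [j ->|->].
    by rewrite !set_argS !ucons; apply: (IHk _ (altm_app _ cf)).1.
  by rewrite !set_arg0 !ucons (altm_lin cf) ffuncurry_lin.
suff alt0 (y : L) (z : {ffun 'I_k -> L}) (j : 'I_k) : y = z j -> ffuncurry f (fcons y z) = 0.
  move=> i j; rewrite -(ftailK x).
  case: (unliftP ord0 i) => [i' ->|->]; case: (unliftP ord0 j) => [j' ->|->] //.
  - rewrite (inj_eq (@lift_inj _ ord0)) !fconsS ucons.
    by apply: (IHk _ (altm_app _ cf)).2.
  - by rewrite fcons0 fconsS => _ /esym; apply: alt0.
  - by rewrite fcons0 fconsS => _; apply: alt0.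
case: k f IHk cf {x} ucons z j => [|k] f IHk cf ucons z; first by case.
rewrite -(ftailK z) => j; case: (unliftP ord0 j) => [l ->|->].
  rewrite fconsS ucons => yE /=; rewrite fcons0 fconsK (altm_anti _ _ cf).
  rewrite (linN (@ffuncurry_lin _)) /= fctE.
  have [_ /(_ (fcons y (ftail z)) ord0 (lift ord0 l))] := IHk _ (altm_app (z ord0) cf).
  by rewrite fcons0 fconsS /= fcons0 fconsK => -> //; rewrite ?oppr0.
by rewrite fcons0 ucons => -> /=; rewrite fcons0 fconsK (altm_diag _ cf) (lin0 (@ffuncurry_lin _)).
Qed.

Lemma fswap k (f : Fn k.+2) x y z : is_cochain f ->
  f (fcons x (fcons y z)) = - f (fcons y (fcons x z)).
Proof.
move=> cf; rewrite (ffcurry_app f) (ffcurry_app f) /= !fcons0 !fconsK.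
by have := altm_anti x y (ffcurry_altm cf) => /= ->; rewrite (linN (@ffuncurry_lin _)).
Qed.

(** Moving u from the front to position j costs j transpositions. *)
Lemma fmove k (f : Fn k.+1) u (y : {ffun 'I_k.+1 -> L}) (j : 'I_k.+1) : is_cochain f ->
  (-1) ^+ j *: f (fcons u (omit y j)) = f (set_arg y j u).
Proof.
elim: k f y j => [|k IHk] f y j cf; rewrite -(ftailK y);
  case: (unliftP ord0 j) => [i ->|->]; rewrite ?set_arg0 ?omit0 ?scale1r //.
  by case: i.
rewrite set_argS omitS fswap // /= exprS mulN1r scaleNr scalerN opprK.
exact: (IHk (fun z => f (fcons (y ord0) z)) (ftail y) i (cochain_app _ cf)).
Qed.

Definition fth k x (f : Fn k) : Fn k := fun y =>
  rho x (f y) - \sum_(i < k) f (set_arg y i (lie x (y i))).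

Lemma ffcurry_fth k x (f : Fn k) : ffcurry (fth x f) = der (lie x) (rho x) (ffcurry f).
Proof.
elim: k f => [|k IHk] f; first by rewrite /= /fth big_ord0 subr0.
apply/funext => z; rewrite derS /= -IHk -(linB (@ffcurry_lin _)); congr ffcurry.
apply/funext => y; rewrite /fth big_ord_recl set_arg0 fcons0 !fctE.
rewrite [X in _ - (_ + X)](_ : _ = \sum_(i < k) f (fcons z (set_arg y i (lie x (y i))))).
  by rewrite opprD addrA addrAC.
by apply: eq_bigr => i _; rewrite set_argS fconsS.
Qed.

(** Cartan's formula. The terms of the differential that do not single out x form the
differential of the contraction with x, up to sign; those in which x acts or is
bracketed form the Lie derivative along x. *)
Lemma ce_diff_cons k (f : Fn k.+1) x y : is_cochain f ->
  ce_diff rho f (fcons x y) = fth x f y - ce_diff rho (fun z => f (fcons x z)) y.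
Proof.
move=> cf; rewrite /ce_diff /fth.
rewrite [X in X + _ = _]big_ord_recl fcons0 omit0 scale1r.
rewrite (eq_bigr (fun i : 'I_k.+1 =>
   - ((-1) ^+ i *: rho (y i) (f (fcons x (omit y i)))))); last first.
  by move=> i _; rewrite fconsS omitS /= exprS mulN1r scaleNr.
rewrite sumrN [X in _ + X = _]big_ord_recl.
rewrite [X in _ + (X + _) = _]big_mkcond [X in _ + (X + _) = _]big_ord_recl /= add0r.
rewrite [X in _ + (X + _) = _](eq_bigr (fun j : 'I_k.+1 => - f (set_arg y j (lie x (y j))))); last first.
  move=> j _; rewrite -fmove // omit2E fcons0 fconsS omit2_0.
  by rewrite /bump leq0n add0n add1n exprS mulN1r scaleNr.
rewrite sumrN.
rewrite [X in _ + (_ + X) = _](_ : _ = - \sum_(i < k.+1)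
   \sum_(j < k.+1 | (i < j)%N) (-1) ^+ (i + j) *: f (fcons x (omit2 y i j))).
  by rewrite opprD !addrA; congr (_ - _); rewrite addrAC.
rewrite -sumrN; apply: eq_bigr => i _.
rewrite big_mkcond big_ord_recl /= add0r -sumrN [RHS]big_mkcond.
apply: eq_bigr => j _; rewrite /bump !leq0n !add1n ltnS; case: ltnP => // ij.
case: k f y cf i j ij => [|k] f y cf i j ij; first by case: i j ij => [[] ? [[]]].
rewrite !omit2E !fconsS omit2_S // fswap // scalerN addSn addnS !exprS.
by rewrite !mulN1r opprK.
Qed.

Lemma ffcurry_ce_diff k (f : Fn k) : is_cochain f ->
  ffcurry (ce_diff rho f) = dif lie rho (ffcurry f).
Proof.
elim: k f => [|k IHk] f cf; apply/funext => x.
  rewrite /= /ce_diff !big_ord_recl !big_ord0 /= !fcons0 omit0 scale1r !addr0.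
  by rewrite big_pred0 ?addr0 // => i; case: i => -[].
rewrite difS -ffcurry_fth [X in _ - X](_ : _ = ffcurry (ce_diff rho (fun z => f (fcons x z)))).
  rewrite -(linB (@ffcurry_lin k.+1)).
  rewrite [LHS](_ : _ = ffcurry (fun y => ce_diff rho f (fcons x y))) //.
  by apply: (congr1 (@ffcurry k.+1)); apply/funext => y; rewrite ce_diff_cons.
by rewrite IHk //; apply: cochain_app.
Qed.

End Currying.

(** * The Lie algebra sl2 *)

Section Sl2Basis.
Variable C : numClosedFieldType.
Local Notation s := (sl C 2).
Local Notation i0 := (0 : 'I_2).
Local Notation i1 := (1 : 'I_2).

Definition cE (X : s) : C := X i0 i1.
Definition cH (X : s) : C := X i0 i0.
Definition cF (X : s) : C := X i1 i0.

Fact sl2_trace0 (a b c : C) :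
  \matrix_(i < 2, j < 2) (if i == 0 then (if j == 0 then b else a)
                          else (if j == 0 then c else - b)) \in trace0 (F := C) (n := 2).
Proof. by rewrite unfold_in /mxtrace !big_ord_recl big_ord0 !mxE /= addr0 subrr. Qed.

Definition slmk a b c : s := Sl (sl2_trace0 a b c).
Definition slE := slmk 1 0 0.
Definition slH := slmk 0 1 0.
Definition slF := slmk 0 0 1.

Lemma slP (X Y : s) : cE X = cE Y -> cH X = cH Y -> cF X = cF Y -> X = Y.
Proof.
move=> eE eH eF; apply: val_inj; apply/matrixP => i j.
have tr (Z : s) : Z i1 i1 = - cH Z.
  have := sl_valP Z; rewrite unfold_in /mxtrace !big_ord_recl big_ord0 addr0 /=.
  rewrite addrC addr_eq0 => /eqP; rewrite /cH.
  by rewrite (_ : lift ord0 ord0 = i1) //; apply: val_inj.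
have ij (l : 'I_2) : l = i0 \/ l = i1.
  by case: l => -[|[|//]] ?; [left | right]; apply: val_inj.
by case: (ij i) => ->; case: (ij j) => -> //; rewrite /= !tr eH.
Qed.

Lemma cE_lin : linear (cE : s -> C^o). Proof. by move=> c u v; rewrite /cE /= !mxE. Qed.
Lemma cH_lin : linear (cH : s -> C^o). Proof. by move=> c u v; rewrite /cH /= !mxE. Qed.
Lemma cF_lin : linear (cF : s -> C^o). Proof. by move=> c u v; rewrite /cF /= !mxE. Qed.

Lemma slmkE a b c : (cE (slmk a b c) = a) * (cH (slmk a b c) = b) * (cF (slmk a b c) = c).
Proof. by rewrite /cE /cH /cF /= !mxE. Qed.

Lemma slDE (X Y : s) : (cE (X + Y) = cE X + cE Y) * (cH (X + Y) = cH X + cH Y) *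
  (cF (X + Y) = cF X + cF Y).
Proof. by rewrite /cE /cH /cF /= !mxE. Qed.

Lemma slZE c (X : s) : (cE (c *: X) = c * cE X) * (cH (c *: X) = c * cH X) *
  (cF (c *: X) = c * cF X).
Proof. by rewrite /cE /cH /cF /= !mxE. Qed.

Lemma sl_decomp (X : s) : cE X *: slE + cH X *: slH + cF X *: slF = X :> s.
Proof. by apply: slP; rewrite !(slDE, slZE, slmkE); ring. Qed.

Lemma sl_lieE (X Y : s) :
  (cE (lie X Y) = 2 * (cH X * cE Y - cE X * cH Y)) *
  (cH (lie X Y) = cE X * cF Y - cF X * cE Y) *
  (cF (lie X Y) = 2 * (cF X * cH Y - cH X * cF Y)).
Proof.
have tr (Z : s) : Z i1 i1 = - cH Z.
  have := sl_valP Z; rewrite unfold_in /mxtrace !big_ord_recl big_ord0 addr0 /=.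
  rewrite addrC addr_eq0 => /eqP; rewrite /cH.
  by rewrite (_ : lift ord0 ord0 = i1) //; apply: val_inj.
have l1 : lift ord0 ord0 = i1 by apply: val_inj.
have o0 : ord0 = i0 by apply: val_inj.
have lE i j : lie X Y i j = (X *m Y - Y *m X) i j by [].
have XE (Z : s) : (Z i0 i1 = cE Z) * (Z i0 i0 = cH Z) * (Z i1 i0 = cF Z) by [].
have E1 : cE (lie X Y) = lie X Y i0 i1 by [].
have E2 : cH (lie X Y) = lie X Y i0 i0 by [].
have E3 : cF (lie X Y) = lie X Y i1 i0 by [].
by rewrite E1 E2 E3 !lE !mxE !big_ord_recl !big_ord0 !l1 !o0 !tr !XE;
  do ![split]; ring.
Qed.

End Sl2Basis.

(** * Multilinear maps on a module as sl2-modules *)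

Section RepLemmas.
Variables (F : fieldType) (L : lieAlgType F) (W : lmodType F) (beta : lieModule L W).
Lemma act_linr x : linear (beta x). Proof. exact: lie_act_linearr. Qed.
Lemma act_linl w : linear (beta^~ w). Proof. exact: lie_act_linearl. Qed.
Lemma act_br x y w : beta (lie x y) w = beta x (beta y w) - beta y (beta x w).
Proof. exact: lie_act_bracket. Qed.
End RepLemmas.

Section CochainModule.
Variables (C : numClosedFieldType) (V : vectType C) (W : lmodType C).
Local Notation s := (sl C 2).
Variables (rho : lieModule s V) (beta : lieModule s W).

Definition lieder (X : s) k : cur V W k -> cur V W k := der (rho X) (beta X).

Lemma lieder_lin X k : linear (@lieder X k).
Proof. exact/der_lin/act_linr. Qed.

Lemma lieder_altm X k (f : cur V W k) : altm f -> altm (lieder X f).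
Proof. by apply: der_altm; apply: act_linr. Qed.

Lemma lieder_comb c X Y k (f : cur V W k) : altm f ->
  lieder (c *: X + Y) f = c *: lieder X f + lieder Y f.
Proof.
by move=> cf; rewrite -der_comb //; apply: eq_der => z; apply: act_linl.
Qed.

Lemma liederZ c X k (f : cur V W k) : altm f -> lieder (c *: X) f = c *: lieder X f.
Proof.
move=> cf; rewrite -[c *: X]addr0 lieder_comb //.
suff -> : lieder 0 f = 0 by rewrite addr0.
by have := lieder_comb (-1) 0 0 cf; rewrite scaler0 addr0 scaleN1r addNr.
Qed.

Lemma lieder_br X Y k (f : cur V W k) : altm f ->
  lieder (lie X Y) f = lieder X (lieder Y f) - lieder Y (lieder X f).
Proof.
move=> cf; rewrite der_comm //; try exact: act_linr.
by apply: eq_der => z; apply: act_br.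
Qed.

Lemma altm_submodule k : submodule (@altm _ V W k).
Proof. by split; [exact: altm0 | move=> c u v; exact: altm_comb]. Qed.

Lemma altm_sl2mod k :
  sl2mod (@altm _ V W k) (@lieder (slE C) k) (@lieder (slH C) k) (@lieder (slF C) k).
Proof.
split; try (by move=> *; apply: lieder_altm); try exact: lieder_lin.
- exact: altm_submodule.
- move=> f cf; rewrite -lieder_br //; congr (lieder _ f).
  by apply: slP; rewrite !sl_lieE !slmkE; ring.
- move=> f cf; rewrite -lieder_br // -liederZ //; congr (lieder _ f).
  by apply: slP; rewrite !sl_lieE !slZE !slmkE; ring.
- move=> f cf; rewrite -lieder_br // -scaleNr -liederZ //; congr (lieder _ f).
  by apply: slP; rewrite !sl_lieE !slZE !slmkE; ring.
Qed.

Lemma altm_basis0 k (f : cur V W k.+1) : altm f ->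
  (forall i, f (tnth (vbasis fullv) i) = 0) -> f = 0.
Proof.
move=> cf f0; apply/funext => v; rewrite (coord_vbasis (memvf v)).
rewrite (lin_sum (altm_lin cf)) big1 // => i _.
by rewrite (linZ (altm_lin cf)) -tnth_nth f0 scaler0.
Qed.

Lemma altm_findim k :
  (exists N (j : W -> 'rV[C]_N), linear j /\ injective j) -> findim (@altm _ V W k).
Proof.
case=> N [j [lj inj_j]]; elim: k => [|k [M [jk [ljk inj_jk]]]].
  by exists N, j; split=> // w _ jw; apply: inj_j; rewrite jw (lin0 lj).
exists (\dim {:V} * M)%N,
  (fun f => mxvec (\matrix_i jk (f (tnth (vbasis fullv) i)))); split.
  move=> c f g; rewrite -linearP; congr mxvec; apply/matrixP => a b.
  by rewrite !mxE [(_ + _) _]curD curZ ljk !mxE.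
move=> f cf /(congr1 vec_mx); rewrite mxvecK linear0 => fb.
apply: altm_basis0 => // i; apply: inj_jk; first exact: altm_app.
by rewrite -[LHS](rowK (fun i => jk (f (tnth (vbasis fullv) i)))) fb row0.
Qed.

End CochainModule.

(** * Components of cochains on the semidirect product *)

Section SemidirectComponents.
Variables (C : numClosedFieldType) (V : vectType C) (rho : lieModule (sl C 2) V).
Local Notation s := (sl C 2).
Local Notation g := (semidirect rho).
Local Notation H := (slH C).
Local Notation E := (slE C).
Local Notation F := (slF C).

(** The Levi factor and the abelian ideal. *)
Definition inS (X : s) : g := (X, 0).
Definition inV (v : V) : g := (0, v).

Lemma gE (x : g) : x = inS x.1 + inV x.2.
Proof.
case: x => X v; rewrite [RHS](_ : _ = (X + 0, 0 + v)) // addr0 add0r.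
by [].
Qed.

Lemma inS_lin : linear inS.
Proof. by move=> c X Y; rewrite [RHS](_ : _ = (c *: X + Y, c *: 0 + 0)) // scaler0 addr0. Qed.

Lemma inV_lin : linear inV.
Proof. by move=> c u v; rewrite [RHS](_ : _ = (c *: 0 + 0, c *: u + v)) // scaler0 addr0. Qed.

Lemma rho0 v : rho 0 v = 0. Proof. exact: (lin0 (act_linl rho v)). Qed.
Lemma rhor0 X : rho X 0 = 0. Proof. exact: (lin0 (act_linr rho X)). Qed.

Lemma lie_SS X Y : lie (inS X) (inS Y) = inS (lie X Y).
Proof. by congr pair; rewrite /= !rhor0 subrr. Qed.

Lemma lie_lin_l (y : g) : linear (lie^~ y). Proof. exact: lie_linearl. Qed.
Lemma lie_lin_r (x : g) : linear (lie x). Proof. exact: lie_linearr. Qed.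

Lemma slie0r (Y : s) : lie Y 0 = 0. Proof. exact: (lin0 (@lie_linearr _ _ Y)). Qed.

Lemma lie_SV X v : lie (inS X) (inV v) = inV (rho X v).
Proof. by congr pair; rewrite /= ?slie0r // rho0 subr0. Qed.

Lemma lie_VV u v : lie (inV u) (inV v) = inV 0.
Proof. by congr pair; rewrite /= ?slie0r // !rho0 subrr. Qed.

Definition adS : lieModule s g.
Proof.
apply: (@LieModule _ _ _ (fun X => lie (inS X))).
- by move=> x c X Y; rewrite inS_lin lie_lin_l.
- by move=> X; apply: lie_lin_r.
- by move=> X Y x; rewrite -lie_SS adjoint_bracket.
Defined.

Local Notation d := (dif (@lie _ g) (adjoint g)).
Local Notation dV := (dif (fun _ _ : V => 0 : V) (fun v (x : g) => lie (inV v) x)).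
Local Notation th x := (der (@lie _ g x) (adjoint g x)).
Local Notation thV X := (@lieder _ _ _ rho adS X _).
Local Notation G k := (cur g g k).
Local Notation U k := (cur V g k).

Lemma gbr_jacobi (x y z : g) : lie x (lie y z) = lie (lie x y) z + lie y (lie x z).
Proof. by rewrite adjoint_bracket subrK. Qed.

Lemma d_lin k : linear (@dif _ _ _ (@lie _ g) (adjoint g) k).
Proof. by apply: dif_lin => x; apply: lie_lin_r. Qed.

Lemma d_altm k (f : G k) : altm f -> altm (d f).
Proof.
by apply: dif_altm; [exact: lie_lin_l | exact: lie_lin_r | exact: liexx
  | exact: lie_lin_l | exact: lie_lin_r].
Qed.

Lemma d_d k (f : G k) : altm f -> d (d f) = 0.
Proof.
exact: (dif_dif lie_lin_r lie_lin_r gbr_jacobi gbr_jacobi).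
Qed.

Lemma dV_lin k : linear (@dif _ V g (fun _ _ : V => 0 : V) (fun v (x : g) => lie (inV v) x) k).
Proof. by apply: dif_lin => v; apply: lie_lin_r. Qed.

Lemma dV_altm k (f : U k) : altm f -> altm (dV f).
Proof.
apply: dif_altm => //; try (by move=> *; exact: linear_zero).
- by move=> w c u v; rewrite inV_lin lie_lin_l.
- by move=> v; apply: lie_lin_r.
Qed.

Lemma dV_thV X k (f : U k) : altm f -> thV X (dV f) = dV (thV X f).
Proof.
move=> cf; apply: der_dif => //; try (by move=> *; exact: linear_zero).
- by move=> v; apply: lie_lin_r.
- exact: act_linr.
- exact: lie_lin_r.
- by move=> u v; rewrite rhor0 addr0.
- by move=> v w /=; rewrite gbr_jacobi lie_SV.
Qed.

Lemma th_altm x k (f : G k) : altm f -> altm (th x f).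
Proof. by apply: der_altm; apply: lie_lin_r. Qed.

Lemma th_lin x k : linear (@der _ g g (lie x) (adjoint g x) k).
Proof. by apply: der_lin; apply: lie_lin_r. Qed.

Fixpoint res k : G k -> U k :=
  match k with
  | 0 => fun m => m
  | k'.+1 => fun f v => @res k' (f (inV v))
  end.

Fixpoint ext k : U k -> G k :=
  match k with
  | 0 => fun m => m
  | k'.+1 => fun f x => @ext k' (f x.2)
  end.

Lemma res_lin k : linear (@res k).
Proof. by elim: k => [|k IHk] c f h //; apply/funext => v; rewrite curE curZ -IHk. Qed.

Lemma ext_lin k : linear (@ext k).
Proof. by elim: k => [|k IHk] c f h //; apply/funext => v; rewrite curE curZ -IHk. Qed.

Lemma res_altm k (f : G k) : altm f -> altm (res f).
Proof.
elim: k f => // k IHk f cf; split.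
- by move=> c u v; rewrite /= inV_lin (altm_lin cf) res_lin.
- by move=> v; apply/IHk/altm_app.
- by case: k {IHk} f cf => // k f cf v; rewrite /= (altm_diag _ cf) (lin0 (@res_lin _)).
Qed.

Lemma ext_altm k (m : U k) : altm m -> altm (ext m).
Proof.
elim: k m => // k IHk m cm; split.
- by move=> c u v; rewrite /= (altm_lin cm) ext_lin.
- by move=> v; apply/IHk/altm_app.
- by case: k {IHk} m cm => // k m cm v; rewrite /= (altm_diag _ cm) (lin0 (@ext_lin _)).
Qed.

Lemma res_ext k (m : U k) : res (ext m) = m.
Proof. by elim: k m => // k IHk m; apply/funext => v /=; rewrite IHk. Qed.

Lemma res_der a a' b k (f : G k) : (forall v, a (inV v) = inV (a' v)) ->
  res (der a b f) = der a' b (res f).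
Proof.
move=> aa'; elim: k f => // k IHk f; apply/funext => v.
by rewrite derS -IHk /= (linB (@res_lin k)) aa'.
Qed.

Lemma res_thS X k (f : G k) : res (th (inS X) f) = thV X (res f).
Proof. exact/res_der/lie_SV. Qed.

Lemma res_d k (f : G k) : altm f -> res (d f) = dV (res f).
Proof.
elim: k f => // k IHk f cf; apply/funext => v.
rewrite difS -IHk; last exact: altm_app.
rewrite -(@res_der (lie (inV v)) (fun _ => 0)) => [|u]; last exact: lie_VV.
by rewrite -(linB (@res_lin _)) -difS.
Qed.

(** Horizontal cochains: these come from alternating maps on V, to which they restrict
faithfully. *)
Definition hor k : G k -> Prop :=
  match k with
  | 0 => fun _ => True
  | k'.+1 => fun f => forall X, f (inS X) = 0
  end.

Lemma hor_res0 k (f : G k) : altm f -> hor f -> res f = 0 -> f = 0.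
Proof.
elim: k f => // k IHk f cf hf rf; apply/funext => x.
rewrite (gE x) (linD (altm_lin cf)) hf add0r; apply: IHk (altm_app _ cf) _ _.
  case: k {rf} f cf hf => // k f cf hf X.
  by rewrite (altm_anti _ _ cf) hf cur0 oppr0.
by have := congr1 (fun h => h x.2) rf.
Qed.

Lemma hor_ext k (m : U k) : altm m -> hor (ext m).
Proof.
case: k m => // k m cm X /=.
by rewrite (lin0 (altm_lin cm)) (lin0 (@ext_lin _)).
Qed.

Lemma horD c k (f h : G k) : hor f -> hor h -> hor (c *: f + h).
Proof. by case: k f h => // k f h hf hh X; rewrite !curE hf hh scaler0 addr0. Qed.

Lemma hor0 k : hor (0 : G k). Proof. by case: k. Qed.

Lemma horB k (f h : G k) : hor f -> hor h -> hor (f - h).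
Proof. by move=> hf hh; rewrite addrC -scaleN1r; apply: horD. Qed.

Lemma hor_thS X k (f : G k) : hor f -> hor (th (inS X) f).
Proof.
case: k f => // k f hf Y; rewrite derS hf lie_SS hf (lin0 (@th_lin _ k)) subr0.
by [].
Qed.

(** By Cartan's formula. *)
Lemma d_hor k (f : G k) Z : hor f -> d f (inS Z) = th (inS Z) f.
Proof.
by case: k f => // k f hf; rewrite difS hf (lin0 (@d_lin _)) subr0.
Qed.

Lemma d_hor2 k (f : G k.+1) X Y : (forall X, hor (f (inS X))) ->
  d f (inS X) (inS Y) = th (inS X) (f (inS Y)) - th (inS Y) (f (inS X))
    - f (inS (lie X Y)).
Proof. by move=> hf; rewrite difS curD curN derS (d_hor _ (hf X)) lie_SS; lmod (G k). Qed.

Lemma d_hor3 k (f : G k.+2) X Y Z : (forall X Y, hor (f (inS X) (inS Y))) ->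
  d f (inS X) (inS Y) (inS Z) =
    th (inS X) (f (inS Y) (inS Z)) - th (inS Y) (f (inS X) (inS Z))
    + th (inS Z) (f (inS X) (inS Y)) - f (inS (lie X Y)) (inS Z)
    + f (inS X) (inS (lie Y Z)) - f (inS Y) (inS (lie X Z)).
Proof.
move=> hf; rewrite difS !(curD, curN) !derS !(curD, curN) !derS lie_SS.
rewrite (_ : d (f (inS X) : G k.+1) (inS Y) (inS Z) = th (inS Y) (f (inS X) (inS Z))
   - th (inS Z) (f (inS X) (inS Y)) - f (inS X) (inS (lie Y Z))).
  by rewrite !lie_SS; lmod (G k).
by apply: d_hor2; apply: hf.
Qed.

(** Alternating maps on a three-dimensional space are determined by their
values on the ordered pairs, resp. the triple, of basis vectors. *)
Lemma altm_S0 k (f : G k.+1) : altm f -> f (inS E) = 0 -> f (inS H) = 0 -> f (inS F) = 0 ->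
  forall X, f (inS X) = 0.
Proof.
move=> cf fE fH fF X; rewrite -(sl_decomp X).
rewrite !(linD inS_lin, linZ inS_lin) !(linD (altm_lin cf), linZ (altm_lin cf)).
by rewrite fE fH fF !scaler0 !addr0.
Qed.

Lemma altm_SS0 k (f : G k.+2) : altm f -> f (inS E) (inS H) = 0 ->
  f (inS E) (inS F) = 0 -> f (inS H) (inS F) = 0 ->
  forall X Y, f (inS X) (inS Y) = 0.
Proof.
move=> cf EH EF HF.
have swap X Y : f (inS X) (inS Y) = 0 -> f (inS Y) (inS X) = 0.
  by rewrite (altm_anti _ _ cf) => /eqP; rewrite oppr_eq0 => /eqP.
move=> X; apply: (altm_S0 (altm_app _ cf)); apply/swap;
  by apply: (altm_S0 (altm_app _ cf)); rewrite ?(altm_diag _ cf) //; apply/swap.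
Qed.

Lemma altm_SSS0 k (f : G k.+3) : altm f -> f (inS E) (inS H) (inS F) = 0 ->
  forall X Y Z, f (inS X) (inS Y) (inS Z) = 0.
Proof.
move=> cf EHF.
have swap X Y Z : f (inS X) (inS Y) (inS Z) = 0 -> f (inS Y) (inS X) (inS Z) = 0.
  by rewrite (altm_anti _ _ cf) curN => /eqP; rewrite oppr_eq0 => /eqP.
have eqf X Y : f (inS X) (inS X) (inS Y) = 0 by rewrite (altm_diag _ cf) cur0.
have fE X Y : f (inS E) (inS X) (inS Y) = 0.
  by apply: (altm_SS0 (altm_app _ cf)) => //; rewrite ?eqf.
have fH X Y : f (inS H) (inS X) (inS Y) = 0.
  by apply: (altm_SS0 (altm_app _ cf)) => //; rewrite ?eqf //; apply/swap.
have fF X Y : f (inS F) (inS X) (inS Y) = 0.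
  by apply: (altm_SS0 (altm_app _ cf)) => //; rewrite ?eqf //; apply/swap.
move=> X Y Z; rewrite -(sl_decomp X).
rewrite !(linD inS_lin, linZ inS_lin) !(linD (altm_lin cf), linZ (altm_lin cf)).
by rewrite !curE fE fH fF !scaler0 !addr0.
Qed.

(** Exterior multiplication by a linear form, defined through its antiderivation rule
for contractions. *)
Fixpoint wedge (a : g -> C) k : G k -> G k.+1 :=
  match k with
  | 0 => fun m x => a x *: m
  | k'.+1 => fun f x => a x *: (f : G k'.+1) - @wedge a k' (f x)
  end.

Lemma wedge_lin a k : linear (@wedge a k).
Proof.
elim: k => [|k IHk] c f h; apply/funext => x; first by rewrite !curE /=; lmod (g : lmodType C).
by rewrite !curE /= !curE IHk; lmod (G k.+1).
Qed.

Lemma wedge_altm a k (f : G k) : linear (a : g -> C^o) -> altm f -> altm (wedge a f).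
Proof.
move=> la; elim: k f => [|k IHk] f cf; split => //.
- by move=> c u v /=; rewrite la [_ *: a u]/GRing.scale /=; lmod (g : lmodType C).
- by move=> c u v /=; rewrite la (altm_lin cf) wedge_lin [c *: a u]/GRing.scale /=; lmod (G k.+1).
- by move=> x; apply: altmB; [exact: altmZ | exact/IHk/altm_app].
- move=> x; rewrite [LHS](_ : _ = a x *: f x - wedge a (f x) x) //.
  case: k IHk f cf => [|k] IHk f cf /=; first exact: subrr.
  by rewrite (altm_diag _ cf) (lin0 (@wedge_lin a k)) subr0 subrr.
Qed.

Lemma wedge_hor a k (f : G k) X : hor f -> wedge a f (inS X) = a (inS X) *: f.
Proof. by case: k f => // k f hf /=; rewrite hf (lin0 (@wedge_lin a k)) subr0. Qed.

Lemma res_wedge a k (f : G k) : (forall v, a (inV v) = 0) -> res (wedge a f) = 0.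
Proof.
move=> aV; elim: k f => [|k IHk] f; apply/funext => v; first by rewrite /= aV scale0r.
rewrite [LHS](_ : _ = res (a (inV v) *: (f : G k.+1) - wedge a (f (inV v)))) //.
by rewrite aV scale0r sub0r (linN (@res_lin k.+1)) IHk oppr0.
Qed.

End SemidirectComponents.

(** * Cocycles up to coboundaries *)

Section Levels.
Variables (C : numClosedFieldType) (V : vectType C) (rho : lieModule (sl C 2) V).
Local Notation s := (sl C 2).
Local Notation g := (semidirect rho).
Local Notation H := (slH C).
Local Notation E := (slE C).
Local Notation F := (slF C).
Local Notation d := (dif (@lie _ g) (adjoint g)).
Local Notation dV := (dif (fun _ _ : V => 0 : V) (fun v (x : g) => lie (inV rho v) x)).
Local Notation th x := (der (@lie _ g x) (adjoint g x)).
Local Notation adS := (adS rho).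
Local Notation inS := (inS rho).
Local Notation inV := (inV rho).
Local Notation thV X := (@lieder _ _ _ rho adS X _).
Local Notation G k := (cur g g k).
Local Notation U k := (cur V g k).
Lemma g_coordinates : exists N (j : g -> 'rV[C]_N), linear j /\ injective j.
Proof.
exists (2 * 2 + \dim {:V})%N, (fun x : g =>
  row_mx (mxvec (sl_val x.1)) (\row_i coord (vbasis fullv) i x.2)); split.
  move=> c x y; rewrite scale_row_mx add_row_mx; congr row_mx.
    by rewrite -linearP.
  by apply/rowP => i; rewrite !mxE -linearP.
move=> [X u] [Y v] /= /eq_row_mx[/(can_inj mxvecK) XY uv].
congr pair; first exact: val_inj.
rewrite (coord_vbasis (memvf u)) (coord_vbasis (memvf v)); apply: eq_bigr => i _.
by have := congr1 (fun z : 'rV_(\dim {:V}) => z 0 i) uv; rewrite !mxE => ->.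
Qed.

Lemma findimU k : findim (@altm _ V g k).
Proof. exact: altm_findim g_coordinates. Qed.

Definition sl2U k := altm_sl2mod rho adS k.

Definition slinv k (m : U k) := altm m /\ forall X, thV X m = 0.

Lemma slinvP k (m : U k) : altm m -> thV E m = 0 -> thV H m = 0 -> thV F m = 0 ->
  slinv m.
Proof.
move=> cm mE mH mF; split=> // X; rewrite -(sl_decomp X).
by rewrite -!addrA !lieder_comb ?mE ?mH ?mF ?scaler0 ?add0r // liederZ // mF scaler0.
Qed.

(** The complement of the invariants. *)
Definition noninv k (m : U k) := exists a b c : U k,
  [/\ altm a, altm b, altm c & m = thV E a + thV H b + thV F c].

Lemma noninv_comb k c (m m' : U k) : noninv m -> noninv m' -> noninv (c *: m + m').
Proof.
move=> [x [y [z [cx cy cz ->]]]] [x' [y' [z' [cx' cy' cz' ->]]]].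
exists (c *: x + x'), (c *: y + y'), (c *: z + z'); split; try exact: altm_comb.
by rewrite !lieder_lin; lmod (U k).
Qed.

Lemma inv_split k : exists p : {poly C}, forall u : U k, altm u ->
  let O := casimir (@lieder _ _ _ rho adS E k) (@lieder _ _ _ rho adS H k)
    (@lieder _ _ _ rho adS F k) in
  [/\ slinv (pact O p u), noninv (u - pact O p u),
      noninv u -> pact O p u = 0 & slinv u -> pact O p u = u].
Proof.
have [p [r pr]] := casimir_split (sl2U k) (@findimU k).
exists p => u cu O; have [uE e0 h0 f0] := pr u cu.
have cp := invproj_U (sl2U k) p cu.
have P0 m : noninv m -> pact O p m = 0.
  case=> [x [y [z [cx cy cz ->]]]].
  have lP := pact_lin (casimir_lin (sl2U k)) p.
  rewrite !(linD lP) (invproj_e (sl2U k) pr) // (invproj_h (sl2U k) pr) //.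
  by rewrite (invproj_f (sl2U k) pr) // !addr0.
split=> //.
- exact: slinvP.
- apply: (noninv_sum (sl2U k) pr (altmB cu cp)).
  rewrite (linB (pact_lin (casimir_lin (sl2U k)) p)).
  by rewrite (invproj_id (sl2U k) pr cp) // subrr.
- exact: P0.
- by case=> _ u0; exact: (invproj_id (sl2U k) pr cu (u0 E) (u0 H) (u0 F)).
Qed.

Lemma inv_noninv0 k (m : U k) : slinv m -> noninv m -> m = 0.
Proof.
move=> im nm; have [p pr] := inv_split k.
by have [_ _ /(_ nm) <- /(_ im) ->] := pr m im.1.
Qed.

Definition dV_inv0 k := forall m : U k, slinv m -> dV m = 0.

(** d_V is equivariant, hence respects both parts of the decomposition. *)
Lemma noninv_dV k (m : U k) : dV_inv0 k -> altm m -> noninv (dV m).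
Proof.
move=> d0 cm; have [p pr] := inv_split k.
have [im [x [y [z [cx cy cz mE]]]] _ _] := pr m cm.
exists (dV x), (dV y), (dV z); split; try exact: dV_altm.
rewrite !dV_thV // -!(linD (@dV_lin _ _ rho k)) -mE (linB (@dV_lin _ _ rho k)) (d0 _ im).
by rewrite subr0.
Qed.

(** ** Coboundaries removing the sl2-components *)

Definition aE (x : g) := cE x.1.
Definition aH (x : g) := cH x.1.
Definition aF (x : g) := cF x.1.
Lemma aE_lin : linear (aE : g -> C^o). Proof. by move=> c x y; apply: cE_lin. Qed.
Lemma aH_lin : linear (aH : g -> C^o). Proof. by move=> c x y; apply: cH_lin. Qed.
Lemma aF_lin : linear (aF : g -> C^o). Proof. by move=> c x y; apply: cF_lin. Qed.

Lemma aS a b c : (aE (inS (slmk a b c)) = a) * (aH (inS (slmk a b c)) = b) *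
  (aF (inS (slmk a b c)) = c).
Proof. by rewrite /aE /aH /aF !slmkE. Qed.

Lemma aV v : (aE (inV v) = 0) * (aH (inV v) = 0) * (aF (inV v) = 0).
Proof. by rewrite /aE /aH /aF /cE /cH /cF /= !mxE. Qed.

Lemma wedge2_S a b k (f : G k) X Y : hor f ->
  wedge a (wedge b f) (inS X) (inS Y) =
  (a (inS X) * b (inS Y) - a (inS Y) * b (inS X)) *: f.
Proof.
move=> hf; rewrite [LHS](_ : _ = a (inS X) *: wedge b f (inS Y)
   - wedge a (wedge b f (inS X)) (inS Y)) //.
by rewrite !(wedge_hor b _ hf) (linZ (@wedge_lin _ _ rho a k)) curZ wedge_hor //; lmod (G k).
Qed.

Lemma wedge3_EHF k (f : G k) : hor f ->
  wedge aE (wedge aH (wedge aF f)) (inS E) (inS H) (inS F) = f.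
Proof.
move=> hf; set w := wedge aH (wedge aF f).
rewrite [LHS](_ : _ = aE (inS E) *: w (inS H) (inS F) -
  (aE (inS H) *: w (inS E) (inS F) - wedge aE (w (inS E) (inS H)) (inS F))) //.
rewrite /w !wedge2_S // (linZ (@wedge_lin _ _ rho aE k)) curZ wedge_hor // !aS.
by lmod (G k).
Qed.

Lemma wedge2_altm a b k (m : U k) : linear (a : g -> C^o) -> linear (b : g -> C^o) ->
  altm m -> altm (wedge a (wedge b (ext m))).
Proof. by move=> la lb cm; do 2!apply: wedge_altm => //; apply: ext_altm. Qed.

Lemma horZ c k (f : G k) : hor f -> hor (c *: f).
Proof. by move=> hf; rewrite -[_ *: _]addr0; apply: horD (hor0 _ _). Qed.

Lemma hor_add k (f h : G k) : hor f -> hor h -> hor (f + h).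
Proof. by rewrite -[f in f + h]scale1r; apply: horD. Qed.

Lemma altm_SSSS0 k (f : G k.+4) X Y Z : altm f -> f (inS E) (inS X) (inS Y) (inS Z) = 0.
Proof.
move=> cf; apply: (altm_SSS0 (altm_app _ cf)).
by rewrite (altm_diag _ cf).
Qed.

(** The components of h on pairs of basis vectors of sl2 are chosen so that the
differential of sl2 produces the given noninvariant value on the triple. *)
Lemma level3 k (f : G k.+3) : altm f -> noninv (res (f (inS E) (inS H) (inS F))) ->
  exists2 h : G k.+2, altm h &
    forall X Y, @hor _ _ rho k.+1 ((f - d h) (inS X) (inS Y)).
Proof.
move=> cf [x [y [z [cx cy cz fE]]]].
have cyN := altmN cy.
pose h : G k.+2 := wedge aE (wedge aH (ext z)) + wedge aE (wedge aF (ext (- y)))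
  + wedge aH (wedge aF (ext x)).
have ch : altm h.
  by apply: altmD; [apply: altmD|]; apply: wedge2_altm => //;
    first [exact: aE_lin | exact: aH_lin | exact: aF_lin].
have hE X Y : h (inS X) (inS Y) =
    (aE (inS X) * aH (inS Y) - aE (inS Y) * aH (inS X)) *: ext z
  + (aE (inS X) * aF (inS Y) - aE (inS Y) * aF (inS X)) *: ext (- y)
  + (aH (inS X) * aF (inS Y) - aH (inS Y) * aF (inS X)) *: ext x.
  rewrite [LHS](_ : _ = wedge aE (wedge aH (ext z)) (inS X) (inS Y)
   + wedge aE (wedge aF (ext (- y))) (inS X) (inS Y)
   + wedge aH (wedge aF (ext x)) (inS X) (inS Y)) //.
  by rewrite !wedge2_S //; apply: hor_ext.
have hh X Y : hor (h (inS X) (inS Y)).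
  by rewrite hE; do ![apply: hor_add]; apply: horZ; apply: hor_ext.
have cfh : altm (f - d h) by apply: altmB => //; apply: d_altm.
exists h => //.
suff q0 : (f - d h) (inS E) (inS H) (inS F) = 0.
  by move=> X Y Z; apply: (altm_SSS0 cfh).
apply: hor_res0; [by do 3!apply: altm_app| |].
  move: (f - d h) cfh => q; clear.
  by case: k q => // k q cq X; apply: altm_SSSS0.
rewrite !(curD, curN) (linB (@res_lin _ _ _ k)) d_hor3 //.
rewrite (_ : lie E H = - 2 *: E); last by apply: slP; rewrite !sl_lieE !slZE !slmkE; ring.
rewrite (_ : lie H F = - 2 *: F); last by apply: slP; rewrite !sl_lieE !slZE !slmkE; ring.
rewrite (_ : lie E F = H); last by apply: slP; rewrite !sl_lieE !slmkE; ring.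
rewrite !(linZ (inS_lin _)) (linZ (altm_lin ch)) (linZ (altm_lin (altm_app _ ch))) curZ.
rewrite (altm_diag _ ch) fE !hE !aS !(mul0r, mulr0, mul1r, mulr1, subr0, sub0r).
have lr := @res_lin _ _ rho k; have le := @ext_lin _ _ rho k.
rewrite !scale0r !scale1r !(addr0, add0r) (linN le).
rewrite !(linD lr, linN lr, linZ lr) !res_thS !(linN lr) !res_ext.
by rewrite (linN (@lieder_lin _ _ _ _ _ _ _)); lmod (U k).
Qed.

Lemma slbr : [/\ lie E F = H, lie H E = 2 *: E, lie E H = - (2 *: E)
  & lie H F = - (2 *: F)].
Proof.
by split; apply: slP; rewrite -?scaleNr !sl_lieE ?slZE !slmkE; ring.
Qed.

Lemma hor_d2 k (f : G k.+1) : (forall X, hor (f (inS X))) ->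
  forall X Y, @hor _ _ rho k (d f (inS X) (inS Y)).
Proof.
by move=> hf X Y; rewrite d_hor2 //; do ![apply: horB]; rewrite ?hf //; apply: hor_thS.
Qed.

(** With no component on three arguments in sl2, the components on two of them form
a 2-cocycle of sl2 with values in the alternating maps on V. *)
Lemma level2 k (f : G k.+2) : altm f -> d f = 0 ->
  (forall X Y, hor (f (inS X) (inS Y))) ->
  exists2 h : G k.+1, altm h & forall X, @hor _ _ rho k.+1 ((f - d h) (inS X)).
Proof.
move=> cf df hf; have [brEF brHE brEH brHF] := slbr.
have cres X Y : altm (res (f (inS X) (inS Y))) by apply: res_altm; do 2!apply: altm_app.
have coc : thV E (res (f (inS H) (inS F))) - thV H (res (f (inS E) (inS F)))
    + thV F (res (f (inS E) (inS H))) = 0.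
  have df3 : d f (inS E) (inS H) (inS F) = 0 by rewrite df.
  have := d_hor3 E H F hf; rewrite df3 brEH brEF brHF.
  rewrite !(linN (inS_lin _), linZ (inS_lin _)) (linN (altm_lin cf)) (linZ (altm_lin cf)).
  rewrite (linN (altm_lin (altm_app _ cf))) (linZ (altm_lin (altm_app _ cf))).
  rewrite !(curN, curZ) (altm_diag _ cf) => eq0.
  have lr := @res_lin _ _ rho k; rewrite -!res_thS -(linB lr) -(linD lr).
  rewrite -[RHS](lin0 lr) [in RHS]eq0; congr (res _).
  by lmod (G k).
have [p [r pr]] := casimir_split (sl2U k) (findimU k).
have [ge [gh [gf [[ce ch cf'] [EE EH HF]]]]] :=
  whitehead2 (sl2U k) pr (cres E F) (cres E H) (cres H F) coc.
pose h : G k.+1 := wedge aE (ext ge) + wedge aH (ext gh) + wedge aF (ext gf).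
have c_h : altm h.
  by apply: altmD; [apply: altmD|]; apply: wedge_altm; try exact: ext_altm;
    first [exact: aE_lin | exact: aH_lin | exact: aF_lin].
have hE X : h (inS X) = aE (inS X) *: ext ge + aH (inS X) *: ext gh + aF (inS X) *: ext gf.
  rewrite [LHS](_ : _ = wedge aE (ext ge) (inS X) + wedge aH (ext gh) (inS X)
    + wedge aF (ext gf) (inS X)) //.
  by rewrite !wedge_hor //; apply: hor_ext.
have hh X : hor (h (inS X)).
  by rewrite hE; do ![apply: hor_add]; apply: horZ; apply: hor_ext.
have cfh : altm (f - d h) by apply: altmB => //; apply: d_altm.
exists h => //.
have hsub X Y : @hor _ _ rho k ((f - d h) (inS X) (inS Y)).
  by apply: horB => //; apply: hor_d2.
have zero X Y : res (f (inS X) (inS Y)) = res (d h (inS X) (inS Y)) ->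
    (f - d h) (inS X) (inS Y) = 0.
  move=> eqr; apply: hor_res0; [by do 2!apply: altm_app | exact: hsub |].
  by rewrite !(curD, curN) (linB (@res_lin _ _ rho k)) eqr subrr.
have lr := @res_lin _ _ rho k.
suff : forall X Y, (f - d h) (inS X) (inS Y) = 0 by [].
apply: (altm_SS0 cfh); apply: zero; rewrite d_hor2 // ?brEH ?brEF ?brHF;
  rewrite ?(linN (inS_lin _)) ?(linZ (inS_lin _)) ?(linN (altm_lin c_h)) ?(linZ (altm_lin c_h));
  rewrite ?(linB lr, linN lr, linZ lr) !res_thS !hE !aS !scale0r !scale1r !(addr0, add0r);
  rewrite !res_ext.
- by rewrite EH; lmod (U k).
- by rewrite EE; lmod (U k).
- by rewrite HF; lmod (U k).
Qed.

(** Now the components on one argument in sl2 form a 1-cocycle of sl2. *)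
Lemma level1 k (f : G k.+1) : altm f -> d f = 0 -> (forall X, hor (f (inS X))) ->
  exists2 h : G k, altm h & @hor _ _ rho k.+1 (f - d h).
Proof.
move=> cf df hf; have [brEF brHE brEH brHF] := slbr.
have cres X : altm (res (f (inS X))) by apply: res_altm; apply: altm_app.
have lr := @res_lin _ _ rho k.
have coc X Y : thV X (res (f (inS Y))) - thV Y (res (f (inS X))) = res (f (inS (lie X Y))).
  have df2 : d f (inS X) (inS Y) = 0 by rewrite df.
  have := d_hor2 X Y hf; rewrite df2 -!res_thS -(linB lr) => eq0.
  by congr (res _); rewrite -[RHS]add0r [in RHS]eq0; lmod (G k).
have [p [r pr]] := casimir_split (sl2U k) (findimU k).
have E1 : thV H (res (f (inS E))) - thV E (res (f (inS H))) = 2 *: res (f (inS E)).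
  by rewrite coc brHE (linZ (inS_lin _)) (linZ (altm_lin cf)) (linZ lr).
have E2 : thV H (res (f (inS F))) - thV F (res (f (inS H))) = - (2 *: res (f (inS F))).
  by rewrite coc brHF (linN (inS_lin _)) (linZ (inS_lin _)) (linN (altm_lin cf))
    (linZ (altm_lin cf)) (linN lr) (linZ lr).
have E3 : thV E (res (f (inS F))) - thV F (res (f (inS E))) = res (f (inS H)).
  by rewrite coc brEF.
have [m [cm mE mH mF]] := whitehead1 (sl2U k) pr (cres E) (cres H) (cres F) E1 E2 E3.
have ce := ext_altm cm; have cfh : altm (f - d (ext m)) by apply: altmB => //; apply: d_altm.
exists (ext m) => //.
have zero X : res (f (inS X)) = thV X m -> (f - d (ext m)) (inS X) = 0.
  move=> eqr; rewrite !(curD, curN) d_hor; last exact: hor_ext.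
  apply: hor_res0.
  - by apply: altmB; [exact: altm_app | exact: th_altm].
  - by apply: horB => //; apply/hor_thS/hor_ext.
  - by rewrite (linB lr) res_thS res_ext eqr subrr.
by apply: (altm_S0 cfh); apply: zero.
Qed.

(** ** Exactness *)

Lemma noninv_res k (f : G k.+1) (h : G k) : dV_inv0 k -> altm h ->
  noninv (res f) -> noninv (res (f - d h)).
Proof.
move=> d0 ch nf; rewrite (linB (@res_lin _ _ rho k.+1)) res_d //.
rewrite addrC -scaleN1r; apply: noninv_comb nf.
by apply: noninv_dV => //; apply: res_altm.
Qed.

Lemma d_sub0 k (f : G k.+1) (h : G k) : altm h -> d f = 0 -> d (f - d h) = 0.
Proof. by move=> ch df; rewrite (linB (@d_lin _ _ rho k.+1)) df d_d // subr0. Qed.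

(** The restriction of a horizontal cocycle is invariant. *)
Lemma exact0 k (f : G k) : altm f -> d f = 0 -> hor f -> noninv (res f) -> f = 0.
Proof.
move=> cf df hf nf; apply: hor_res0 => //; apply: inv_noninv0 => //.
split=> [|X]; first exact: res_altm.
by rewrite -res_thS -d_hor // df cur0 (lin0 (@res_lin _ _ rho k)).
Qed.

Lemma exact1 k (f : G k.+1) : dV_inv0 k -> altm f -> d f = 0 ->
  (forall X, hor (f (inS X))) -> noninv (res f) -> exists2 h : G k, altm h & f = d h.
Proof.
move=> d0 cf df hf nf; have [h ch hh] := level1 cf df hf.
exists h => //; apply/eqP; rewrite -subr_eq0; apply/eqP/exact0 => //.
- by apply: altmB => //; apply: d_altm.
- exact: d_sub0.
- exact: noninv_res.
Qed.

Lemma exact2 k (f : G k.+2) : dV_inv0 k.+1 -> altm f -> d f = 0 ->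
  (forall X Y, hor (f (inS X) (inS Y))) -> noninv (res f) ->
  exists2 h : G k.+1, altm h & f = d h.
Proof.
move=> d0 cf df hf nf; have [h ch hh] := level2 cf df hf.
have [||||h' ch' fE] := @exact1 k.+1 (f - d h) d0 => //.
- by apply: altmB => //; apply: d_altm.
- exact: d_sub0.
- exact: noninv_res.
exists (h + h'); first exact: altmD.
by rewrite (linD (@d_lin _ _ rho k.+1)) -fE addrC subrK.
Qed.

Lemma exact3 k (f : G k.+3) : dV_inv0 k.+2 -> altm f -> d f = 0 ->
  noninv (res f) -> noninv (res (f (inS E) (inS H) (inS F))) ->
  exists2 h : G k.+2, altm h & f = d h.
Proof.
move=> d0 cf df nf nf3; have [h ch hh] := level3 cf nf3.
have [||||h' ch' fE] := @exact2 k.+1 (f - d h) d0 => //.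
- by apply: altmB => //; apply: d_altm.
- exact: d_sub0.
- exact: noninv_res.
exists (h + h'); first exact: altmD.
by rewrite (linD (@d_lin _ _ rho k.+2)) -fE addrC subrK.
Qed.

(** ** Cocycles with prescribed components *)

Lemma ext_cocycle k (m : U k) : slinv m -> dV m = 0 -> d (ext m) = 0.
Proof.
move=> [cm im] dm; have ce := ext_altm cm; have he := hor_ext cm.
apply: hor_res0; [exact: d_altm | | by rewrite res_d // res_ext].
move=> X; rewrite d_hor //; apply: hor_res0; [exact: th_altm | exact: hor_thS |].
by rewrite res_thS res_ext.
Qed.

(** The volume form of sl2 times an alternating map on V. *)
Definition vol k (m : U k) : G k.+3 := wedge aE (wedge aH (wedge aF (ext m))).

Lemma vol_altm k (m : U k) : altm m -> altm (vol m).
Proof.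
move=> cm; do ![apply: wedge_altm]; try exact: ext_altm;
  first [exact: aE_lin | exact: aH_lin | exact: aF_lin].
Qed.

Lemma vol_EHF k (m : U k) : altm m -> vol m (inS E) (inS H) (inS F) = ext m.
Proof. by move=> cm; apply/wedge3_EHF/hor_ext. Qed.

Lemma res_vol k (m : U k) : res (vol m) = 0.
Proof. by apply: res_wedge => v; rewrite aV. Qed.

Lemma res_vol1 k (m : U k) X : @res _ _ rho k.+2 (vol m (inS X)) = 0.
Proof.
rewrite [vol m (inS X)](_ : _ = aE (inS X) *: wedge aH (wedge aF (ext m))
  - wedge aE (wedge aH (wedge aF (ext m)) (inS X) : G k.+1)) //.
have lr := @res_lin _ _ rho k.+2.
by rewrite (linB lr) (linZ lr) !res_wedge ?scaler0 ?subr0 // => v; rewrite aV.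
Qed.

Lemma res_vol2 k (m : U k) X Y : @res _ _ rho k.+1 (vol m (inS X) (inS Y)) = 0.
Proof.
have lr := @res_lin _ _ rho k.+1.
set w := wedge aH (wedge aF (ext m)).
have w0 Z : @res _ _ rho k.+1 (w (inS Z)) = 0.
  rewrite [w _](_ : _ = aH (inS Z) *: wedge aF (ext m)
    - wedge aH (wedge aF (ext m) (inS Z) : G k)) //.
  by rewrite (linB lr) (linZ lr) !res_wedge ?scaler0 ?subr0 // => v; rewrite aV.
have v0 : @res _ _ rho k.+1 (wedge aE (w (inS X) (inS Y) : G k)) = 0.
  by apply: res_wedge => v; rewrite aV.
rewrite [vol m (inS X) (inS Y)](_ : _ = aE (inS X) *: w (inS Y)
  - (aE (inS Y) *: w (inS X) - wedge aE (w (inS X) (inS Y) : G k))) //.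
by rewrite (linB lr) (linZ lr) w0 (linB lr) (linZ lr) w0 v0 !scaler0 !subr0.
Qed.

Lemma d_contract3 k (f : G k.+3) X Y Z :
  d f (inS X) (inS Y) (inS Z) =
    th (inS X) (f (inS Y) (inS Z) : G k.+1) - th (inS Y) (f (inS X) (inS Z) : G k.+1)
    + th (inS Z) (f (inS X) (inS Y) : G k.+1) - f (inS (lie X Y)) (inS Z)
    + f (inS X) (inS (lie Y Z)) - f (inS Y) (inS (lie X Z))
    - d (f (inS X) (inS Y) (inS Z) : G k).
Proof.
rewrite -!lie_SS.
rewrite [LHS](_ : _ = th (inS X) (f (inS Y) (inS Z) : G k.+1)
  - f (inS Y) (lie (inS X) (inS Z)) - f (lie (inS X) (inS Y)) (inS Z)
  - (th (inS Y) (f (inS X) (inS Z) : G k.+1) - f (inS X) (lie (inS Y) (inS Z))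
     - (th (inS Z) (f (inS X) (inS Y) : G k.+1) - d (f (inS X) (inS Y) (inS Z) : G k)))) //.
by lmod (G k.+1).
Qed.

Lemma vol_cocycle k (m : U k) : slinv m -> dV m = 0 -> d (vol m) = 0.
Proof.
move=> [cm im] dm; have cv := vol_altm cm; have cd := d_altm cv.
have lr j := @res_lin _ _ rho j.
have resd1 j (f : G j.+1) X :
    @res _ _ rho j.+1 (d f (inS X)) = thV X (res f) - res (d (f (inS X) : G j)).
  by rewrite difS (linB (lr j.+1)) res_thS.
apply: hor_res0 => //; last by rewrite res_d // res_vol (lin0 (@dV_lin _ _ rho _)).
move=> X; apply: (@hor_res0 _ _ rho k.+3); [exact: altm_app | | ]; last first.
  rewrite resd1 res_vol (lin0 (@lieder_lin _ _ _ _ _ _ _)) res_d ?res_vol1; last exact: altm_app.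
  by rewrite (lin0 (@dV_lin _ _ rho _)) subr0.
move=> Y; apply: (@hor_res0 _ _ rho k.+2); [by do 2!apply: altm_app | | ]; last first.
  rewrite difS curD curN derS (linB (lr k.+2)) (linB (lr k.+2)) res_thS resd1 !res_vol1.
  rewrite lie_SS res_vol1 !(lin0 (@lieder_lin _ _ _ _ _ _ _)) res_d ?res_vol2 //;
    last by do 2!apply: altm_app.
  by rewrite (lin0 (@dV_lin _ _ rho _)) !subr0.
suff dEHF : d (vol m) (inS E) (inS H) (inS F) = 0.
  by move=> Z; apply: (altm_SSS0 cd).
have cvEHF : altm (vol m (inS E) (inS H) (inS F) : G k) by do 3!apply: altm_app.
apply: (@hor_res0 _ _ rho k.+1); first by do 3!apply: altm_app.
  by move=> T; apply: altm_SSSS0.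
rewrite d_contract3 6!(linB (lr k.+1), linD (lr k.+1)) !res_thS res_d //.
rewrite vol_EHF // res_ext dm !res_vol2 !(lin0 (@lieder_lin _ _ _ _ _ _ _)).
by rewrite !subr0 !addr0.
Qed.

End Levels.

(** * Computing a cohomology space from a functional on cocycles *)

(** Linearity of Phi on all functions, not only on cocycles, avoids introducing a
structure on the space of cocycles in the applications. *)
Lemma cohomology_iso (F : fieldType) (L : lieAlgType F) (M : lmodType F)
    (rho : lieModule L M) k (W : lmodType F) (Phi : ({ffun 'I_k -> L} -> M) -> W) :
  linear Phi ->
  (forall f, is_cochain f -> ce_diff rho f = 0 -> Phi f = 0 -> is_coboundary rho f) ->
  (forall f, is_coboundary rho f -> Phi f = 0) ->
  (forall w, exists f, [/\ is_cochain f, ce_diff rho f = 0 & Phi f = w]) ->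
  lmod_iso (cohomology rho k) W.
Proof.
move=> lP injP cobP surP.
pose Q := @coboundary_pred F L M rho k.
pose phi (q : cohomology rho k) : W := Phi (cocycle_val (repr q)).
have phi_pi (z : cocycle rho k) : phi (\pi_(lmod_quot Q) z)%qT = Phi (cocycle_val z).
  apply/eqP; rewrite -subr_eq0 -(linB lP); apply/eqP/cobP.
  have : (repr (\pi_(lmod_quot Q) z) - z)%qT \in Q by apply/lmod_quot_piE; rewrite reprK.
  by move/asboolP.
have lphi : linear phi.
  move=> a; elim/lmod_quot_ind => u; elim/lmod_quot_ind => v.
  rewrite (_ : _ + _ = \pi_(lmod_quot Q) (a *: u + v))%qT; last first.
    by rewrite lmod_quot_piD; congr (_ + _); rewrite -lmod_quot_piZ.
  by rewrite !phi_pi lP.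
pose lin_phi := GRing.isLinear.Build F (cohomology rho k) W _ phi lphi.
pose phiL : {linear cohomology rho k -> W} := HB.pack phi lin_phi.
have phi_inj q : phi q = 0 -> q = 0.
  elim/lmod_quot_ind: q => z; rewrite phi_pi => z0.
  have [cz dz] := asboolP _ (cocycle_valP z).
  rewrite -(lin0 (f := \pi_(lmod_quot Q)%qT)); last first.
    by move=> a u v; rewrite lmod_quot_piD; congr (_ + _); rewrite -lmod_quot_piZ.
  by apply/lmod_quot_piE; rewrite subr0; apply/asboolP/injP.
have /choice[sec secP] w : exists q, phi q = w.
  have [f [cf df fw]] := surP w.
  have zf : f \in cocycle_pred rho (k := k) by apply/asboolP.
  by exists (\pi_(lmod_quot Q) (Cocycle zf))%qT; rewrite phi_pi.
exists phiL; exists sec => [q|w]; last exact: secP.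
by apply/eqP; rewrite -subr_eq0; apply/eqP/phi_inj; rewrite (linB lphi) secP subrr.
Qed.

Lemma cohomology_eq0 (F : fieldType) (L : lieAlgType F) (M : lmodType F)
    (rho : lieModule L M) k :
  (forall f : {ffun 'I_k -> L} -> M, is_cochain f -> ce_diff rho f = 0 -> is_coboundary rho f) ->
  forall x : cohomology rho k, x = 0.
Proof.
move=> cob; elim/lmod_quot_ind => z.
have [cz dz] := asboolP _ (cocycle_valP z).
rewrite -(lin0 (f := \pi_(lmod_quot (@coboundary_pred F L M rho k))%qT)); last first.
  by move=> a u v; rewrite lmod_quot_piD; congr (_ + _); rewrite -lmod_quot_piZ.
by apply/lmod_quot_piE; rewrite subr0; apply/asboolP/cob.
Qed.

(** * The standard basis of an irreducible sl2-module *)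

Section StandardBasis.
Variables (C : numClosedFieldType) (V : vectType C) (rho : lieModule (sl C 2) V).
Local Notation s := (sl C 2).
Local Notation H := (slH C).
Local Notation E := (slE C).
Local Notation F := (slF C).

Lemma vect_coordinates : exists N (j : V -> 'rV[C]_N), linear j /\ injective j.
Proof.
exists (\dim {:V}), (fun x => \row_i coord (vbasis fullv) i x); split.
  by move=> c x y; apply/rowP => i; rewrite !mxE -linearP.
move=> u v uv; rewrite (coord_vbasis (memvf u)) (coord_vbasis (memvf v)).
apply: eq_bigr => i _.
by have := congr1 (fun z : 'rV_(\dim {:V}) => z 0 i) uv; rewrite !mxE => ->.
Qed.

(** [co i] is the i-th coordinate on the basis [b 0, ..., b m] of weight
vectors; the convention [b i = 0] for i > m makes the formulas for the action
of the standard generators uniform. *)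
Record std_basis (m : nat) (b : nat -> V) (co : nat -> V -> C) : Prop := StdBasis {
  std_H : forall i, rho H (b i) = (m%:R - (2 * i)%:R) *: b i;
  std_F : forall i, rho F (b i) = b i.+1;
  std_E0 : rho E (b 0%N) = 0;
  std_E : forall i, rho E (b i.+1) = (i.+1%:R * (m%:R - i%:R)) *: b i;
  std_gt : forall i, (m < i)%N -> b i = 0;
  std_lin : forall i, linear (co i : V -> C^o);
  std_co : forall i j, (i <= m)%N -> (j <= m)%N -> co i (b j) = (i == j)%:R;
  std_sum : forall v, v = \sum_(i < m.+1) co i v *: b i
}.

(** A highest weight vector exists, since some eigenvector of H can be raised to the
top. The string it generates is stable, hence spans V, and it is free because its last
vector is nonzero. *)
Lemma irreducible_std_basis m : lie_irreducible rho -> \dim {:V} = m.+1 ->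
  exists b co, std_basis m b co.
Proof.
move=> [V0 irr] dimV.
have mV : sl2mod (fun _ : V => True) (rho E) (rho H) (rho F).
  exact: (altm_sl2mod rho rho 0).
have fV : findim (fun _ : V => True) by exact: (altm_findim V 0 vect_coordinates).
have [sV le lh lf] := And4 (sl2_sub mV) (sl2_line mV) (sl2_linh mV) (sl2_linf mV).
have [p p0 pH] := annih_global sV fV lh (fun _ _ => I).
have v0 : vpick (fullv : {vspace V}) != 0 by rewrite vpick0.
have [mu _ [r [w0 hw]]] := eigvec lh p0 v0 (pH _ I).
have [k [w'0 ew']] := raise_to_top mV fV I w0 hw.
set w' := iter k (rho E) _ in w'0 ew'.
have hw' := weight_en mV k I hw; rewrite -/w' in hw'.
have [n [lamn fn0 fn1]] := highest_weight_nat mV fV I w'0 ew' hw'.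
rewrite lamn in hw'.
pose b i := iter i (rho F) w'.
have bgt i : (n < i)%N -> b i = 0.
  move=> lt_ni; rewrite /b -(subnK lt_ni) iterD fn1.
  by elim: (i - n.+1)%N => //= j ->; rewrite (lin0 lf).
have bH i : rho H (b i) = (n%:R - (2 * i)%:R) *: b i by exact: (weight_fn mV i I hw').
have bE i : rho E (b i.+1) = (i.+1%:R * (n%:R - i%:R)) *: b i by exact: (e_fn mV i I ew' hw').
pose X : n.+1.-tuple V := [tuple b i | i < n.+1].
have XE (i : 'I_n.+1) : X`_i = b i by rewrite -tnth_nth tnth_mktuple.
(* Applying F^(n-i) to a relation whose first i coefficients vanish isolates the
   next one. *)
have freeX : free X.
  apply/freeP => c; under eq_bigr do rewrite XE; move=> c0.
  suff c0i i (lt_in : (i < n.+1)%N) : c (Ordinal lt_in) = 0.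
    by move=> [i lt_in]; apply: c0i.
  elim/ltn_ind: i lt_in => i IHi lt_in.
  have lin_it : linear (iter (n - i) (rho F)) by exact: linear_iter.
  have := congr1 (iter (n - i) (rho F)) c0.
  rewrite (lin_sum lin_it) (lin0 lin_it) (bigD1 (Ordinal lt_in)) //= big1 ?addr0.
    rewrite (linZ lin_it) /b -iterD subnK // => /eqP.
    by rewrite scaler_eq0 (negbTE fn0) orbF => /eqP.
  move=> j ji; rewrite (linZ lin_it); have [lt_ji|le_ij] := ltnP j i.
    by case: j ji lt_ji => j lt_jn ji lt_ji; rewrite IHi ?scale0r.
  rewrite /b -iterD -/(b _) bgt ?scaler0 //.
  have : (j != i :> nat) by [].
  by lia.
have spanX : (<<X>> = fullv)%VS.
  have Xb i : b i \in <<X>>%VS.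
    have [lt_in|] := ltnP i n.+1; last by move/bgt->; rewrite mem0v.
    by rewrite memv_span //; apply/mapP; exists (Ordinal lt_in); rewrite ?mem_enum.
  case: (irr <<X>>%VS) => //.
    move=> Y v /coord_span ->; rewrite (lin_sum (act_linr rho Y)).
    apply: memv_suml => i _; rewrite XE (linZ (act_linr rho Y)) memvZ //.
    rewrite -(sl_decomp Y) !(linD (act_linl rho _)) !(linZ (act_linl rho _)).
    rewrite !memvD ?memvZ //; last exact: (Xb i.+1).
      case: (i : nat) => [|j]; first by rewrite ew' mem0v.
      by rewrite bE memvZ.
    by rewrite bH memvZ.
  move=> X0; have := Xb 0%N; rewrite X0 memv0 => /eqP b0.
  by case/eqP: w'0.
have nm : n = m.
  by have := eqnP freeX; rewrite spanX dimV size_tuple => -[].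
exists b, (fun i v => coord X (inord i) v); rewrite -nm; split => //.
- by move=> i c u v; rewrite linearP.
- move=> i j le_in le_jn.
  rewrite (_ : b j = X`_(inord j : 'I_n.+1)); last by rewrite XE inordK.
  by rewrite coord_free // eq_sym -val_eqE /= !inordK.
- move=> v; have vX : v \in <<X>>%VS by rewrite spanX memvf.
  rewrite {1}(coord_span vX); apply: eq_bigr => i _.
  by rewrite XE inord_val.
Qed.

End StandardBasis.

(** * Post-composition of multilinear maps *)

Section PostComposition.
Variables (F : fieldType) (T : lmodType F).

Fixpoint post (W W' : lmodType F) (q : W -> W') (k : nat) : cur T W k -> cur T W' k :=
  match k with
  | 0 => q
  | k'.+1 => fun f x => post q (f x)
  end.

Lemma post_lin (W W' : lmodType F) (q : W -> W') k : linear q -> linear (@post W W' q k).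
Proof.
by move=> lq; elim: k => // k IHk c f h; apply/funext => x; rewrite /= !curE IHk.
Qed.

Lemma post_altm (W W' : lmodType F) (q : W -> W') k (f : cur T W k) :
  linear q -> altm f -> altm (post q f).
Proof.
move=> lq; elim: k f => // k IHk f cf; split.
- by move=> c u v; rewrite /= (altm_lin cf) (post_lin lq).
- by move=> x; apply/IHk/altm_app.
- by case: k {IHk} f cf => // k f cf x; rewrite /= (altm_diag _ cf) (lin0 (post_lin lq)).
Qed.

Lemma post_comp (W W' W'' : lmodType F) (q : W' -> W'') (q' : W -> W') k (f : cur T W k) :
  post q (post q' f) = post (fun w => q (q' w)) f.
Proof. by elim: k f => // k IHk f; apply/funext => x /=; rewrite IHk. Qed.

Lemma post_der (W W' : lmodType F) (q : W -> W') a b b' k (f : cur T W k) :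
  linear q -> (forall w, q (b w) = b' (q w)) -> post q (der a b f) = der a b' (post q f).
Proof.
move=> lq qb; elim: k f => // k IHk f; apply/funext => x.
by rewrite derS -IHk /= (linB (post_lin lq)).
Qed.

Lemma der_mo (W : lmodType F) a b k (f : cur T W k) :
  der a b f = der a (fun=> 0) f + post b f.
Proof.
elim: k f => [|k IHk] f; first by rewrite /= add0r.
by apply/funext => x; rewrite curD !derS IHk /=; lmod (cur T W k).
Qed.

Lemma post_comb (W W' : lmodType F) (q q' : W -> W') c k (f : cur T W k) :
  post (fun w => c *: q w + q' w) f = c *: post q f + post q' f.
Proof. by elim: k f => // k IHk f; apply/funext => x; rewrite /= IHk. Qed.

Lemma post0 (W W' : lmodType F) k (f : cur T W k) : post (fun _ => 0 : W') f = 0.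
Proof. by elim: k f => // k IHk f; apply/funext => x; rewrite /= IHk. Qed.

Lemma postZ (W W' : lmodType F) (q : W -> W') c k (f : cur T W k) :
  post (fun w => c *: q w) f = c *: post q f.
Proof. by elim: k f => // k IHk f; apply/funext => x; rewrite /= IHk. Qed.

Lemma post_inj2 (W W1 W2 : lmodType F) (q1 : W -> W1) (q2 : W -> W2) k (f : cur T W k) :
  (forall w, q1 w = 0 -> q2 w = 0 -> w = 0) -> post q1 f = 0 -> post q2 f = 0 -> f = 0.
Proof.
move=> inj; elim: k f => [|k IHk] f f1 f2; first exact: inj.
by apply/funext => x; apply: IHk; [have := congr1 (@^~ x) f1 | have := congr1 (@^~ x) f2].
Qed.

End PostComposition.

(** * Invariant multilinear maps *)

Section Weights.
Variables (C : numClosedFieldType) (V : vectType C) (rho : lieModule (sl C 2) V).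
Local Notation s := (sl C 2).
Local Notation H := (slH C).
Local Notation E := (slE C).
Local Notation F := (slF C).
Variables (m : nat) (b : nat -> V) (co : nat -> V -> C).
Hypothesis basis : std_basis rho m b co.

Let bH := std_H basis.
Let bF := std_F basis.
Let bE := std_E basis.

Lemma std_co_sum i (c : nat -> C) : (i <= m)%N ->
  co i (\sum_(j < m.+1) c j *: b j) = c i.
Proof.
move=> le_im; rewrite (lin_sum (std_lin basis i)) (bigD1 (Ordinal (le_im : i < m.+1)%N)) //=.
rewrite (linZ (std_lin basis i)) (std_co basis) // eqxx big1 => [|j ji].
  by rewrite addr0; apply: mulr1.
rewrite (linZ (std_lin basis i)) (std_co basis) // -1?ltnS //.
by rewrite eq_sym (negbTE (ji : (j : nat) != i)); apply: mulr0.
Qed.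

Lemma std_eq0 v : (forall i, (i <= m)%N -> co i v = 0) -> v = 0.
Proof.
move=> v0; rewrite (std_sum basis v) big1 // => i _.
by rewrite v0 ?scale0r // -ltnS.
Qed.

Lemma co_H i v : (i <= m)%N -> co i (rho H v) = (m%:R - (2 * i)%:R) * co i v.
Proof.
move=> le_im; rewrite {1}(std_sum basis v) (lin_sum (act_linr rho H)).
rewrite (eq_bigr (fun j : 'I_m.+1 => ((m%:R - (2 * j)%:R) * co j v) *: b j)) => [|j _].
  by rewrite (std_co_sum (fun j => (m%:R - (2 * j)%:R) * co j v)).
by rewrite (linZ (act_linr rho H)) bH scalerA mulrC.
Qed.

Lemma co0_F v : co 0%N (rho F v) = 0.
Proof.
rewrite (std_sum basis v) (lin_sum (act_linr rho F)) (lin_sum (std_lin basis 0)).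
rewrite big1 // => j _; rewrite (linZ (act_linr rho F)) (linZ (std_lin basis 0)) bF.
have [le_jm|lt_mj] := leqP j.+1 m; first by rewrite (std_co basis) //; apply: mulr0.
by rewrite (std_gt basis) // (lin0 (std_lin basis 0)) scaler0.
Qed.

Lemma co_E i v : (i < m)%N -> co i (rho E v) = (i.+1%:R * (m%:R - i%:R)) * co i.+1 v.
Proof.
move=> lt_im; rewrite {1}(std_sum basis v) (lin_sum (act_linr rho E)) big_ord_recl.
rewrite (linZ (act_linr rho E)) (std_E0 basis) scaler0 add0r.
pose c j := (j < m)%N%:R * ((j.+1%:R * (m%:R - j%:R)) * co j.+1 v).
rewrite (eq_bigr (fun j : 'I_m => c j *: b j)) => [|j _]; last first.
  by rewrite (linZ (act_linr rho E)) lift0 bE scalerA /c ltn_ord mul1r mulrC.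
have -> : \sum_(j < m) c j *: b j = \sum_(j < m.+1) c j *: b j.
  by rewrite big_ord_recr /= /c ltnn mul0r scale0r addr0.
by rewrite std_co_sum ?(ltnW lt_im) // /c lt_im mul1r.
Qed.

Section BasisValues.
Variable W : lmodType C.

Lemma basis_eq0 k (f : cur V W k.+1) : altm f ->
  (forall i, (i <= m)%N -> f (b i) = 0) -> f = 0.
Proof.
move=> cf f0; apply/funext => v; rewrite (std_sum basis v) (lin_sum (altm_lin cf)).
by rewrite big1 // => i _; rewrite (linZ (altm_lin cf)) f0 ?scaler0 // -ltnS.
Qed.

(** The arguments contribute k odd weights, so the parity of the weights of the
values is that of k (m being odd). *)
Lemma parity_zero (bt : lieModule s W) (p : nat) :
  (forall (t : int) w, bt H w = (2 * t + p)%:~R *: w -> w = 0) ->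
  forall k (t : int) (f : cur V W k), altm f ->
  lieder rho bt H f = (2 * t + p - k%:Z * m)%:~R *: f -> f = 0.
Proof.
move=> bad; elim=> [|k IHk] t f cf fH; first by move: fH; rewrite mul0r subr0; apply: bad.
apply: basis_eq0 => // i le_im; apply: (IHk (t - i%:Z)); first exact: altm_app.
have := congr1 (@^~ (b i)) fH; rewrite /lieder derS curZ bH (linZ (altm_lin cf)) => /eqP.
rewrite subr_eq -scalerDl => /eqP ->; congr (_ *: _).
rewrite !(rmorphB, rmorphD, rmorphM) /= -?pmulrn.
ring.
Qed.

End BasisValues.
End Weights.

Section Invariants.
Variables (C : numClosedFieldType) (V : vectType C) (rho : lieModule (sl C 2) V).
Local Notation s := (sl C 2).
Local Notation H := (slH C).
Local Notation E := (slE C).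
Local Notation F := (slF C).
Variables (m : nat) (b : nat -> V) (co : nat -> V -> C).
Hypothesis basis : std_basis rho m b co.

Let bH := std_H basis.
Let bF := std_F basis.
Let bE := std_E basis.

Definition eqvt (W : lmodType C) (bt : lieModule s W) k (f : cur V W k) :=
  altm f /\ forall X, lieder rho bt X f = 0.

(** ** Highest weight components *)

(** An alternating form of the given weight that is killed by the lowering
operator acting on the arguments. *)
Definition hwform (c : C) k (f : cur V C^o k) := [/\ altm f,
  der (rho H) (fun=> 0) f = - c *: f & der (rho F) (fun=> 0) f = 0].

(** Equivariance turns the action on the values into minus the action on the arguments. *)
Lemma post_eqvt (W : lmodType C) (bt : lieModule s W) (q : W -> C^o) X k (f : cur V W k) :
  linear q -> eqvt bt f ->
  der (rho X) (fun=> 0) (post q f) = - post (fun w => q (bt X w)) f.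
Proof.
move=> lq [cf inv_f]; rewrite -(post_der (b := fun=> 0) (rho X) f lq) => [|w]; last exact: lin0.
have := inv_f X; rewrite /lieder der_mo => /eqP; rewrite addr_eq0 => /eqP ->.
by rewrite (linN (post_lin lq)) post_comp.
Qed.

Lemma post_E0 (W : lmodType C) (bt : lieModule s W) (q q' : W -> C^o) c k (f : cur V W k) :
  linear q -> eqvt bt f -> c != 0 -> (forall w, q (bt E w) = c *: q' w) ->
  post q f = 0 -> post q' f = 0.
Proof.
move=> lq inv_f c0 qE qf; have := post_eqvt E lq inv_f; rewrite qf.
rewrite (lin0 (der_lin _ (@linear_zero _ _ _))) => /esym/eqP.
have -> : (fun w => q (bt E w)) = (fun w => c *: q' w) by apply/funext.
by rewrite postZ oppr_eq0 scaler_eq0 (negbTE c0) => /eqP.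
Qed.

Lemma hwform_sl k (f : cur V s k) : eqvt (adjoint s) f -> hwform 2 (post (@cE C : s -> C^o) f).
Proof.
move=> inv_f; have [cf _] := inv_f; split.
- exact: post_altm (@cE_lin C) cf.
- rewrite (post_eqvt H (@cE_lin C) inv_f) scaleNr; congr (- _); rewrite -postZ; congr (post _ f).
  apply/funext => w; rewrite [LHS](_ : _ = cE (lie H w)) // sl_lieE !slmkE mul1r mul0r subr0.
  by [].
- rewrite (post_eqvt F (@cE_lin C) inv_f) (_ : (fun w => _) = fun=> 0) ?post0 ?oppr0 //.
  apply/funext => w; rewrite [LHS](_ : _ = cE (lie F w)) // sl_lieE !slmkE !mul0r subr0.
  by rewrite mulr0.
Qed.

(** The raising operator recovers the other components from the one of highest
weight. *)
Lemma hwform_sl0 k (f : cur V s k) : eqvt (adjoint s) f ->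
  post (@cE C : s -> C^o) f = 0 -> f = 0.
Proof.
move=> inv_f f0.
have h0 : post (@cH C : s -> C^o) f = 0.
  apply: (post_E0 (c := - 2) (@cE_lin C) inv_f _ _ f0); first by rewrite oppr_eq0 pnatr_eq0.
  move=> w; rewrite [LHS](_ : _ = cE (lie E w)) // sl_lieE !slmkE mul1r mul0r sub0r.
  by rewrite mulrN -mulNr.
have g0 : post (@cF C : s -> C^o) f = 0.
  apply: (post_E0 (c := 1) (@cH_lin C) inv_f _ _ h0); first exact: oner_neq0.
  move=> w; rewrite [LHS](_ : _ = cH (lie E w)) // sl_lieE !slmkE mul1r mul0r subr0.
  by rewrite scale1r.
elim: k f {inv_f} f0 h0 g0 => [|k IHk] f f0 h0 g0.
  by apply: slP; rewrite ?(lin0 (@cE_lin C)) ?(lin0 (@cH_lin C)) ?(lin0 (@cF_lin C)).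
apply/funext => x; apply: IHk; by [have := congr1 (@^~ x) f0 | have := congr1 (@^~ x) h0
  | have := congr1 (@^~ x) g0].
Qed.

Lemma hwform_V k (f : cur V V k) : eqvt rho f -> hwform m%:R (post (co 0%N : V -> C^o) f).
Proof.
move=> inv_f; have [cf _] := inv_f; have lco := std_lin basis 0; split.
- exact: post_altm lco cf.
- rewrite (post_eqvt H lco inv_f) scaleNr; congr (- _); rewrite -postZ; congr (post _ f).
  by apply/funext => w; rewrite (co_H basis) // subr0.
- rewrite (post_eqvt F lco inv_f) (_ : (fun w => _) = fun=> 0) ?post0 ?oppr0 //.
  by apply/funext => w; apply: (co0_F basis).
Qed.

(** As for [hwform_sl0], climbing down the basis one coordinate at a time. *)
Lemma hwform_V0 k (f : cur V V k) : eqvt rho f -> post (co 0%N : V -> C^o) f = 0 -> f = 0.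
Proof.
move=> inv_f f0.
have coi i : (i <= m)%N -> post (co i : V -> C^o) f = 0.
  elim: i => // i IHi lt_im.
  apply: (post_E0 (c := i.+1%:R * (m%:R - i%:R)) (std_lin basis i) inv_f _ _ (IHi (ltnW lt_im))).
    by rewrite mulf_neq0 ?pnatr_eq0 // subr_eq0 eqr_nat gtn_eqF.
  by move=> w; apply: (co_E basis).
elim: k f {inv_f f0} coi => [|k IHk] f coi; first exact: (std_eq0 basis).
by apply/funext => x; apply: IHk => i le_im; have := congr1 (@^~ x) (coi i le_im).
Qed.

(** ** Weights and the lowering relation on basis vectors *)

Section Values.
Implicit Types (a : V -> V) (x y z w : V).

Lemma der2E a (f : cur V C^o 2) x y :
  der a (fun=> 0) f x y = - (f (a x) y + f x (a y)).
Proof. rewrite [LHS](_ : _ = 0 - f x (a y) - f (a x) y) //; ring. Qed.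

Lemma der3E a (f : cur V C^o 3) x y z :
  der a (fun=> 0) f x y z = - (f (a x) y z + f x (a y) z + f x y (a z)).
Proof. rewrite [LHS](_ : _ = 0 - f x y (a z) - f x (a y) z - f (a x) y z) //; ring. Qed.

Lemma der4E a (f : cur V C^o 4) x y z w :
  der a (fun=> 0) f x y z w =
  - (f (a x) y z w + f x (a y) z w + f x y (a z) w + f x y z (a w)).
Proof.
rewrite [LHS](_ : _ = 0 - f x y z (a w) - f x y (a z) w - f x (a y) z w - f (a x) y z w) //.
ring.
Qed.

Variable c : C.

Lemma hw2_weight (f : cur V C^o 2) i j : hwform c f ->
  (2 * m%:R - (2 * (i + j))%:R - c) * f (b i) (b j) = 0.
Proof.
case=> cf fH _; have := congr1 (fun h : cur V C^o 2 => h (b i) (b j)) fH.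
have L1 (r : C) x y : f (r *: x) y = r * f x y by rewrite (linZ (altm_lin cf)).
have L2 (r : C) x y : f x (r *: y) = r * f x y by rewrite (linZ (altm_lin (altm_app _ cf))).
rewrite der2E !bH L1 L2 [RHS](_ : _ = - c * f (b i) (b j)) //.
by move/eqP; rewrite -subr_eq0 => /eqP eq0; rewrite -[RHS]oppr0 -eq0 !natrM natrD; ring.
Qed.

Lemma hw3_weight (f : cur V C^o 3) i j k : hwform c f ->
  (3 * m%:R - (2 * (i + j + k))%:R - c) * f (b i) (b j) (b k) = 0.
Proof.
case=> cf fH _; have := congr1 (fun h : cur V C^o 3 => h (b i) (b j) (b k)) fH.
have c1 := altm_app _ cf; have c2 x y := altm_app x (c1 y).
have L1 (r : C) x y z : f (r *: x) y z = r * f x y z by rewrite (linZ (altm_lin cf)).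
have L2 (r : C) x y z : f x (r *: y) z = r * f x y z by rewrite (linZ (altm_lin (c1 _))).
have L3 (r : C) x y z : f x y (r *: z) = r * f x y z by rewrite (linZ (altm_lin (c2 _ _))).
rewrite der3E !bH L1 L2 L3 [RHS](_ : _ = - c * f (b i) (b j) (b k)) //.
by move/eqP; rewrite -subr_eq0 => /eqP eq0; rewrite -[RHS]oppr0 -eq0 !natrM !natrD; ring.
Qed.

Lemma hw4_weight (f : cur V C^o 4) i j k l : hwform c f ->
  (4 * m%:R - (2 * (i + j + k + l))%:R - c) * f (b i) (b j) (b k) (b l) = 0.
Proof.
case=> cf fH _; have := congr1 (fun h : cur V C^o 4 => h (b i) (b j) (b k) (b l)) fH.
have c1 := altm_app _ cf; have c2 x y := altm_app x (c1 y); have c3 x y z := altm_app x (c2 y z).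
have L1 (r : C) x y z w : f (r *: x) y z w = r * f x y z w by rewrite (linZ (altm_lin cf)).
have L2 (r : C) x y z w : f x (r *: y) z w = r * f x y z w by rewrite (linZ (altm_lin (c1 _))).
have L3 (r : C) x y z w : f x y (r *: z) w = r * f x y z w by rewrite (linZ (altm_lin (c2 _ _))).
have L4 (r : C) x y z w : f x y z (r *: w) = r * f x y z w by rewrite (linZ (altm_lin (c3 _ _ _))).
rewrite der4E !bH L1 L2 L3 L4 [RHS](_ : _ = - c * f (b i) (b j) (b k) (b l)) //.
by move/eqP; rewrite -subr_eq0 => /eqP eq0; rewrite -[RHS]oppr0 -eq0 !natrM !natrD; ring.
Qed.

Lemma hw2_lower (f : cur V C^o 2) i j : hwform c f ->
  f (b i.+1) (b j) + f (b i) (b j.+1) = 0.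
Proof.
case=> _ _ fF; have := congr1 (fun h : cur V C^o 2 => h (b i) (b j)) fF.
by rewrite der2E !bF => /eqP; rewrite oppr_eq0 => /eqP.
Qed.

Lemma hw3_lower (f : cur V C^o 3) i j k : hwform c f ->
  f (b i.+1) (b j) (b k) + f (b i) (b j.+1) (b k) + f (b i) (b j) (b k.+1) = 0.
Proof.
case=> _ _ fF; have := congr1 (fun h : cur V C^o 3 => h (b i) (b j) (b k)) fF.
by rewrite der3E !bF => /eqP; rewrite oppr_eq0 => /eqP.
Qed.

Lemma hw4_lower (f : cur V C^o 4) i j k l : hwform c f ->
  f (b i.+1) (b j) (b k) (b l) + f (b i) (b j.+1) (b k) (b l)
  + f (b i) (b j) (b k.+1) (b l) + f (b i) (b j) (b k) (b l.+1) = 0.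
Proof.
case=> _ _ fF; have := congr1 (fun h : cur V C^o 4 => h (b i) (b j) (b k) (b l)) fF.
by rewrite der4E !bF => /eqP; rewrite oppr_eq0 => /eqP.
Qed.

End Values.

Lemma altm2_eq0 (W : lmodType C) (f : cur V W 2) : altm f ->
  (forall i j, f (b i) (b j) = 0) -> f = 0.
Proof.
move=> cf f0; apply: (basis_eq0 basis cf) => i _.
by apply: (basis_eq0 basis (altm_app _ cf)) => j _; apply: f0.
Qed.

Lemma altm3_eq0 (W : lmodType C) (f : cur V W 3) : altm f ->
  (forall i j k, f (b i) (b j) (b k) = 0) -> f = 0.
Proof.
move=> cf f0; apply: (basis_eq0 basis cf) => i _.
apply: (basis_eq0 basis (altm_app _ cf)) => j _.
by apply: (basis_eq0 basis (altm_app _ (altm_app _ cf))) => k _; apply: f0.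
Qed.

Lemma altm4_eq0 (W : lmodType C) (f : cur V W 4) : altm f ->
  (forall i j k l, f (b i) (b j) (b k) (b l) = 0) -> f = 0.
Proof.
move=> cf f0; apply: (basis_eq0 basis cf) => i _.
apply: (basis_eq0 basis (altm_app _ cf)) => j _.
apply: (basis_eq0 basis (altm_app _ (altm_app _ cf))) => k _.
by apply: (basis_eq0 basis (altm_app _ (altm_app _ (altm_app _ cf)))) => l _; apply: f0.
Qed.

End Invariants.

(** * Alternating solutions of the lowering relation *)

Section Recurrences.
Variable C : numClosedFieldType.

Lemma eq_oppr0 (x : C) : x = - x -> x = 0.
Proof.
by move=> /eqP; rewrite -addr_eq0 -mulr2n mulrn_eq0 => /eqP.
Qed.

(** The relation gives A i j = (-1)^i A 0 (i + j), which for even S is symmetric. *)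
Lemma alt2_eq0 (A : nat -> nat -> C) S :
  (forall i j, A i j = - A j i) ->
  (forall i j, A i.+1 j + A i j.+1 = 0) ->
  (forall i j, (i + j != S)%N -> A i j = 0) -> ~~ odd S ->
  forall i j, A i j = 0.
Proof.
move=> anti low supp evS i j.
have A0 l k : A l k = (-1) ^+ l * A 0%N (l + k)%N.
  elim: l k => [|l IHl] k; first by rewrite mul1r.
  have /eqP := low l k; rewrite addr_eq0 => /eqP ->; rewrite IHl exprS addSnnS.
  by ring.
have [ijS|] := eqVneq (i + j)%N S; last exact: supp.
suff A0S : A 0%N S = 0 by rewrite A0 ijS A0S mulr0.
apply: eq_oppr0; rewrite {1}anti A0 addn0 -signr_odd (negbTE evS) mul1r.
by [].
Qed.

Section ThreeIndices.
Variables (A : nat -> nat -> nat -> C).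
Hypothesis anti12 : forall i j k, A i j k = - A j i k.
Hypothesis anti23 : forall i j k, A i j k = - A i k j.

Lemma alt3_diag12 i k : A i i k = 0. Proof. exact/eq_oppr0/anti12. Qed.
Lemma alt3_diag23 i k : A k i i = 0. Proof. exact/eq_oppr0/anti23. Qed.

(** Insertion sort. *)
Lemma alt3_sorted : (forall i j k, (i < j < k)%N -> A i j k = 0) ->
  forall i j k, A i j k = 0.
Proof.
move=> srt.
have ins i j k : (j < k)%N -> A i j k = 0.
  move=> jk; have [ij|ji|->] := ltngtP i j; [by rewrite srt ?ij| |exact: alt3_diag12].
  rewrite anti12; have [ik|ki|->] := ltngtP i k; last by rewrite alt3_diag23 oppr0.
    by rewrite srt ?ji ?oppr0.
  by rewrite anti23 srt ?jk ?opprK.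
move=> i j k; have [jk|kj|->] := ltngtP j k; [exact: ins| |exact: alt3_diag23].
by rewrite anti23 ins ?oppr0.
Qed.

Variable n : nat.
Let m := (2 * n - 1)%N.
Hypothesis n_gt0 : (0 < n)%N.
Hypothesis supp : forall i j k, (i + j + k != m)%N -> A i j k = 0.
Hypothesis low : forall i j k, A i.+1 j k + A i j.+1 k + A i j k.+1 = 0.

(** Solving the relation for the term with the largest index expresses
everything through the triples whose two largest entries are adjacent. *)
Lemma tight_eq0 :
  (forall t, (t < (n + 1) %/ 3)%N -> A (2 * t)%N (n - 1 - t)%N (n - t)%N = 0) ->
  forall i j k, A i j k = 0.
Proof.
move=> tight; apply: alt3_sorted => i j k; elim: k i j => [|k IHk] i j; first by rewrite andbF.
case/andP=> ij; rewrite ltnS => le_jk.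
have [sm|] := eqVneq (i + j + k.+1)%N m; last exact: supp.
have [jk|njk] := eqVneq j k.
  have -> : i = (2 * (n - k.+1))%N by rewrite /m in sm; lia.
  have -> : j = (n - 1 - (n - k.+1))%N by rewrite /m in sm; lia.
  rewrite [X in A _ _ X](_ : _ = n - (n - k.+1))%N; last by rewrite /m in sm; lia.
  by apply: tight; rewrite /m in sm; lia.
have lt_jk : (j < k)%N by rewrite ltn_neqAle njk.
have /eqP := low i j k; rewrite addrC addr_eq0 => /eqP ->.
have -> : A i.+1 j k = 0.
  by have [->|nij] := eqVneq i.+1 j; [exact: alt3_diag12 | apply: IHk; lia].
have -> : A i j.+1 k = 0.
  by have [->|njk'] := eqVneq j.+1 k; [exact: alt3_diag23 | apply: IHk; lia].
by rewrite addr0 oppr0.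
Qed.

End ThreeIndices.

Section Construction.
Variables (n : nat) (bt : nat -> C).
Let m := (2 * n - 1)%N.

(** The solution with prescribed tight values, by recursion on the largest
index (the first argument); it vanishes on non-increasing triples. *)
Fixpoint tsol (k i j : nat) : C :=
  if k is k'.+1 then
    if (i < j <= k')%N && (i + j + k'.+1 == m)%N then
      if j == k' then bt (n - 1 - j) else - tsol k' i.+1 j - tsol k' i j.+1
    else 0
  else 0.

Lemma tsol0 k i j : ~~ ((i < j < k)%N && (i + j + k == m)%N) -> tsol k i j = 0.
Proof. by case: k => // k; rewrite ltnS => /negbTE /= ->. Qed.

(** For i < j < k this is the recursion; otherwise all three terms vanish. *)
Lemma tsol_low i j k : i != j -> j != k -> i != k ->
  tsol k i.+1 j + tsol k i j.+1 + tsol k.+1 i j = 0.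
Proof.
move=> ij jk ik; have [srt|nsrt] := boolP ((i < j < k)%N && (i + j + k.+1 == m)%N).
  rewrite [tsol k.+1 i j]/= (_ : (i < j <= k)%N && _ = true); last by lia.
  by rewrite (negbTE jk); ring.
by rewrite !tsol0 ?addr0 //; lia.
Qed.

Definition altsol i j k :=
  tsol k i j - tsol k j i - tsol j i k + tsol i j k + tsol j k i - tsol i k j.

Lemma altsol12 i j k : altsol i j k = - altsol j i k.
Proof. by rewrite /altsol; ring. Qed.

Lemma altsol23 i j k : altsol i j k = - altsol i k j.
Proof. by rewrite /altsol; ring. Qed.

Lemma altsol_supp i j k : (i + j + k != m)%N -> altsol i j k = 0.
Proof. by move=> sm; rewrite /altsol !tsol0 ?subr0 ?addr0 //; lia. Qed.

(** For distinct indices each of the six contributions vanishes, and for two equal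
indices they cancel in pairs. *)
Lemma altsol_low i j k :
  altsol i.+1 j k + altsol i j.+1 k + altsol i j k.+1 = 0.
Proof.
pose S p q r := tsol r p.+1 q + tsol r p q.+1 + tsol r.+1 p q.
have -> : altsol i.+1 j k + altsol i j.+1 k + altsol i j k.+1 =
    S i j k - S j i k - S i k j + S j k i + S k i j - S k j i.
  by rewrite /altsol /S; ring.
have [<-|ij] := eqVneq i j; first by ring.
have [<-|jk] := eqVneq j k; first by ring.
have [<-|ik] := eqVneq i k; first by ring.
rewrite /S !tsol_low 1?eq_sym //; first by ring.
all: by rewrite eq_sym.
Qed.

Lemma altsol_tight t : (t < (n + 1) %/ 3)%N ->
  altsol (2 * t)%N (n - 1 - t)%N (n - t)%N = bt t.
Proof.
move=> lt_t; rewrite /altsol; set a := tsol (n - t) _ _.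
rewrite !tsol0 ?subr0 ?addr0; try by lia.
rewrite /a (_ : n - t = (n - 1 - t).+1)%N; last by lia.
rewrite /= (_ : (_ < _ <= _)%N && _ = true); last by rewrite /m; lia.
by rewrite eqxx; congr bt; lia.
Qed.

End Construction.

(** The quadruples covered by antisymmetry, by the bound on the indices or by the gap
condition. *)
Definition known m a b c d :=
  [|| a == b, b == c, c == d, (m < d)%N |
   has (fun p => all (fun x => [&& p != x, p != x.+1 & p != x.+2]) [:: a; b; c; d])
     (iota 1 m)].

Section FourIndices.
Variables (A : nat -> nat -> nat -> nat -> C).
Hypothesis anti12 : forall i j k l, A i j k l = - A j i k l.
Hypothesis anti23 : forall i j k l, A i j k l = - A i k j l.
Hypothesis anti34 : forall i j k l, A i j k l = - A i j l k.

Lemma alt4_diag12 i k l : A i i k l = 0. Proof. exact/eq_oppr0/anti12. Qed.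
Lemma alt4_diag23 i k l : A k i i l = 0. Proof. exact/eq_oppr0/anti23. Qed.
Lemma alt4_diag34 i k l : A k l i i = 0. Proof. exact/eq_oppr0/anti34. Qed.

Lemma alt4_sorted : (forall i j k l, (i < j < k)%N -> (k < l)%N -> A i j k l = 0) ->
  forall i j k l, A i j k l = 0.
Proof.
move=> srt i.
have ins j k l : (j < k)%N -> (k < l)%N -> A i j k l = 0.
  move=> jk kl; have [ij|ji|->] := ltngtP i j; [by rewrite srt ?ij| |exact: alt4_diag12].
  rewrite anti12; have [ik|ki|->] := ltngtP i k; last by rewrite alt4_diag23 oppr0.
    by rewrite srt ?ji ?oppr0.
  rewrite anti23; have [il|li|->] := ltngtP i l; last by rewrite alt4_diag34 !oppr0.
    by rewrite srt ?jk ?oppr0.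
  by rewrite anti34 srt ?jk ?oppr0.
by apply: (@alt3_sorted (A i)) => // j k l /andP[]; apply: ins.
Qed.

Variable m : nat.
Hypothesis odd_m : odd m.
Hypothesis supp : forall i j k l, (i + j + k + l != 2 * m - 1)%N -> A i j k l = 0.
Hypothesis large : forall i j k l, (m < l)%N -> A i j k l = 0.
Hypothesis low : forall i j k l,
  A i.+1 j k l + A i j.+1 k l + A i j k.+1 l + A i j k l.+1 = 0.
Hypothesis gap : forall i j k l p, (0 < p <= m)%N ->
  all (fun x => [&& p != x, p != x.+1 & p != x.+2]) [:: i; j; k; l] -> A i j k l = 0.

Lemma known0 a b c d : known m a b c d -> A a b c d = 0.
Proof.
case/or4P => [/eqP ->|/eqP ->|/eqP ->|];
  [exact: alt4_diag12|exact: alt4_diag23|exact: alt4_diag34|].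
case/orP => [|/hasP[p]]; first exact: large.
by rewrite mem_iota add1n ltnS; apply: gap.
Qed.

(** The gap condition leaves only finitely many quadruples, with m at most 11;
for these the lowering relation is solved explicitly. *)
Lemma gap_eq0 i j k l : A i j k l = 0.
Proof.
have z5_0135 : m = 5%N -> A 0 1 3 5 = 0.
  move=> hm; have := low 0 1 2 5.
  by rewrite (@known0 1 1 2 5) ?hm // (@known0 0 2 2 5) ?hm //
    (@known0 0 1 2 6) ?hm // !(add0r, addr0).
have z5_0234 : m = 5%N -> A 0 2 3 4 = 0.
  move=> hm; have := low 0 1 3 4.
  by rewrite (@known0 1 1 3 4) ?hm // (@known0 0 1 4 4) ?hm //
    (z5_0135 hm) !(add0r, addr0).
have z7_0247 : m = 7%N -> A 0 2 4 7 = 0.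
  move=> hm; have := low 0 1 4 7.
  by rewrite (@known0 1 1 4 7) ?hm // (@known0 0 1 5 7) ?hm //
    (@known0 0 1 4 8) ?hm // !(add0r, addr0).
have z7_0256 : m = 7%N -> A 0 2 5 6 = 0.
  move=> hm; have := low 0 1 5 6.
  by rewrite (@known0 1 1 5 6) ?hm // (@known0 0 1 6 6) ?hm //
    (@known0 0 1 5 7) ?hm // !(add0r, addr0).
have z7_1246 : m = 7%N -> A 1 2 4 6 = 0.
  move=> hm; have := low 1 2 3 6.
  by rewrite (@known0 2 2 3 6) ?hm // (@known0 1 3 3 6) ?hm //
    (@known0 1 2 3 7) ?hm // !(add0r, addr0).
have z7_1345 : m = 7%N -> A 1 3 4 5 = 0.
  move=> hm; have := low 1 2 4 5.
  by rewrite (@known0 2 2 4 5) ?hm // (@known0 1 2 5 5) ?hm //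
    (z7_1246 hm) !(add0r, addr0).
have z7_0346 : m = 7%N -> A 0 3 4 6 = 0.
  move=> hm; have := low 0 2 4 6.
  by rewrite (z7_1246 hm) (z7_0256 hm) (z7_0247 hm) !(add0r, addr0).
have z9_0368 : m = 9%N -> A 0 3 6 8 = 0.
  move=> hm; have := low 0 2 6 8.
  by rewrite (@known0 1 2 6 8) ?hm // (@known0 0 2 7 8) ?hm //
    (@known0 0 2 6 9) ?hm // !(add0r, addr0).
have z9_1358 : m = 9%N -> A 1 3 5 8 = 0.
  move=> hm; have := low 0 3 5 8.
  by rewrite (@known0 0 4 5 8) ?hm // (z9_0368 hm)
    (@known0 0 3 5 9) ?hm // !(add0r, addr0).
have z9_1367 : m = 9%N -> A 1 3 6 7 = 0.
  move=> hm; have := low 0 3 6 7.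
  by rewrite (@known0 0 4 6 7) ?hm // (@known0 0 3 7 7) ?hm //
    (z9_0368 hm) !(add0r, addr0).
have z9_1457 : m = 9%N -> A 1 4 5 7 = 0.
  move=> hm; have := low 0 4 5 7.
  by rewrite (@known0 0 5 5 7) ?hm // (@known0 0 4 6 7) ?hm //
    (@known0 0 4 5 8) ?hm // !(add0r, addr0).
have z11_1479 : m = 11%N -> A 1 4 7 9 = 0.
  move=> hm; have := low 0 4 7 9.
  by rewrite (@known0 0 5 7 9) ?hm // (@known0 0 4 8 9) ?hm //
    (@known0 0 4 7 10) ?hm // !(add0r, addr0).
apply: alt4_sorted => {i j k l} a b c d /andP[ab bc] cd.
have [sm|] := eqVneq (a + b + c + d)%N (2 * m - 1)%N; last exact: supp.
have [lt_md|le_dm] := ltnP m d; first exact: large.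
have [lt_1a|le_a1] := ltnP 1 a; first by apply: (gap (p := 1)); rewrite /=; lia.
have [lt_d|le_d] := ltnP (d + 2) m; first by apply: (gap (p := m)); rewrite /=; lia.
have [lt_b|le_b] := ltnP (a + 3) b; first by apply: (gap (p := b.-1)); rewrite /=; lia.
have [lt_c|le_c] := ltnP (b + 3) c; first by apply: (gap (p := c.-1)); rewrite /=; lia.
have [lt_d'|le_d'] := ltnP (c + 3) d; first by apply: (gap (p := d.-1)); rewrite /=; lia.
have [aE bE cE dE] : [/\ a = 0 \/ a = 1, b = a + 1 \/ b = a + 2 \/ b = a + 3,
   c = b + 1 \/ c = b + 2 \/ c = b + 3 & d = c + 1 \/ d = c + 2 \/ d = c + 3]%N.
  by split; lia.
case: aE => aE; case: bE => [|[]] bE; case: cE => [|[]] cE; case: dE => [|[]] dE.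
all: rewrite aE ?add0n ?add1n in bE; rewrite bE /= in cE; rewrite cE /= in dE.
all: subst a b c d; try by lia.
all: first [ by apply: z5_0135; lia
  | by apply: z5_0234; lia
  | by apply: z7_0247; lia
  | by apply: z7_0256; lia
  | by apply: z7_1246; lia
  | by apply: z7_1345; lia
  | by apply: z7_0346; lia
  | by apply: z9_0368; lia
  | by apply: z9_1358; lia
  | by apply: z9_1367; lia
  | by apply: z9_1457; lia
  | by apply: z11_1479; lia ].
Qed.

End FourIndices.

End Recurrences.

Section LowDegreeInvariants.
Variables (C : numClosedFieldType) (V : vectType C) (rho : lieModule (sl C 2) V).
Local Notation s := (sl C 2).
Local Notation g := (semidirect rho).
Local Notation H := (slH C).
Local Notation E := (slE C).
Local Notation F := (slF C).
Local Notation dV := (dif (fun _ _ : V => 0 : V) (fun v (x : g) => lie (inV rho v) x)).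
Local Notation inV := (inV rho).
Local Notation U k := (cur V g k).
Variables (n : nat) (b : nat -> V) (co : nat -> V -> C).
Hypothesis n_gt0 : (0 < n)%N.
Let m := (2 * n - 1)%N.
Hypothesis basis : std_basis rho m b co.

Let bH := std_H basis.
Let bF := std_F basis.
Let bE := std_E basis.

Definition fstg (x : g) : s := x.1.
Definition sndg (x : g) : V := x.2.
Lemma fstg_lin : linear fstg. Proof. by []. Qed.
Lemma sndg_lin : linear sndg. Proof. by []. Qed.

Lemma slinv_fst k (f : U k) : slinv f -> eqvt rho (adjoint s) (post fstg f).
Proof.
move=> [cf inv_f]; split=> [|X]; first exact: post_altm fstg_lin cf.
rewrite /lieder -(post_der (b := adS rho X) (rho X) f fstg_lin) //.
by rewrite -[der _ _ _]/(lieder rho (adS rho) X f) inv_f (lin0 (post_lin fstg_lin)).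
Qed.

Lemma slinv_snd k (f : U k) : slinv f -> eqvt rho rho (post sndg f).
Proof.
move=> [cf inv_f]; split=> [|X]; first exact: post_altm sndg_lin cf.
rewrite /lieder -(post_der (b := adS rho X) (rho X) f sndg_lin) => [|w].
  by rewrite -[der _ _ _]/(lieder rho (adS rho) X f) inv_f (lin0 (post_lin sndg_lin)).
by rewrite /sndg /= rhor0 subr0.
Qed.

Lemma odd_weight_sl (t : int) (w : s) : adjoint s H w = (2 * t + 1%N)%:~R *: w -> w = 0.
Proof.
rewrite [adjoint s H w]/= => Hw; set z := (2 * t + 1%N)%:~R in Hw.
have zn (k : int) : z != (2 * k)%:~R by rewrite eqr_int; lia.
have z2 : z != 2 by apply: (zn 1).
have z0 : z != 0 by apply: (zn 0).
have zm2 : z != - 2 by apply: (zn (- 1)).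
have e1 := congr1 (@cE C) Hw; have e2 := congr1 (@cH C) Hw; have e3 := congr1 (@cF C) Hw.
move: e1 e2 e3; rewrite !sl_lieE !slZE !slmkE !(mul0r, mul1r, subr0, sub0r, oppr0) => e1 e2 e3.
have cancel (x y : C) : x != y -> x * cE w = y * cE w -> cE w = 0.
  by move=> xy /eqP; rewrite -subr_eq0 -mulrBl mulf_eq0 subr_eq0 (negbTE xy) => /eqP.
have cancel' (x y : C) : x != y -> x * cF w = y * cF w -> cF w = 0.
  by move=> xy /eqP; rewrite -subr_eq0 -mulrBl mulf_eq0 subr_eq0 (negbTE xy) => /eqP.
apply: slP; rewrite ?(lin0 (@cE_lin C)) ?(lin0 (@cH_lin C)) ?(lin0 (@cF_lin C)).
- by apply: (cancel _ _ z2); rewrite e1.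
- by move/esym/eqP: e2; rewrite mulf_eq0 (negbTE z0) => /eqP.
- by apply: (cancel' _ _ zm2); rewrite -e3 mulrN mulNr.
Qed.

Lemma even_weight_V (t : int) (v : V) : rho H v = (2 * t + 0%N)%:~R *: v -> v = 0.
Proof.
move=> Hv; apply: (std_eq0 basis) => i le_im.
have /eqP : (m%:R - (2 * i)%:R) * co i v = (2 * t + 0%N)%:~R * co i v.
  by rewrite -(co_H basis) // Hv (linZ (std_lin basis i)).
rewrite -subr_eq0 -mulrBl mulf_eq0 => /orP[|/eqP //].
rewrite !pmulrn -!rmorphB /= intr_eq0.
by rewrite /m in le_im *; lia.
Qed.

(** The integer t witnesses that k m is odd. *)
Lemma slinv_odd_fst k (t : int) (f : U k) : slinv f -> 2 * t + 1%N = k%:Z * m ->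
  post fstg f = 0.
Proof.
move=> /slinv_fst[cf inv_f] tE; apply: (parity_zero basis odd_weight_sl (t := t) cf).
by rewrite tE subrr scale0r; apply: inv_f.
Qed.

(** The integer t witnesses that k m is even. *)
Lemma slinv_even_snd k (t : int) (f : U k) : slinv f -> 2 * t + 0%N = k%:Z * m ->
  post sndg f = 0.
Proof.
move=> /slinv_snd[cf inv_f] tE; apply: (parity_zero basis even_weight_V (t := t) cf).
by rewrite tE subrr scale0r; apply: inv_f.
Qed.

Lemma fst_snd_eq0 k (f : U k) : post fstg f = 0 -> post sndg f = 0 -> f = 0.
Proof. by apply: post_inj2 => -[x v]; rewrite /fstg /sndg /= => -> ->. Qed.

(** The ideal V acts trivially on itself. *)
Lemma dV_fst0 k (f : U k) : altm f -> post fstg f = 0 -> dV f = 0.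
Proof.
have lieV u (x : g) : fstg x = 0 -> lie (inV u) x = 0.
  case: x => X v; rewrite /fstg /= => ->; congr pair => /=.
    by rewrite slie0r.
  by rewrite !rho0 subr0.
have derV u j (f' : U j) : altm f' -> post fstg f' = 0 ->
    der (fun=> 0) (fun x : g => lie (inV u) x) f' = 0.
  elim: j f' => [|j IHj] f' cf' f0; first exact: lieV.
  apply/funext => v; rewrite derS (lin0 (altm_lin cf')) subr0; apply: IHj (altm_app _ cf') _.
  by have := congr1 (@^~ v) f0.
elim: k f => [|k IHk] f cf f0; apply/funext => v; first exact: lieV.
have fv0 : post fstg (f v) = 0 by have := congr1 (@^~ v) f0.
rewrite difS (IHk _ (altm_app v cf) fv0) subr0; exact: (derV v k.+1 f cf f0).
Qed.

Lemma slinv0 (f : U 0) : slinv f -> f = 0.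
Proof.
move=> inv_f; apply: fst_snd_eq0; last by apply: (slinv_even_snd (t := 0) inv_f).
have [_ inv1] := slinv_fst inv_f.
have h X : lie X (post fstg f : s) = 0 by apply: inv1.
have := h E; have := h H => hH hE.
apply: slP; rewrite ?(lin0 (@cE_lin C)) ?(lin0 (@cH_lin C)) ?(lin0 (@cF_lin C)).
- have := congr1 (@cE C) hH; rewrite sl_lieE !slmkE (lin0 (@cE_lin C)) mul1r mul0r subr0.
  by move/eqP; rewrite mulf_eq0 pnatr_eq0 => /eqP.
- have := congr1 (@cE C) hE; rewrite sl_lieE !slmkE (lin0 (@cE_lin C)) mul1r mul0r sub0r.
  by move/eqP; rewrite mulf_eq0 pnatr_eq0 oppr_eq0 => /eqP.
- have := congr1 (@cH C) hE; rewrite sl_lieE !slmkE (lin0 (@cH_lin C)) mul1r mul0r subr0.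
  by [].
Qed.

Lemma slinv2 (f : U 2) : slinv f -> f = 0.
Proof.
move=> inv_f; apply: fst_snd_eq0; last first.
  by apply: (slinv_even_snd (t := m) inv_f); rewrite addr0.
have inv1 := slinv_fst inv_f; apply: (hwform_sl0 inv1).
have hw := hwform_sl inv1; have [cp _ _] := hw; set psi := post _ _ in hw cp *.
apply: (altm2_eq0 basis cp).
apply: (@alt2_eq0 _ (fun i j => psi (b i) (b j)) (m - 1)%N).
- by move=> i j; apply: (altm_anti _ _ cp).
- by move=> i j; apply: (hw2_lower basis i j hw).
- move=> i j ij; have /eqP := hw2_weight basis i j hw.
  rewrite mulf_eq0 => /orP[|/eqP //].
  by rewrite -natrM -[2]/(2%:R) !pmulrn -!rmorphB /= intr_eq0; lia.
- by rewrite oddB // ?oddM /=; lia.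
Qed.

(** By Schur's lemma the coefficient of b_0 in the image of b_0 is the scalar. *)
Definition lam1 (f : U 1) : C^o := co 0%N (sndg (f (b 0%N))).

Lemma lam1_lin : linear lam1.
Proof. by move=> c f h; rewrite /lam1 curE curZ sndg_lin (std_lin basis). Qed.

Lemma lam1_inj (f : U 1) : slinv f -> lam1 f = 0 -> f = 0.
Proof.
move=> inv_f f0; apply: fst_snd_eq0.
  by apply: (slinv_odd_fst (t := n%:Z - 1) inv_f); rewrite /m; lia.
have inv1 := slinv_snd inv_f; apply: (hwform_V0 basis inv1).
have [cp pH _] := hwform_V basis inv1; set psi := post _ _ in cp pH *.
apply: (basis_eq0 basis cp) => -[|i] _; first exact: f0.
have := congr1 (fun h : cur V C^o 1 => h (b i.+1)) pH.
rewrite [LHS](_ : _ = 0 - psi (rho H (b i.+1))) // bH (linZ (altm_lin cp)) sub0r.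
rewrite [RHS](_ : _ = - m%:R * psi (b i.+1)) //.
rewrite [_ *: _](_ : _ = (m%:R - (2 * i.+1)%:R) * psi (b i.+1)) //.
move/eqP; rewrite -subr_eq0 -mulNr -mulrBl mulf_eq0 => /orP[|/eqP //].
by rewrite opprB opprK subrK pnatr_eq0.
Qed.

Lemma lam1_surj (w : C^o) : exists f : U 1, [/\ slinv f, dV f = 0 & lam1 f = w].
Proof.
pose f : U 1 := fun v => inV (w *: v).
have cf : altm f by split=> // c u v; rewrite /f scalerDr scalerA mulrC -scalerA inV_lin.
have inv_f : slinv f.
  split=> // X; apply/funext => v.
  rewrite /lieder derS [der _ _ _](_ : _ = lie (inS rho X) (inV (w *: v))) // lie_SV /f.
  by rewrite (linZ (act_linr rho X)) subrr.
exists f; split=> //.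
  exact: dV_fst0.
by rewrite /lam1 /f /sndg /= (linZ (std_lin basis 0)) (std_co basis) //; apply: mulr1.
Qed.

(** The values of the highest weight form on the tight triples. *)
Definition lam3 (f : U 3) : 'rV[C]_((n + 1) %/ 3) :=
  \row_t co 0%N (sndg (f (b (2 * t)) (b (n - 1 - t)) (b (n - t)))).

Lemma lam3_lin : linear lam3.
Proof.
move=> c f h; apply/rowP => t; rewrite !mxE.
have fhE x y z : (c *: f + h) x y z = c *: f x y z + h x y z by [].
by rewrite fhE sndg_lin (std_lin basis).
Qed.

Lemma slinv3_fst (f : U 3) : slinv f -> post fstg f = 0.
Proof.
by move=> inv_f; apply: (slinv_odd_fst (t := 3 * n%:Z - 2) inv_f); rewrite /m; lia.
Qed.

Lemma lam3_inj (f : U 3) : slinv f -> lam3 f = 0 -> f = 0.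
Proof.
move=> inv_f f0; apply: fst_snd_eq0; first exact: slinv3_fst.
have inv1 := slinv_snd inv_f; apply: (hwform_V0 basis inv1).
have hw := hwform_V basis inv1; have [cp _ _] := hw; set psi := post _ _ in hw cp *.
apply: (altm3_eq0 basis cp).
apply: (@tight_eq0 _ (fun i j k => psi (b i) (b j) (b k)) _ _ n n_gt0).
- by move=> i j k; rewrite (altm_anti _ _ cp).
- by move=> i j k; apply: (altm_anti _ _ (altm_app _ cp)).
- move=> i j k ijk; have /eqP := hw3_weight basis i j k hw.
  rewrite mulf_eq0 => /orP[|/eqP //].
  by rewrite -natrM !pmulrn -!rmorphB /= intr_eq0; lia.
- by move=> i j k; apply: (hw3_lower basis i j k hw).
- move=> t lt_t; have := congr1 (fun r : 'rV_((n + 1) %/ 3) => r 0 (Ordinal lt_t)) f0.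
  by rewrite !mxE.
Qed.

(** ** Lifting a highest weight form to an equivariant map *)

Definition triv : lieModule s C^o.
Proof.
apply: (@LieModule _ _ _ (fun _ _ => 0)) => [w|X|X Y w]; try exact: linear_zero.
by rewrite subr0.
Defined.

Fixpoint lift_coef (j : nat) : C :=
  if j is j'.+1 then - lift_coef j' / (j'.+1%:R * (m%:R - j'%:R)) else 1.

Lemma lift_coefS j : (j < m)%N ->
  lift_coef j.+1 * (j.+1%:R * (m%:R - j%:R)) = - lift_coef j.
Proof.
move=> lt_jm; rewrite /= divfK // mulf_neq0 ?pnatr_eq0 // subr_eq0 eqr_nat.
by rewrite gtn_eqF.
Qed.

Definition tens k (f : cur V C^o k) (v : V) : cur V V k := post (fun c : C^o => c *: v) f.

Lemma tens_linv k (f : cur V C^o k) : linear (tens f).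
Proof.
move=> c u v; rewrite -[RHS]post_comb; congr (post _ f); apply/funext => x.
by lmod (V : lmodType C).
Qed.

Lemma tens_linf k (v : V) : linear ((@tens k)^~ v).
Proof. by apply: post_lin => c x y; rewrite scalerDl scalerA. Qed.

Lemma tens_altm k (f : cur V C^o k) v : altm f -> altm (tens f v).
Proof. by apply: post_altm => c x y; rewrite scalerDl scalerA. Qed.

Lemma tens_lieder X k (f : cur V C^o k) v :
  lieder rho rho X (tens f v) = tens (lieder rho triv X f) v + tens f (rho X v).
Proof.
elim: k f => [|k IHk] f.
  rewrite [LHS](_ : _ = rho X ((f : C) *: v)) // (linZ (act_linr rho X)).
  by rewrite [RHS](_ : _ = (0 : C) *: v + (f : C) *: rho X v) // scale0r add0r.
apply/funext => x; rewrite [LHS](_ : _ = lieder rho rho X (tens (f x) v) - tens (f (rho X x)) v) //.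
rewrite IHk [RHS](_ : _ = tens (lieder rho triv X (f x) - f (rho X x)) v + tens (f x) (rho X v)) //.
by rewrite (linB (@tens_linf k v)); lmod (cur V V k).
Qed.

(** The coefficients are forced by equivariance under the raising operator. *)
Lemma hwform_lift k (psi : cur V C^o k) : hwform rho m%:R psi ->
  exists phi : cur V V k, eqvt rho rho phi /\ post (co 0%N : V -> C^o) phi = psi.
Proof.
case=> cp pH pF.
have mU := sl2mod_swap (altm_sl2mod rho triv k).
have fU : findim (@altm _ V C^o k).
  apply: altm_findim; exists 1%N, (fun c => \row_(_ < 1) c); split.
    by move=> c x y; apply/rowP => i; rewrite !mxE.
  by move=> x y /rowP/(_ 0); rewrite !mxE.
have [ps psE] : exists ps : nat -> cur V C^o k,
    forall j, ps j = iter j (lieder rho triv E (k := k)) psi by eexists.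
have psS j : lieder rho triv E (ps j) = ps j.+1 by rewrite !psE.
have eF : lieder rho triv F psi = 0 by exact: pF.
have eH : - lieder rho triv H psi = m%:R *: psi.
  by rewrite /lieder [der _ _ _]pH scaleNr opprK.
have cps j : altm (ps j) by rewrite psE; exact: (sl2_Ufn mU j cp).
have psF j : lieder rho triv F (ps j.+1) = (j.+1%:R * (m%:R - j%:R)) *: ps j.
  by rewrite !psE; exact: (e_fn mU j cp eF eH).
have psH j : lieder rho triv H (ps j) = - (m%:R - (2 * j)%:R) *: ps j.
  by rewrite psE scaleNr -(weight_fn mU j cp eH) opprK.
have psm : ps m.+1 = 0.
  rewrite psE; have [p0|p0] := eqVneq psi 0.
    by rewrite p0; elim: (m.+1) => //= j ->; rewrite (lin0 (@lieder_lin _ _ _ rho triv E k)).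
  have [l [/eqP ml _ pl]] := highest_weight_nat mU fU cp p0 eF eH.
  by move: ml; rewrite eqr_nat => /eqP ->.
pose phi := \sum_(j < m.+1) lift_coef j *: tens (ps j) (b j).
have cphi : altm phi by apply: altm_sum => j; apply: altmZ; apply: tens_altm.
exists phi; split.
  have lt X := @lieder_lin _ _ _ rho rho X k.
  have thphi X : lieder rho rho X phi = \sum_(j < m.+1) lift_coef j *:
      (tens (lieder rho triv X (ps j)) (b j) + tens (ps j) (rho X (b j))).
    rewrite /phi (lin_sum (lt X)); apply: eq_bigr => j _.
    by rewrite (linZ (lt X)) tens_lieder.
  have tl v := @tens_linf k v.
  have phE : lieder rho rho E phi = 0.
    rewrite thphi; under eq_bigr do rewrite psS scalerDr.
    rewrite big_split /= [X in X + _]big_ord_recr /= psm (lin0 (tl _)) scaler0 addr0.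
    rewrite [X in _ + X]big_ord_recl /= (std_E0 basis) (lin0 (tens_linv _)) scaler0 add0r.
    rewrite -big_split big1 // => j _ /=.
    rewrite /bump leq0n add1n bE (linZ (tens_linv _)) scalerA.
    rewrite -[- _ / _]/(lift_coef j.+1) lift_coefS //.
    by rewrite scaleNr subrr.
  have phF : lieder rho rho F phi = 0.
    rewrite thphi; under eq_bigr do rewrite scalerDr bF.
    rewrite big_split /= [X in X + _]big_ord_recl /= psE [lieder _ _ _ _]eF.
    rewrite (lin0 (tl _)) scaler0 add0r.
    rewrite [X in _ + X]big_ord_recr /= (std_gt basis (ltnSn m)) (lin0 (tens_linv _)) scaler0 addr0.
    rewrite -big_split big1 // => j _ /=.
    rewrite /bump leq0n add1n psF (linZ (tl _)) scalerA.
    by rewrite -[- _ / _]/(lift_coef j.+1) lift_coefS // scaleNr addNr.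
  have phH : lieder rho rho H phi = 0.
    rewrite thphi big1 // => j _; rewrite psH bH (linZ (tl _)) (linZ (tens_linv _)).
    by rewrite scaleNr addNr scaler0.
  split=> // X; rewrite -(sl_decomp X) -addrA !lieder_comb // liederZ //.
  by rewrite phE phF phH !scaler0 !addr0.
have lm := @post_lin _ V _ _ (co 0%N : V -> C^o) k (std_lin basis 0).
rewrite /phi (lin_sum lm) big_ord_recl big1 => [|j _].
  rewrite scale1r addr0 /tens post_comp (_ : (fun c => _) = id); last first.
    by apply/funext => c; rewrite (linZ (std_lin basis 0)) (std_co basis) //; apply: mulr1.
  by rewrite psE /=; elim: (k) (psi) => //= k' IHk f; apply/funext => x; apply: IHk.
rewrite (linZ lm) /tens post_comp (_ : (fun c => _) = fun=> 0) ?post0 ?scaler0 //.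
apply/funext => c; rewrite (linZ (std_lin basis 0)) (std_co basis) //; first exact: mulr0.
exact: (ltn_ord (lift ord0 j)).
Qed.

(** ** Multilinear extension from the basis *)

Definition bext (W : lmodType C) k (a : nat -> cur V W k) : cur V W k.+1 :=
  fun u => \sum_(i < m.+1) co i u *: a i.

Lemma bext_lin (W : lmodType C) k (a : nat -> cur V W k) : linear (bext a : V -> cur V W k).
Proof.
move=> c u v; rewrite /bext scaler_sumr -big_split; apply: eq_bigr => i _ /=.
by rewrite (std_lin basis) scalerDl scalerA.
Qed.

Lemma bext_b (W : lmodType C) k (a : nat -> cur V W k) i : (i <= m)%N -> bext a (b i) = a i.
Proof.
move=> le_im; rewrite /bext (bigD1 (Ordinal (le_im : i < m.+1)%N)) //=.
rewrite (std_co basis) // eqxx scale1r big1 ?addr0 // => j ji.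
rewrite (std_co basis) // -1?ltnS //.
by rewrite (negbTE (ji : (j : nat) != i)) scale0r.
Qed.

Lemma lmod_oppr0 (X : lmodType C) (x : X) : x = - x -> x = 0.
Proof.
move/eqP; rewrite -addr_eq0 -[x]scale1r -scalerDl scaler_eq0 -[1 + 1]/(2%:R : C).
by rewrite pnatr_eq0 scale1r => /eqP.
Qed.

(** Antisymmetry on basis vectors gives f u u = - f u u by exchanging the two sums. *)
Lemma bext_altm (W : lmodType C) k (a : nat -> cur V W k) : (forall i, altm (a i)) ->
  match k return (nat -> cur V W k) -> Prop with
  | 0 => fun _ => True
  | k'.+1 => fun a => forall i j, (i <= m)%N -> (j <= m)%N -> a i (b j) = - a j (b i)
  end a -> altm (bext a).
Proof.
move=> ca anti; split; [exact: bext_lin | by move=> u; apply: altm_sum => i; apply: altmZ |].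
case: k a ca anti => // k a ca anti u.
have sumE (f : 'I_m.+1 -> cur V W k.+1) v : (\sum_i f i) v = \sum_i f i v.
  by elim/big_ind2: _ => // [] f1 f2 g1 g2 <- <-.
have bE2 : bext a u u = \sum_(i < m.+1) \sum_(j < m.+1) (co i u * co j u) *: a i (b j).
  rewrite [LHS]sumE; apply: eq_bigr => i _.
  rewrite curZ {2}(std_sum basis u) (lin_sum (altm_lin (ca i))) scaler_sumr.
  by apply: eq_bigr => j _; rewrite (linZ (altm_lin (ca i))) scalerA.
have : bext a u u = - bext a u u.
  rewrite {1}bE2 exchange_big bE2 -sumrN; apply: eq_bigr => i _.
  rewrite -sumrN; apply: eq_bigr => j _.
  by rewrite (anti j i) -1?ltnS // scalerN mulrC.
exact: lmod_oppr0.
Qed.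

Lemma lam3_surj (r : 'rV[C]_((n + 1) %/ 3)) :
  exists f : U 3, [/\ slinv f, dV f = 0 & lam3 f = r].
Proof.
pose bt t : C := if insub t is Some i then r 0 i else 0.
pose A := altsol n bt.
pose psi : cur V C^o 3 := bext (fun i => bext (fun j => bext (fun k => A i j k : cur V C^o 0))).
have cpsi : altm psi.
  apply: bext_altm => [i|i j le_im le_jm].
    apply: bext_altm => [j|j k le_jm le_km]; first exact: bext_altm.
    by rewrite !bext_b // /A altsol23.
  rewrite !bext_b //; apply/funext => u.
  rewrite [RHS](_ : _ = - bext (fun k => A j i k : cur V C^o 0) u) // /bext -sumrN.
  apply: eq_bigr => k _.
  by rewrite /A altsol12 scalerN.
have c1 := altm_app _ cpsi; have c2 x y := altm_app x (c1 y).
have psiE i j k : psi (b i) (b j) (b k) = A i j k.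
  have [le_im|lt_mi] := leqP i m; last first.
    rewrite (std_gt basis lt_mi) (lin0 (altm_lin cpsi)) /A altsol_supp //.
    by rewrite -/m; lia.
  have [le_jm|lt_mj] := leqP j m; last first.
    rewrite (std_gt basis lt_mj) (lin0 (altm_lin (c1 _))) /A altsol_supp //.
    by rewrite -/m; lia.
  have [le_km|lt_mk] := leqP k m; last first.
    rewrite (std_gt basis lt_mk) (lin0 (altm_lin (c2 _ _))) /A altsol_supp //.
    by rewrite -/m; lia.
  by rewrite /psi !bext_b.
have hw : hwform rho m%:R psi.
  split=> //.
    apply/eqP; rewrite -subr_eq0; apply/eqP/(altm3_eq0 basis).
      apply: altmB; last exact: altmZ.
      by apply: der_altm => //; [exact: act_linr | exact: linear_zero].
    move=> i j k.
    rewrite [LHS](_ : _ = der (rho H) (fun=> 0) psi (b i) (b j) (b k)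
      - (- m%:R) * psi (b i) (b j) (b k)) //.
    have L1 (q : C) x y z : psi (q *: x) y z = q * psi x y z by rewrite (linZ (altm_lin cpsi)).
    have L2 (q : C) x y z : psi x (q *: y) z = q * psi x y z by rewrite (linZ (altm_lin (c1 _))).
    have L3 (q : C) x y z : psi x y (q *: z) = q * psi x y z by rewrite (linZ (altm_lin (c2 _ _))).
    rewrite der3E !bH L1 L2 L3 !psiE.
    have [sm|/altsol_supp A0] := eqVneq (i + j + k)%N m; last by rewrite /A A0 !mulr0; ring.
    rewrite -[m in m%:R]sm !natrM !natrD; ring.
  apply: (altm3_eq0 basis); first by apply: der_altm => //; [exact: act_linr | exact: linear_zero].
  by move=> i j k; rewrite der3E !bF !psiE /A altsol_low oppr0.
have [phi [[cphi inv_phi] phiE]] := hwform_lift hw.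
pose f : U 3 := post inV phi.
have cf : altm f by apply: post_altm => //; apply: inV_lin.
have inv_f : slinv f.
  split=> // X; rewrite /lieder /f -(post_der (b := rho X) (rho X) phi (inV_lin rho)).
    by rewrite -[der _ _ _]/(lieder rho rho X phi) inv_phi (lin0 (post_lin (inV_lin rho))).
  by move=> w; rewrite -lie_SV.
exists f; split=> //; first by apply: dV_fst0 => //; apply: slinv3_fst.
apply/rowP => t; rewrite mxE.
rewrite [LHS](_ : _ = post (co 0%N : V -> C^o) phi (b (2 * t)) (b (n - 1 - t)) (b (n - t))) //.
by rewrite phiE psiE /A altsol_tight // /bt valK.
Qed.

(** ** Degree four *)

Lemma dV4E (f : U 4) (v u1 u2 u3 u4 : V) : altm f ->
  dV f v u1 u2 u3 u4 = lie (inV v) (f u1 u2 u3 u4) - lie (inV u1) (f v u2 u3 u4)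
    + lie (inV u2) (f v u1 u3 u4) - lie (inV u3) (f v u1 u2 u4) + lie (inV u4) (f v u1 u2 u3).
Proof.
move=> cf.
pose dz v k (q : U k) : U k := der (fun=> 0) (fun x : g => lie (inV v) x) q.
have dz0 w k (q : U k.+1) x : altm q -> dz w k.+1 q x = dz w k (q x).
  by move=> cq; rewrite /dz derS (lin0 (altm_lin cq)) subr0.
rewrite [LHS](_ : _ = dz v 4 f u1 u2 u3 u4 - (dz u1 3 (f v) u2 u3 u4
  - (dz u2 2 (f v u1) u3 u4 - (dz u3 1 (f v u1 u2) u4 - lie (inV u4) (f v u1 u2 u3))))) //.
have c1 x := altm_app x cf; have c2 x y := altm_app y (c1 x); have c3 x y z := altm_app z (c2 x y).
rewrite !dz0 //.
by rewrite /dz /=; lmod (g : lmodType C).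
Qed.

Lemma weight_sl0 (z : C) (x : s) : lie H x = z *: x ->
  z != 2 -> z != 0 -> z != - 2 -> x = 0.
Proof.
move=> Hx z2 z0 zm2.
have := congr1 (@cE C) Hx; have := congr1 (@cH C) Hx; have := congr1 (@cF C) Hx.
rewrite !sl_lieE !slZE !slmkE !(mul0r, mul1r, subr0, sub0r, oppr0, addr0) => e3 e2 e1.
apply: slP; rewrite ?(lin0 (@cE_lin C)) ?(lin0 (@cH_lin C)) ?(lin0 (@cF_lin C)).
- move/eqP: e1; rewrite -subr_eq0 -mulrBl mulf_eq0 subr_eq0 eq_sym (negbTE z2).
  by move/eqP.
- by move/esym/eqP: e2; rewrite mulf_eq0 (negbTE z0) => /eqP.
- move/eqP: e3; rewrite mulrN -mulNr -subr_eq0 -mulrBl mulf_eq0 subr_eq0 eq_sym (negbTE zm2).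
  by move/eqP.
Qed.

Lemma weight_sl2 (x : s) : lie H x = 2 *: x -> x = cE x *: E.
Proof.
move=> Hx.
have := congr1 (@cH C) Hx; have := congr1 (@cF C) Hx.
rewrite !sl_lieE !slZE !slmkE !(mul0r, mul1r, subr0, sub0r, oppr0, addr0) => e3 e2.
apply: slP; rewrite !slZE !slmkE ?mulr1 // mulr0.
  by move/esym/eqP: e2; rewrite mulf_eq0 pnatr_eq0 => /eqP.
have /eq_oppr0/eqP : 2 * cF x = - (2 * cF x) by rewrite -mulrN e3.
by rewrite mulf_eq0 pnatr_eq0 => /eqP.
Qed.

(** On b_p, b_i, b_j, b_k, b_l the condition dV f = 0 has five terms. The value of f on
four basis vectors vanishes unless its weight is 2, 0 or -2; if the four indices i, j,
k, l have the sum of weight 2 and p is far enough from them, only the term with b_p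
survives. *)
Lemma slinv4 (f : U 4) : slinv f -> dV f = 0 -> f = 0.
Proof.
move=> inv_f df; apply: fst_snd_eq0; last first.
  by apply: (slinv_even_snd (t := 2 * m) inv_f); lia.
have inv1 := slinv_fst inv_f; apply: (hwform_sl0 inv1).
have hw := hwform_sl inv1; have [cp _ _] := hw; set psi := post _ _ in hw cp *.
have c1 := altm_app _ cp; have c2 x y := altm_app x (c1 y); have c3 x y z := altm_app x (c2 y z).
pose phi : cur V s 4 := post fstg f.
have [_ inv_phi] := inv1; have cphi : altm phi by case: inv1.
have phiH i j k l : lie H (phi (b i) (b j) (b k) (b l)) =
    (4 * m%:R - (2 * (i + j + k + l))%:R) *: phi (b i) (b j) (b k) (b l).
  have p1 := altm_app _ cphi; have p2 x y := altm_app x (p1 y).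
  have p3 x y z := altm_app x (p2 y z).
  have L1 (q : C) x y z w : phi (q *: x) y z w = q *: phi x y z w by rewrite (linZ (altm_lin cphi)).
  have L2 (q : C) x y z w : phi x (q *: y) z w = q *: phi x y z w
    by rewrite (linZ (altm_lin (p1 _))).
  have L3 (q : C) x y z w : phi x y (q *: z) w = q *: phi x y z w
    by rewrite (linZ (altm_lin (p2 _ _))).
  have L4 (q : C) x y z w : phi x y z (q *: w) = q *: phi x y z w
    by rewrite (linZ (altm_lin (p3 _ _ _))).
  have := congr1 (fun h : cur V s 4 => h (b i) (b j) (b k) (b l)) (inv_phi H).
  rewrite [LHS](_ : _ = lie H (phi (b i) (b j) (b k) (b l)) - phi (b i) (b j) (b k) (rho H (b l))
    - phi (b i) (b j) (rho H (b k)) (b l) - phi (b i) (rho H (b j)) (b k) (b l)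
    - phi (rho H (b i)) (b j) (b k) (b l)) //.
  rewrite !bH L1 L2 L3 L4 [RHS](_ : _ = 0) // => eq0.
  rewrite -[LHS]subr0 -[in LHS]eq0 !natrM !natrD.
  by lmod_prepare (s : lmodType C); ring.
have psiE i j k l : psi (b i) (b j) (b k) (b l) = cE (phi (b i) (b j) (b k) (b l)) by [].
have supp i j k l : (i + j + k + l != 2 * m - 1)%N -> psi (b i) (b j) (b k) (b l) = 0.
  move=> ijkl; have /eqP := hw4_weight basis i j k l hw.
  rewrite mulf_eq0 => /orP[|/eqP //].
  by rewrite -natrM !pmulrn -!rmorphB /= intr_eq0; lia.
apply: (altm4_eq0 basis cp).
apply: (@gap_eq0 _ (fun i j k l => psi (b i) (b j) (b k) (b l)) _ _ _ m) => //.
- by move=> i j k l; rewrite (altm_anti _ _ cp).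
- by move=> i j k l; rewrite (altm_anti _ _ (c1 _)).
- by move=> i j k l; apply: (altm_anti _ _ (c2 _ _)).
- by rewrite /m oddB ?oddM //; lia.
- by move=> i j k l lt_ml; rewrite (std_gt basis lt_ml) (lin0 (altm_lin (c3 _ _ _))).
- by move=> i j k l; apply: (hw4_lower basis i j k l hw).
move=> i j k l p /andP[p_gt0 le_pm] /and5P[/and3P[i0 i1 i2] /and3P[j0 j1 j2]
  /and3P[k0 k1 k2] /and3P[l0 l1 l2] _].
have [sm|] := eqVneq (i + j + k + l)%N (2 * m - 1)%N; last exact: supp.
have zero x y z w : (x + y + z + w != 2 * m - 1)%N -> (x + y + z + w != 2 * m)%N ->
    (x + y + z + w != 2 * m + 1)%N -> phi (b x) (b y) (b z) (b w) = 0.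
  move=> s1 s2 s3; apply: (weight_sl0 (phiH x y z w)).
  - by rewrite -natrM !pmulrn -!rmorphB /= eqr_int; lia.
  - by rewrite -natrM !pmulrn -!rmorphB /= intr_eq0; lia.
  - by rewrite -natrM !pmulrn -!rmorphB -rmorphN /= eqr_int; lia.
have := congr1 (fun h : U 5 => sndg (h (b p) (b i) (b j) (b k) (b l))) df.
rewrite dV4E; last by case: inv_f.
have lieE u x : sndg (lie (inV u) x) = - rho (fstg x) u.
  by case: x => X v; rewrite /sndg /= rho0 sub0r.
have sndD := linD sndg_lin; have sndN := linN sndg_lin.
have phE x y z w : fstg (f x y z w) = phi x y z w by [].
rewrite !(sndD, sndN, lieE) !phE (zero p j k l)
  ?(zero p i k l) ?(zero p i j l) ?(zero p i j k); try by lia.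
rewrite !rho0.
rewrite !(opprK, oppr0, addr0) [RHS](_ : _ = 0) // => /eqP; rewrite oppr_eq0 => /eqP.
have w2 : lie H (phi (b i) (b j) (b k) (b l)) = 2 *: phi (b i) (b j) (b k) (b l).
  rewrite phiH; congr (_ *: _); rewrite -natrM !pmulrn -!rmorphB /=.
  by congr (_%:~R); lia.
rewrite (weight_sl2 w2) -psiE (linZ (act_linl rho (b p))).
rewrite -(prednK p_gt0) bE scalerA => /eqP; rewrite scaler_eq0 => /orP[|/eqP b0].
  rewrite mulf_eq0 => /orP[/eqP //|].
  by rewrite mulf_eq0 pnatr_eq0 /= subr_eq0 eqr_nat gtn_eqF //; lia.
have /eqP := std_co basis (i := p.-1) (j := p.-1) ltac:(lia) ltac:(lia).
by rewrite b0 (lin0 (std_lin basis _)) eqxx eq_sym oner_eq0.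
Qed.
End LowDegreeInvariants.

(** * The cohomology of the semidirect product *)

Section Cohomology.
Variables (C : numClosedFieldType) (V : vectType C) (rho : lieModule (sl C 2) V).
Local Notation s := (sl C 2).
Local Notation g := (semidirect rho).
Local Notation H := (slH C).
Local Notation E := (slE C).
Local Notation F := (slF C).
Local Notation d := (dif (@lie _ g) (adjoint g)).
Local Notation dV := (dif (fun _ _ : V => 0 : V) (fun v (x : g) => lie (inV rho v) x)).
Local Notation inS := (inS rho).
Local Notation thV X := (@lieder _ _ _ rho (adS rho) X _).
Local Notation G k := (cur g g k).
Local Notation U k := (cur V g k).
Local Notation Fn k := ({ffun 'I_k -> g} -> g).

Lemma ffcurry_cocycle k (f : Fn k) : is_cochain f -> ce_diff (adjoint g) f = 0 ->
  d (ffcurry f) = 0.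
Proof. by move=> cf df; rewrite -ffcurry_ce_diff // df (lin0 (@ffcurry_lin _ _ _ _)). Qed.

Lemma ffuncurry_cocycle k (f : G k) : altm f -> d f = 0 ->
  is_cochain (ffuncurry f) /\ ce_diff (adjoint g) (ffuncurry f) = 0.
Proof.
move=> cf df; have cu := ffuncurry_cochain cf; split=> //.
rewrite -[LHS](@ffcurryK C g g k.+1) ffcurry_ce_diff // ffuncurryK df.
exact: (lin0 (@ffuncurry_lin _ g g k.+1)).
Qed.

Lemma coboundary_ffcurry k (f : Fn k.+1) : is_coboundary (adjoint g) f <->
  exists2 h : G k, altm h & ffcurry f = d h.
Proof.
split=> [[h ch ->]|[h ch fh]].
  by exists (ffcurry h); [exact: ffcurry_altm | rewrite ffcurry_ce_diff].
have cu := ffuncurry_cochain ch; exists (ffuncurry h) => //.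
rewrite -[LHS](@ffcurryK C g g k.+1) fh -[RHS](@ffcurryK C g g k.+1).
by rewrite ffcurry_ce_diff // ffuncurryK.
Qed.

(** A component of cochains detects a cohomology space when its values, taken
modulo the non-invariant part, vanish exactly on the coboundaries. *)
Lemma component_iso k j (W : lmodType C) (comp : G k.+1 -> U j) (lam : U j -> W) :
  linear comp -> (forall f, altm f -> altm (comp f)) -> linear lam ->
  (forall m, slinv m -> lam m = 0 -> m = 0) ->
  (forall w, exists f, [/\ altm f, d f = 0, slinv (comp f) & lam (comp f) = w]) ->
  (forall f : G k.+1, altm f -> d f = 0 -> noninv (comp f) ->
     exists2 h : G k, altm h & f = d h) ->
  (forall h : G k, altm h -> noninv (comp (d h))) ->
  lmod_iso (cohomology (adjoint g) k.+1) W.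
Proof.
move=> lcomp ccomp llam inj sur ex cob; have [p pr] := inv_split rho j.
set O := casimir _ _ _ in pr.
have lP : linear (pact O p) by apply/pact_lin/(casimir_lin (sl2U rho j)).
apply: (@cohomology_iso _ _ _ _ _ _ (fun f : Fn k.+1 => lam (pact O p (comp (ffcurry f))))).
- by move=> c f h; rewrite ffcurry_lin lcomp lP llam.
- move=> f cf df lam0; apply/coboundary_ffcurry.
  have cu := ffcurry_altm cf; have [inv_u non_u _ _] := pr _ (ccomp _ cu).
  apply: ex => //; first exact: ffcurry_cocycle.
  by rewrite (inj _ inv_u lam0) subr0 in non_u.
- move=> f /coboundary_ffcurry[h ch ->].
  have [_ _ /(_ (cob _ ch)) -> _] := pr _ (ccomp _ (d_altm ch)).
  exact: lin0 llam.
- move=> w; have [f [cf df inv_f fw]] := sur w.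
  have [cu du] := ffuncurry_cocycle cf df; exists (ffuncurry f); split=> //.
  have [_ _ _ /(_ inv_f) Pf] := pr _ (ccomp _ cf).
  by rewrite ffuncurryK Pf.
Qed.

Lemma noninv_of k (m : U k) : altm m -> (forall m' : U k, slinv m' -> noninv (m - m') -> m' = 0) ->
  noninv m.
Proof.
move=> cm m0; have [p pr] := inv_split rho k; have [inv_m non_m _ _] := pr m cm.
by have p0 := m0 _ inv_m non_m; rewrite p0 subr0 in non_m.
Qed.

(** The invariant part of the restriction of a cocycle is a cocycle. *)
Lemma inv_part_cocycle k (f : G k) (m : U k) : altm f -> d f = 0 -> slinv m ->
  noninv (res f - m) -> dV m = 0.
Proof.
move=> cf df inv_m [x [y [z [cx cy cz mE]]]]; have [cm inv1] := inv_m.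
apply: inv_noninv0.
  by split=> [|X]; [exact: dV_altm | rewrite dV_thV // inv1 (lin0 (@dV_lin _ _ rho k))].
have dr : dV (res f) = 0 by rewrite -res_d // df (lin0 (@res_lin _ _ rho k.+1)).
exists (- dV x), (- dV y), (- dV z); split; try by apply/altmN/dV_altm.
have lt X := @lieder_lin _ _ _ rho (adS rho) X k.+1.
rewrite !(linN (lt _)) !dV_thV // -!opprD -!(linD (@dV_lin _ _ rho k)) -mE.
by rewrite (linB (@dV_lin _ _ rho k)) dr sub0r opprK.
Qed.

(** For a coboundary the component on three arguments in sl2 is a sum of images under
E, H and F, because sl2 is unimodular, and of the value of dV on an alternating map. *)
Lemma noninv_top k (h : G k.+3) : dV_inv0 rho k -> altm h ->
  noninv (res (d h (inS E) (inS H) (inS F) : G k.+1)).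
Proof.
move=> d0 ch; have [brEF brHE brEH brHF] := slbr C.
have c1 X := altm_app (inS X) ch; have c2 X Y := altm_app (inS Y) (c1 X).
have c3 : altm (h (inS E) (inS H) (inS F) : G k) by exact: (altm_app _ (c2 E H)).
have lr := @res_lin _ _ rho k.+1.
set hEF := h (inS E) (inS F).
have br1 : h (inS (lie E H)) (inS F) = - (2 *: hEF).
  by rewrite brEH (linN (inS_lin rho)) (linZ (inS_lin rho)) (linN (altm_lin ch))
    (linZ (altm_lin ch)).
have br2 : h (inS E) (inS (lie H F)) = - (2 *: hEF).
  by rewrite brHF (linN (inS_lin rho)) (linZ (inS_lin rho)) (linN (altm_lin (c1 E)))
    (linZ (altm_lin (c1 E))).
rewrite d_contract3 br1 br2 brEF (altm_diag _ ch) subr0 subrK.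
rewrite (linB lr) (linD lr) (linB lr) !res_thS res_d //.
rewrite addrC -scaleN1r; apply: noninv_comb.
  by apply: noninv_dV d0 (res_altm c3).
exists (res (h (inS H) (inS F) : G k.+1)), (- res (hEF : G k.+1)),
  (res (h (inS E) (inS H) : G k.+1)).
split; try exact: (res_altm (c2 _ _)); first exact/altmN/(res_altm (c2 _ _)).
by rewrite (linN (@lieder_lin _ _ _ _ _ _ _)).
Qed.

Variables (n : nat) (b : nat -> V) (co : nat -> V -> C).
Hypothesis n_gt0 : (0 < n)%N.
Hypothesis basis : std_basis rho (2 * n - 1) b co.

Lemma dV_inv0_0 : dV_inv0 rho 0.
Proof. by move=> m /(slinv0 n_gt0 basis) ->; rewrite (lin0 (@dV_lin _ _ rho 0)). Qed.

Lemma dV_inv0_1 : dV_inv0 rho 1.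
Proof.
move=> m inv_m; apply: dV_fst0; first by case: inv_m.
by apply: (slinv_odd_fst n_gt0 basis (t := n%:Z - 1) inv_m); lia.
Qed.

Lemma dV_inv0_2 : dV_inv0 rho 2.
Proof. by move=> m /(slinv2 n_gt0 basis) ->; rewrite (lin0 (@dV_lin _ _ rho 2)). Qed.

Lemma noninv0 (m : U 0) : altm m -> noninv m.
Proof. by move=> cm; apply: noninv_of => // m' /(slinv0 n_gt0 basis). Qed.

Lemma H0_eq0 (x : cohomology (adjoint g) 0) : x = 0.
Proof.
apply: cohomology_eq0 x => f cf df; have du := ffcurry_cocycle cf df.
have inv_f : slinv (ffcurry f : U 0).
  by split=> // X; have := congr1 (fun h : G 1 => h (inS X)) du.
rewrite /is_coboundary -[f](@ffcurryK C g g 0) (slinv0 n_gt0 basis inv_f).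
exact: (lin0 (@ffuncurry_lin _ g g 0)).
Qed.

Lemma H1_iso : lmod_iso (cohomology (adjoint g) 1) C^o.
Proof.
apply: (@component_iso 0 1 _ (@res _ _ rho 1) (lam1 b co)).
- exact: res_lin.
- by move=> f; apply: res_altm.
- exact: lam1_lin basis.
- by move=> m; apply: (lam1_inj n_gt0 basis).
- move=> w; have [m [inv_m dm mw]] := lam1_surj basis w.
  exists (ext m); rewrite res_ext; split=> //; [by case: inv_m => /ext_altm | exact: ext_cocycle].
- by move=> f cf df; apply: exact1 dV_inv0_0 cf df _.
- by move=> h ch; rewrite res_d //; apply: noninv_dV dV_inv0_0 (res_altm ch).
Qed.

Lemma H2_eq0 (x : cohomology (adjoint g) 2) : x = 0.
Proof.
apply: cohomology_eq0 x => f cf df; apply/coboundary_ffcurry.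
have cu := ffcurry_altm cf.
apply: (exact2 dV_inv0_1 cu (ffcurry_cocycle cf df)) => //.
by apply: noninv_of (res_altm cu) _ => m' /(slinv2 n_gt0 basis).
Qed.

Lemma H3_iso : lmod_iso (cohomology (adjoint g) 3) 'rV[C]_((n + 1) %/ 3).
Proof.
apply: (@component_iso 2 3 'rV[C]_((n + 1) %/ 3) (@res _ _ rho 3) (@lam3 _ _ rho n b co)).
- exact: res_lin.
- by move=> f; apply: res_altm.
- exact: lam3_lin basis.
- by move=> m; apply: (lam3_inj n_gt0 basis).
- move=> w; have [m [inv_m dm mw]] := lam3_surj n_gt0 basis w.
  exists (ext m); rewrite res_ext; split=> //; [by case: inv_m => /ext_altm | exact: ext_cocycle].
- move=> f cf df nf; apply: exact3 dV_inv0_2 cf df nf _.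
  exact: noninv0.
- by move=> h ch; rewrite res_d //; apply: noninv_dV dV_inv0_2 (res_altm ch).
Qed.

Lemma dV_inv0_3 : dV_inv0 rho 3.
Proof.
move=> m inv_m; apply: dV_fst0; first by case: inv_m.
exact: (slinv3_fst n_gt0 basis).
Qed.

Lemma noninv4 (f : G 4) : altm f -> d f = 0 -> noninv (res f).
Proof.
move=> cf df; apply: noninv_of (res_altm cf) _ => m inv_m non_m.
exact: (slinv4 n_gt0 basis inv_m (inv_part_cocycle cf df inv_m non_m)).
Qed.

Lemma H4_iso : lmod_iso (cohomology (adjoint g) 4) C^o.
Proof.
apply: (@component_iso 3 1 _ (fun f => @res _ _ rho 1 (f (inS E) (inS H) (inS F))) (lam1 b co)).
- by move=> c f h; rewrite -res_lin.
- by move=> f cf; apply: res_altm; do 3!apply: altm_app.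
- exact: lam1_lin basis.
- by move=> m; apply: (lam1_inj n_gt0 basis).
- move=> w; have [m [inv_m dm mw]] := lam1_surj basis w.
  have cm : altm m by case: inv_m.
  exists (vol m); rewrite vol_EHF // res_ext; split=> //; [exact: vol_altm | exact: vol_cocycle].
- by move=> f cf df nf; exact: (exact3 dV_inv0_3 cf df (noninv4 cf df) nf).
- by move=> h ch; exact: (noninv_top dV_inv0_0 ch).
Qed.

End Cohomology.

Theorem proposition3p20 (R : realType) (n : nat) (n_ge1 : (1 <= n)%N)
    (V : vectType R[i]) (rho : lieModule (sl R[i] 2) V)
    (V_irr : lie_irreducible rho)
    (V_dim : \dim {:V} = (2 * n - 1).+1%N) :
  let g : lieAlgType R[i] := semidirect rho in
  let H (k : nat) : lmodType R[i] := cohomology (adjoint g) k in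
  [/\ (forall x : H 0%N, x = 0),
      lmod_iso (H 1%N) R[i]^o,
      (forall x : H 2%N, x = 0),
      lmod_iso (H 3%N) 'rV[R[i]]_((n + 1) %/ 3)
    & lmod_iso (H 4%N) R[i]^o].
Proof.
move=> g H; have [b [co basis]] := irreducible_std_basis V_irr V_dim.
split.
- exact: (H0_eq0 n_ge1 basis).
- exact: (H1_iso n_ge1 basis).
- exact: (H2_eq0 n_ge1 basis).
- exact: (H3_iso n_ge1 basis).
- exact: (H4_iso n_ge1 basis).
Qed.
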